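(* Let $K$ be a field complete with respect to a nontrivial non-Archimedean absolute value. Let $A$ be an affinoid $K$-algebra whose underlying ring is an integral domain. Let $\mathcal{E}$ be the field of fractions of $A$ and let $B \subseteq \mathcal{E}$ be the normalization of $A$ (the integral closure of $A$ in $\mathcal{E}$). Denote by $\mathbb{X}(\mathcal{E})$ the set of all discrete valuations of the field $\mathcal{E}$, and for $v\in\mathbb{X}(\mathcal{E})$ let $\mathcal{O}_v\subseteq\mathcal{E}$ be the valuation ring of $v$. Then $$\bigcap_{v \in \mathbb{X}(\mathcal{E})} \mathcal{O}_v = \begin{cases} B^\circ & \text{if $K$ is discretely valued},\\ B & \text{if $K$ is not discretely valued},\end{cases}$$ where $B^\circ$ is the subring of power-bounded elements of $B$.
   Context: Affinoid algebras: for $n\ge 1$ the Tate algebra is $$T_n=\Big\{\sum_{\alpha\in\mathbb{Z}_{\ge 0}^n}c_\alpha z_1^{\alpha_1}\cdots z_n^{\alpha_n}\in K[[z_1,\dots,z_n]] : c_\alpha\to 0 \text{ as } |\alpha|=\sum_i\alpha_i\to\infty\Big\},$$ and $T_0=K$; it is a Banach $K$-algebra for the Gauss norm $\max_\alpha|c_\alpha|$. An affinoid $K$-algebra is a $K$-algebra isomorphic (as an abstract $K$-algebra) to a quotient $T_n/I$ for some $n$ and some ideal $I$. All ideals of $T_n$ are closed, and the quotient topology on an affinoid $K$-algebra (which is induced by a Banach algebra norm) does not depend on the chosen presentation; affinoid algebras carry this canonical topology. The normalization $B$ of an affinoid integral domain $A$ is finite over $A$ and is itself an affinoid $K$-algebra.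 Power-bounded elements: for a normed ring $(B,\|\cdot\|)$, $B^\circ$ consists of the $x\in B$ with $\sup_{n\ge 0}\|x^n\|<\infty$; for an affinoid algebra one uses any Banach norm inducing the canonical topology. Discrete valuations: a discrete valuation of a field $F$ is a surjection $v:F\to\mathbb{Z}\cup\{\infty\}$ with $v(a)=\infty$ iff $a=0$, $v(ab)=v(a)+v(b)$, and $v(a+b)\ge\min\{v(a),v(b)\}$; its valuation ring is $\mathcal{O}_v=\{a\in F: v(a)\ge 0\}$. No compatibility of $v$ with the absolute value of $K$ is required. An empty intersection of subrings of $\mathcal{E}$ is understood to be $\mathcal{E}$. $K$ is discretely valued if its ring of integers $\mathcal{O}_K=\{x\in K:|x|\le 1\}$ is a discrete valuation ring. *)

(* Defs.v *)
From HB Require Import structures.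
From mathcomp Require Import all_boot all_order all_algebra.
From mathcomp Require Import mathcomp_extra boolp classical_sets functions.
From mathcomp Require Import cardinality fsbigop reals constructive_ereal.

Set Implicit Arguments.
Unset Strict Implicit.
Unset Printing Implicit Defensive.

Import Order.TTheory GRing.Theory Num.Theory.

Local Open Scope classical_set_scope.
Local Open Scope ring_scope.

Record nonarch_absval (R : realType) (K : fieldType) := NonarchAbsval {
  absval :> K -> R;
  absval_ge0 : forall x, 0 <= absval x;
  absval_eq0 : forall x, absval x = 0 <-> x = 0;
  absvalM : forall x y, absval (x * y) = absval x * absval y;
  absvalD : forall x y, absval (x + y) <= Num.max (absval x) (absval y) }.

Definition nontrivial_absval (R : realType) (K : fieldType)
    (abs : nonarch_absval R K) : Prop :=
  exists x : K, x != 0 /\ abs x != 1.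

Section Norm.
Variables (R : realType) (V : zmodType) (N : V -> R).

Definition cauchy_for (u : nat -> V) : Prop :=
  forall e : R, 0 < e ->
  exists n0 : nat, forall i j : nat,
    (n0 <= i)%N -> (n0 <= j)%N -> N (u i - u j) < e.

Definition converges_for (u : nat -> V) (l : V) : Prop :=
  forall e : R, 0 < e ->
  exists n0 : nat, forall i : nat, (n0 <= i)%N -> N (u i - l) < e.

Definition complete_for : Prop :=
  forall u : nat -> V, cauchy_for u -> exists l : V, converges_for u l.

Definition open_for (U : set V) : Prop :=
  forall x, U x -> exists2 e : R, 0 < e & forall y, N (y - x) < e -> U y.

End Norm.

Definition discrete_valuations (F : fieldType) : set (F -> \bar int) :=
  [set v | [/\ range v = [set~ -oo%E],
               forall a, v a = +oo%E <-> a = 0,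
               forall a b, v (a * b) = (v a + v b)%E
             & forall a b, (Order.min (v a) (v b) <= v (a + b)%R)%E]].

Definition valuation_ring (F : fieldType) (v : F -> \bar int) : set F :=
  [set a | (0 <= v a)%E].

(* A subring S of F is a discrete valuation ring with fraction field F iff it
   is the valuation ring of a discrete valuation of F.  The ring of integers
   of K always has fraction field K. *)
Definition discrete_valuation_ring (F : fieldType) (S : set F) : Prop :=
  exists2 w, discrete_valuations w & S = valuation_ring w.

Definition ring_of_integers (R : realType) (K : fieldType)
    (abs : nonarch_absval R K) : set K :=
  [set x | abs x <= 1].

Definition discretely_valued (R : realType) (K : fieldType)
    (abs : nonarch_absval R K) : Prop :=
  discrete_valuation_ring (ring_of_integers abs).

Section AbsvalTheory.
Variables (R : realType) (K : fieldType) (abs : nonarch_absval R K).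

Lemma absval0 : abs 0 = 0. Proof. exact/absval_eq0. Qed.

Lemma absval1 : abs 1 = 1.
Proof.
have a1 : abs 1 != 0 by apply/eqP => /absval_eq0/eqP; rewrite oner_eq0.
by apply: (mulfI a1); rewrite mulr1 -absvalM mulr1.
Qed.

Lemma absvalN x : abs (- x) = abs x.
Proof.
have aN1 : abs (- 1) = 1.
  apply/eqP; rewrite -(@eqrXn2 _ 2) ?absval_ge0 // expr2 -absvalM.
  by rewrite mulrNN mulr1 absval1 expr1n.
by rewrite -mulN1r absvalM aN1 mul1r.
Qed.

Lemma absval_sum_lt (I : Type) (r : seq I) (P : pred I) (F : I -> K) (e : R) :
  0 < e -> (forall i, P i -> abs (F i) < e) ->
  abs (\sum_(i <- r | P i) F i) < e.
Proof.
move=> e0 Fe; apply: (big_ind (fun x => abs x < e)); rewrite ?absval0 //.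
by move=> x y xe ye; rewrite (le_lt_trans (absvalD abs x y)) // gt_max xe ye.
Qed.

End AbsvalTheory.

Definition mindex (n : nat) := {ffun 'I_n -> nat}.
HB.instance Definition _ n := GRing.Nmodule.on (mindex n).

Definition mdegree n (a : mindex n) : nat := (\sum_(i < n) a i)%N.

Definition antidiag n (a : mindex n) : set (mindex n * mindex n) :=
  [set p | p.1 + p.2 = a].

(* f stands for the sum over a of f a * z_0 ^ (a 0) * ... * z_(n-1) ^ (a (n-1)). *)
Record pseries (K : fieldType) (n : nat) := PSeries {
  pscoef :> mindex n -> K }.

Section PowerSeries.
Variables (K : fieldType) (n : nat).
Implicit Types (f g h : pseries K n) (a b : mindex n).

HB.instance Definition _ := [isNew for @pscoef K n].
HB.instance Definition _ := gen_eqMixin (pseries K n).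
HB.instance Definition _ := gen_choiceMixin (pseries K n).

Lemma psP f g : (forall a, f a = g a) -> f = g.
Proof. by case: f g => [f] [g] /= fg; congr PSeries; apply/funext. Qed.

Definition ps_zero : pseries K n := PSeries (fun=> 0).
Definition ps_opp f : pseries K n := PSeries (fun a => - f a).
Definition ps_add f g : pseries K n := PSeries (fun a => f a + g a).

Definition psC (c : K) : pseries K n :=
  PSeries (fun a => if a == 0 then c else 0).

Definition ps_mul f g : pseries K n :=
  PSeries (fun a => \sum_(p \in antidiag a) f p.1 * g p.2).

Fact ps_addA : associative ps_add.
Proof. by move=> f g h; apply: psP => a /=; rewrite addrA. Qed.
Fact ps_addC : commutative ps_add.
Proof. by move=> f g; apply: psP => a /=; rewrite addrC. Qed.
Fact ps_add0 : left_id ps_zero ps_add.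
Proof. by move=> f; apply: psP => a /=; rewrite add0r. Qed.
Fact ps_addN : left_inverse ps_zero ps_opp ps_add.
Proof. by move=> f; apply: psP => a /=; rewrite addNr. Qed.

HB.instance Definition _ :=
  GRing.isZmodule.Build (pseries K n) ps_addA ps_addC ps_add0 ps_addN.

Definition mbox (N : nat) (u : {ffun 'I_n -> 'I_N.+1}) : mindex n :=
  [ffun i => u i : nat].

Lemma mbox_inj N : injective (@mbox N).
Proof.
move=> u v uv; apply/ffunP => i; apply: val_inj.
by move/ffunP: uv => /(_ i); rewrite !ffunE.
Qed.

Lemma mbox_surj N a : (forall i, (a i <= N)%N) ->
  exists u : {ffun 'I_n -> 'I_N.+1}, mbox u = a.
Proof.
move=> aN; exists [ffun i => inord (a i)]; apply/ffunP => i.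
by rewrite !ffunE inordK ?ltnS.
Qed.

Lemma antidiag_sumE N a (F : mindex n * mindex n -> K) :
  (forall i, (a i <= N)%N) ->
  \sum_(p \in antidiag a) F p =
  \sum_(u : {ffun 'I_n -> 'I_N.+1})
    \sum_(v : {ffun 'I_n -> 'I_N.+1} | mbox u + mbox v == a)
      F (mbox u, mbox v).
Proof.
move=> aN; pose W := {ffun 'I_n -> 'I_N.+1}.
pose P := [pred p : W * W | mbox p.1 + mbox p.2 == a].
pose w (p : W * W) := (mbox p.1, mbox p.2).
rewrite (pair_big_dep xpredT (fun u v => mbox u + mbox v == a)
  (fun u v => F (mbox u, mbox v))) /=.
rewrite (@bigfs _ _ _ _ _ P (fun p => F (w p))) ?index_enum_uniq //; last first.
  by move=> i _; rewrite mem_index_enum.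
apply: reindex_fsbig; split.
- by move=> p /eqP.
- move=> p q _ _ [] /mbox_inj p1 /mbox_inj p2.
  by case: p q p1 p2 => [? ?] [? ?] /= -> ->.
- move=> [b c] /= bca.
  have [i|u bu] := @mbox_surj N b.
    by rewrite (leq_trans _ (aN i)) // -bca ffunE leq_addr.
  have [i|v cv] := @mbox_surj N c.
    by rewrite (leq_trans _ (aN i)) // -bca ffunE leq_addl.
  by exists (u, v); rewrite /w /P /= ?inE /= bu cv //; apply/eqP.
Qed.

Lemma leq_mdegree a i : (a i <= mdegree a)%N.
Proof. by rewrite /mdegree (bigD1 i) //= leq_addr. Qed.

Lemma ps_mulE N f g a : (forall i, (a i <= N)%N) ->
  ps_mul f g a =
  \sum_(u : {ffun 'I_n -> 'I_N.+1}) \sum_(v : {ffun 'I_n -> 'I_N.+1})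
     if mbox u + mbox v == a then f (mbox u) * g (mbox v) else 0.
Proof.
move=> aN; rewrite /= (antidiag_sumE _ aN).
by apply: eq_bigr => u _; rewrite big_mkcond.
Qed.

Fact ps_mulC : commutative ps_mul.
Proof.
move=> f g; apply: psP => a; rewrite !(ps_mulE _ _ (leq_mdegree a)).
rewrite exchange_big; apply: eq_bigr => u _; apply: eq_bigr => v _.
by rewrite addrC mulrC.
Qed.

Fact ps_mulDl : left_distributive ps_mul ps_add.
Proof.
move=> f g h; apply: psP => a; rewrite [RHS]/=.
rewrite -[X in _ = X + _]/(ps_mul f h a) -[X in _ = _ + X]/(ps_mul g h a).
rewrite !(ps_mulE _ _ (leq_mdegree a)) -big_split.
apply: eq_bigr => u _; rewrite -big_split; apply: eq_bigr => v _ /=.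
by case: ifP; rewrite ?mulrDl ?addr0.
Qed.

Fact ps_mul1 : left_id (psC 1) ps_mul.
Proof.
move=> f; apply: psP => a; rewrite (ps_mulE _ _ (leq_mdegree a)).
have [i|z z0] := @mbox_surj (mdegree a) 0; first by rewrite ffunE.
have [w wa] := mbox_surj (leq_mdegree a).
rewrite (bigD1 z) //= [X in _ + X]big1 ?addr0 => [|u uz]; last first.
  have /negPf uN0 : mbox u != 0.
    by apply: contra uz => /eqP e; apply/eqP/mbox_inj; rewrite z0.
  by rewrite big1 // => v _; rewrite /= uN0 mul0r if_same.
rewrite (bigD1 w) //= [X in _ + X]big1 ?addr0 => [|u uw].
  by rewrite z0 add0r wa !eqxx mul1r.
rewrite ifN // z0 add0r; apply: contra uw => /eqP e.
by apply/eqP/mbox_inj; rewrite e.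
Qed.

Lemma ps_mulAE N f g h a : (forall i, (a i <= N)%N) ->
  ps_mul f (ps_mul g h) a =
  \sum_(u : {ffun 'I_n -> 'I_N.+1}) \sum_(v : {ffun 'I_n -> 'I_N.+1})
  \sum_(w : {ffun 'I_n -> 'I_N.+1})
     if mbox u + (mbox v + mbox w) == a
     then f (mbox u) * (g (mbox v) * h (mbox w)) else 0.
Proof.
move=> aN; rewrite (ps_mulE _ _ aN); apply: eq_bigr => u _.
have xN (x : {ffun 'I_n -> 'I_N.+1}) i : (mbox x i <= N)%N.
  by rewrite ffunE -ltnS.
under eq_bigr => x _.
  rewrite (ps_mulE _ _ (xN x)) mulr_sumr -if_neg.
  under eq_bigr => v _ do rewrite mulr_sumr.
  over.
transitivity (\sum_(x : {ffun 'I_n -> 'I_N.+1})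
  \sum_(v : {ffun 'I_n -> 'I_N.+1}) \sum_(w : {ffun 'I_n -> 'I_N.+1})
   if (mbox u + mbox x == a) && (mbox v + mbox w == mbox x)
   then f (mbox u) * (g (mbox v) * h (mbox w)) else 0).
  apply: eq_bigr => x _; case: eqP => _ /=.
    apply: eq_bigr => v _; apply: eq_bigr => w _.
    by case: eqP; rewrite ?mulr0.
  by rewrite big1 // => v _; rewrite big1.
rewrite exchange_big; apply: eq_bigr => v _.
rewrite exchange_big; apply: eq_bigr => w _ /=.
case: eqP => [e|ne]; last first.
  rewrite big1 // => x _; case: eqP => //= e1; case: eqP => //= e2.
  by rewrite e2 in ne.
have [i|x xe] := @mbox_surj N (mbox v + mbox w).
  by rewrite (leq_trans _ (aN i)) // -e [leqRHS]ffunE leq_addl.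
rewrite (bigD1 x) //= xe e !eqxx /= big1 ?addr0 // => y yx.
rewrite andbC; case: eqP => //= e2; case/negP: yx.
by apply/eqP/mbox_inj; rewrite -e2.
Qed.

Fact ps_mulA : associative ps_mul.
Proof.
move=> f g h; rewrite [RHS]ps_mulC; apply: psP => a.
rewrite !(ps_mulAE _ _ _ (leq_mdegree a)).
rewrite [RHS]exchange_big; apply: eq_bigr => u _.
rewrite [RHS]exchange_big; apply: eq_bigr => v _; apply: eq_bigr => w _ /=.
by rewrite [mbox w + _]addrC -addrA [h _ * _]mulrC mulrA.
Qed.

Fact ps_oner_neq0 : psC 1 != 0.
Proof.
apply/eqP => /(congr1 (fun f : pseries K n => f 0)) /=.
by rewrite eqxx => /eqP; rewrite oner_eq0.
Qed.

HB.instance Definition _ := GRing.Zmodule_isComNzRing.Build (pseries K n)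
  ps_mulA ps_mulC ps_mul1 ps_mulDl ps_oner_neq0.

End PowerSeries.

Section Tate.
Variables (R : realType) (K : fieldType) (abs : nonarch_absval R K) (n : nat).
Implicit Types (f g : pseries K n) (a b : mindex n).

Definition coef_vanishes f : Prop :=
  forall e : R, 0 < e ->
  exists d : nat, forall a, (d <= mdegree a)%N -> abs (f a) < e.

Definition tate_pred : {pred pseries K n} := fun f => `[< coef_vanishes f >].

Lemma mdegreeD a b : mdegree (a + b) = (mdegree a + mdegree b)%N.
Proof.
by rewrite /mdegree -big_split; apply: eq_bigr => i _; rewrite ffunE.
Qed.

Lemma coef_vanishes_bounded f : coef_vanishes f ->
  exists2 M : R, 0 < M & forall a, abs (f a) < M.
Proof.
move=> /(_ 1 ltr01)[d fd].
pose S : R := \sum_(u : {ffun 'I_n -> 'I_d.+1}) abs (f (mbox u)).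
have S0 : 0 <= S by apply: sumr_ge0 => u _; exact: absval_ge0.
exists (1 + S) => [|a]; first by rewrite ltr_pwDl.
have [da|ad] := leqP d (mdegree a); first by rewrite ltr_wpDr ?fd.
have [i|u <-] := @mbox_surj n d a.
  by rewrite (leq_trans (leq_mdegree a i)) // ltnW.
rewrite ltr_pwDl // /S (bigD1 u) //= lerDl sumr_ge0 // => v _.
exact: absval_ge0.
Qed.

Lemma coef_vanishesC c : coef_vanishes (psC n c).
Proof.
move=> e e0; exists 1%N => a a1; rewrite /= ifN ?absval0 //.
apply: contraTneq a1 => ->; rewrite /mdegree big1 // => i _.
by rewrite ffunE.
Qed.

Lemma coef_vanishesB f g :
  coef_vanishes f -> coef_vanishes g -> coef_vanishes (f - g).
Proof.
move=> fv gv e e0; have [df fd] := fv e e0; have [dg gd] := gv e e0.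
exists (maxn df dg) => a; rewrite geq_max => /andP[/fd fe /gd ge] /=.
by rewrite (le_lt_trans (absvalD _ _ _)) // gt_max fe absvalN.
Qed.

Lemma coef_vanishesM f g :
  coef_vanishes f -> coef_vanishes g -> coef_vanishes (f * g).
Proof.
move=> fv gv e e0.
have [Mf Mf0 fM] := coef_vanishes_bounded fv.
have [Mg Mg0 gM] := coef_vanishes_bounded gv.
have [df fd] := fv _ (divr_gt0 e0 Mg0); have [dg gd] := gv _ (divr_gt0 e0 Mf0).
exists (df + dg)%N => a da; rewrite [(f * g) a](antidiag_sumE _ (leq_mdegree a)).
apply: absval_sum_lt => // u _; apply: absval_sum_lt => // v /eqP uva.
have {}da : (df + dg <= mdegree (mbox u) + mdegree (mbox v))%N.
  by rewrite -mdegreeD uva.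
rewrite absvalM.
have [ud|ud] := leqP df (mdegree (mbox u)).
  by rewrite -(divfK (lt0r_neq0 Mg0) e) ltr_pM ?absval_ge0 ?fd.
have vd : (dg <= mdegree (mbox v))%N.
  rewrite leqNgt; apply/negP => vd.
  by move: (leq_add (ltnW ud) vd); rewrite addnS => lt; rewrite leqNgt lt in da.
by rewrite -(divfK (lt0r_neq0 Mf0) e) mulrC ltr_pM ?absval_ge0 ?gd.
Qed.

Fact tate_pred_subring : subring_closed tate_pred.
Proof.
split=> [|f g /asboolP fv /asboolP gv|f g /asboolP fv /asboolP gv];
  apply/asboolP.
- exact: coef_vanishesC.
- exact: coef_vanishesB.
- exact: coef_vanishesM.
Qed.

HB.instance Definition _ :=
  GRing.isSubringClosed.Build (pseries K n) tate_pred tate_pred_subring.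

Record tate := Tate {
  tate_pseries :> pseries K n;
  _ : tate_pseries \in tate_pred }.

HB.instance Definition _ := [isSub for tate_pseries].
HB.instance Definition _ := [Choice of tate by <:].
HB.instance Definition _ := [SubChoice_isSubComNzRing of tate by <:].

Definition tateC (c : K) : tate := Tate (asboolT (coef_vanishesC c)).

(* The supremum is attained, since the coefficients tend to 0. *)
Definition gauss_norm (f : tate) : R := sup (range (fun a => abs (f a))).

End Tate.

Section Normalization.
Variable A : idomainType.

Definition integral_pred : {pred {fraction A}} :=
  fun x => `[< integralOver (@tofrac A) x >].

Fact integral_pred_subring : subring_closed integral_pred.
Proof.
split=> [|x y /asboolP ix /asboolP iy|x y /asboolP ix /asboolP iy];
  apply/asboolP.
- exact: integral1.
- exact: integral_sub.
- exact: integral_mul.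
Qed.

HB.instance Definition _ := GRing.isSubringClosed.Build {fraction A}
  integral_pred integral_pred_subring.

Record normalization := Normalization {
  normalization_val :> {fraction A};
  _ : normalization_val \in integral_pred }.

HB.instance Definition _ := [isSub for normalization_val].
HB.instance Definition _ := [Choice of normalization by <:].
HB.instance Definition _ := [SubChoice_isSubComNzRing of normalization by <:].

Definition to_normalization (x : A) : normalization :=
  Normalization (asboolT (integral_id (@tofrac A) x)).

Fact to_normalization_zmod_morphism : zmod_morphism to_normalization.
Proof. by move=> x y; apply: val_inj; rewrite /= rmorphB. Qed.
Fact to_normalization_monoid_morphism : monoid_morphism to_normalization.
Proof. by split=> [|x y]; apply: val_inj; rewrite /= ?rmorph1 ?rmorphM. Qed.

HB.instance Definition _ := GRing.isZmodMorphism.Build A normalization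
  to_normalization to_normalization_zmod_morphism.
HB.instance Definition _ := GRing.isMonoidMorphism.Build A normalization
  to_normalization to_normalization_monoid_morphism.

Definition normalization_scalar (K : fieldType) (iota : {rmorphism K -> A}) :
  {rmorphism K -> normalization} := to_normalization \o iota.

End Normalization.

(* A K-algebra is a commutative ring A with a ring morphism iota from K. *)
Section Affinoid.
Variables (R : realType) (K : fieldType) (abs : nonarch_absval R K).
Variables (A : comNzRingType) (iota : {rmorphism K -> A}).

Definition affinoid_presentation (n : nat) (I : idealr (tate abs n))
    (phi : {rmorphism {ideal_quot I} -> A}) : Prop :=
  bijective phi /\
  forall c, phi (\pi_{ideal_quot I}%qT (tateC abs n c)) = iota c.

Definition affinoid : Prop :=
  exists (n : nat) (I : idealr (tate abs n))
         (phi : {rmorphism {ideal_quot I} -> A}), affinoid_presentation phi.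

Definition banach_algebra_norm (N : A -> R) : Prop :=
  [/\ forall x, N x = 0 <-> x = 0,
      forall x y, N (x + y) <= Num.max (N x) (N y),
      N 1 = 1 /\ (forall x y, N (x * y) <= N x * N y),
      forall c x, N (iota c * x) = abs c * N x
    & complete_for N].

(* The quotient topology on T_n / I does not depend on the presentation. *)
Definition induces_canonical_topology (N : A -> R) : Prop :=
  exists (n : nat) (I : idealr (tate abs n))
         (phi : {rmorphism {ideal_quot I} -> A}),
    affinoid_presentation phi /\
    forall U : set A, open_for N U <->
      open_for (@gauss_norm R K abs n)
        [set f | U (phi (\pi_{ideal_quot I}%qT f))].

(* All such norms N are equivalent, and so define the same power-bounded
   elements. *)
Definition power_bounded : set A :=
  [set x | exists N : A -> R,
    [/\ banach_algebra_norm N, induces_canonical_topology N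
      & has_ubound (range (fun k => N (x ^+ k)))]].

End Affinoid.

(* Main.v *)
Require Import Defs.
From HB Require Import structures.
From mathcomp Require Import all_boot all_order all_algebra.
From mathcomp Require Import mathcomp_extra boolp classical_sets functions.
From mathcomp Require Import cardinality fsbigop reals constructive_ereal.
From mathcomp Require Import ring lra zify.

Set Implicit Arguments.
Unset Strict Implicit.
Unset Printing Implicit Defensive.

Import Order.TTheory GRing.Theory Num.Theory.

Local Open Scope classical_set_scope.
Local Open Scope ring_scope.

(* Let E be the fraction field of A.  For c in K with |c| < 1 and f power-bounded, 1 + c f
   has roots of order l^k for all k, for some l with |l| = 1; hence a discrete valuation
   cannot be negative at c f, and it is nonnegative on power-bounded elements.  It is
   also trivial on K unless K is discretely valued, and then it is nonnegative on all
   of A, hence on B.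

   Conversely, by Noether normalization A is finite over a Tate algebra T, and discrete
   valuations of Frac T extend to E up to scaling.  By Gauss's lemma the minimal
   polynomial over Frac T of an element x of the intersection then has coefficients at
   which all discrete valuations of Frac T are nonnegative.  Such coefficients lie in
   T: by Weierstrass preparation and induction on the dimension, if g does not divide f
   in T then some discrete valuation satisfies v(f) < v(g).  So x is in B.

   If K is discretely valued with uniformizer t, then these coefficients even have
   Gauss norm at most 1, because the Gauss norm is a discrete valuation.  A Groebner
   basis argument with spectral leading exponents and Dickson's lemma shows that the
   intersection S is finite over the unit ball of T.  As B = S[1/t], the gauge norm of S
   is a Banach norm on B, for which B is a strict quotient of a Tate algebra; the
   elements of S have bounded powers for it. *)

(** * Complete ultrametric rings *)

(** The valuations in question are unrelated to the absolute value of K; extraction of roots is the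
    bridge. Its order l is 2 or 3, whichever has absolute value 1, so every residue characteristic
    is covered. The field E may be inseparable over Frac T, so a trace form cannot place S in a
    finite module over the unit ball of T. Leading exponents do this instead. They need a valuation
    of Frac T whose residue field is that of K: the Gauss norm refined by a lexicographic order. It
    is in general not of rank one, so it and its extensions are handled as valuation rings, obtained
    by Zorn's lemma, and an element x is measured through x^N, where N clears the denominators of
    all slopes that can occur. Power-boundedness asks for an actual Banach norm, homogeneous over K
    and inducing the canonical topology. The gauge of S is homogeneous because all values of K are
    powers of |t|; finite generation of S makes it complete and turns B into a strict quotient. *)

Lemma geom_small (R : realType) (M r e : R) : 0 <= r -> r < 1 -> 0 < e ->
  exists n : nat, M * r ^+ n < e.
Proof.
move=> r0 r1 e0.
have [M0|M0] := leP M 0; first by exists 0; rewrite (le_lt_trans _ e0) // expr0 mulr1.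
have [->|rN0] := eqVneq r 0; first by exists 1%N; rewrite expr1 mulr0.
have rgt0 : 0 < r by rewrite lt0r rN0.
have q1 : 0 < r^-1 - 1 by rewrite subr_gt0 invf_gt1.
have e'0 : 0 < e / M by rewrite divr_gt0.
have bern k : 1 + k%:R * (r^-1 - 1) <= (r^-1) ^+ k.
  elim: k => [|k IH]; first by rewrite mul0r addr0 expr0.
  have s1 : 1 <= r^-1 by rewrite -subr_ge0 ltW.
  rewrite exprS (le_trans _ (ler_wpM2l _ IH)) ?invr_ge0 //.
  rewrite -subr_ge0 -(natr1 k).
  have -> : r^-1 * (1 + k%:R * (r^-1 - 1)) - (1 + (k%:R + 1) * (r^-1 - 1)) =
    k%:R * (r^-1 - 1) ^+ 2 by ring.
  by rewrite mulr_ge0 // sqr_ge0.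
have [k kM] : exists k : nat, (M / e) / (r^-1 - 1) < k%:R.
  exists (Num.trunc (M / e / (r^-1 - 1))).+1.
  by rewrite truncnS_gt.
exists k; rewrite -ltr_pdivlMl // mulrC -(invrK r) exprVn.
rewrite -[ltRHS]invrK ltf_pV2 ?posrE ?exprn_gt0 ?invr_gt0 //.
rewrite (lt_le_trans _ (bern k)) // invf_div.
by rewrite ltr_pdivrMr // in kM; rewrite (lt_le_trans kM) // lerDr.
Qed.

Section UltrametricNorm.
Variables (R : realType) (C : comNzRingType) (N : C -> R).

(** Instances are [abs] on K, the Gauss norms and the gauge norm on the normalization. Symmetry is a
    field because a bare ring has no scalar -1 of known norm. *)
Record unorm : Prop := UNorm {
  unorm0 : forall x, N x = 0 <-> x = 0;
  unormD : forall x y, N (x + y) <= Num.max (N x) (N y);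
  unormN : forall x, N (- x) = N x;
  unormM : forall x y, N (x * y) <= N x * N y;
  unorm1 : N 1 = 1;
  unorm_complete : complete_for N }.

Definition null_seq (u : nat -> C) := converges_for N u 0.

Definition ssum (u : nat -> C) : C :=
  xget 0 [set l | converges_for N (fun k => \sum_(i < k) u i) l].

Hypothesis uN : unorm.

Implicit Types (x y l : C) (u w : nat -> C).

Lemma unorm_ge0 x : 0 <= N x.
Proof.
have /(unorm0 uN) <- : 0 = 0 :> C by [].
rewrite -(subrr x); apply: le_trans (unormD uN _ _) _.
by rewrite (unormN uN) maxxx.
Qed.

Lemma unorm_0 : N 0 = 0. Proof. exact/(unorm0 uN). Qed.

Lemma unormBC x y : N (x - y) = N (y - x).
Proof. by rewrite -opprB (unormN uN). Qed.

Lemma unormD_le e x y : N x <= e -> N y <= e -> N (x + y) <= e.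
Proof. by move=> xe ye; rewrite (le_trans (unormD uN x y)) // ge_max xe. Qed.

Lemma unormB_le e x y : N x <= e -> N y <= e -> N (x - y) <= e.
Proof. by move=> xe ye; rewrite unormD_le // (unormN uN). Qed.

Lemma unormD_lt e x y : N x < e -> N y < e -> N (x + y) < e.
Proof. by move=> xe ye; rewrite (le_lt_trans (unormD uN x y)) // gt_max xe. Qed.

Lemma unormB_lt e x y : N x < e -> N y < e -> N (x - y) < e.
Proof. by move=> xe ye; rewrite unormD_lt // (unormN uN). Qed.

Lemma unorm_sum_le (I : Type) (r : seq I) (P : pred I) (F : I -> C) (e : R) :
  0 <= e -> (forall i, P i -> N (F i) <= e) -> N (\sum_(i <- r | P i) F i) <= e.
Proof.
move=> e0 Fe; apply: (big_ind (fun x => N x <= e)); rewrite ?unorm_0 //.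
by move=> x y; apply: unormD_le.
Qed.

Lemma unorm_sum_lt (I : Type) (r : seq I) (P : pred I) (F : I -> C) (e : R) :
  0 < e -> (forall i, P i -> N (F i) < e) -> N (\sum_(i <- r | P i) F i) < e.
Proof.
move=> e0 Fe; apply: (big_ind (fun x => N x < e)); rewrite ?unorm_0 //.
by move=> x y; apply: unormD_lt.
Qed.

Lemma unorm_eq0_small x : (forall e : R, 0 < e -> N x < e) -> x = 0.
Proof.
move=> xe; apply/(unorm0 uN)/eqP; rewrite eq_le unorm_ge0 andbT.
by rewrite leNgt; apply/negP => /xe; rewrite ltxx.
Qed.

Lemma unormX_le1 x k : N x <= 1 -> N (x ^+ k) <= 1.
Proof.
move=> x1; elim: k => [|k IH]; first by rewrite expr0 (unorm1 uN).
rewrite exprS (le_trans (unormM uN _ _)) //.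
by rewrite -(mulr1 1) ler_pM ?unorm_ge0.
Qed.

Lemma unorm_prod_le1 (I : Type) (r : seq I) (F : I -> C) :
  (forall i, N (F i) <= 1) -> N (\prod_(i <- r) F i) <= 1.
Proof.
move=> F1; apply: (big_ind (fun x => N x <= 1)) => //; first by rewrite (unorm1 uN).
move=> x y x1 y1; rewrite (le_trans (unormM uN _ _)) //.
by rewrite -(mulr1 1) ler_pM ?unorm_ge0.
Qed.

Lemma cvg_for_unique u l l' :
  converges_for N u l -> converges_for N u l' -> l = l'.
Proof.
move=> ul ul'; apply/eqP; rewrite -subr_eq0; apply/eqP/unorm_eq0_small => e e0.
have [n nl] := ul _ e0; have [n' nl'] := ul' _ e0.
have -> : l - l' = (u (maxn n n') - l') - (u (maxn n n') - l).
  by ring.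
by apply: unormB_lt; [apply: nl'; rewrite leq_maxr|apply: nl; rewrite leq_maxl].
Qed.

Lemma cvg_forD u w l m : converges_for N u l -> converges_for N w m ->
  converges_for N (fun k => u k + w k) (l + m).
Proof.
move=> ul wm e e0; have [n nl] := ul _ e0; have [n' nm] := wm _ e0.
exists (maxn n n') => i; rewrite geq_max => /andP[ni n'i].
by rewrite opprD addrACA unormD_lt ?nl ?nm.
Qed.

Lemma cvg_for_le u l a M : converges_for N u l ->
  (exists n0, forall i, (n0 <= i)%N -> N (u i - a) <= M) -> N (l - a) <= M.
Proof.
move=> ul [n0 uM]; rewrite leNgt; apply/negP => Ml.
have M0 : 0 < N (l - a) by rewrite (le_lt_trans _ Ml) // (le_trans _ (uM n0 _)) ?unorm_ge0.
have [n nl] := ul _ M0; pose k := maxn n n0.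
suff : N (l - a) < N (l - a) by rewrite ltxx.
have {1}-> : l - a = (u k - a) - (u k - l) by ring.
apply: unormB_lt; first exact: le_lt_trans (uM k (leq_maxr _ _)) Ml.
exact: nl (leq_maxl _ _).
Qed.

Lemma null_summable u : null_seq u ->
  converges_for N (fun k => \sum_(i < k) u i) (ssum u).
Proof.
move=> u0; rewrite /ssum.
suff [l ul] : exists l, converges_for N (fun k => \sum_(i < k) u i) l.
  by case: xgetP => [y -> //|/(_ l)].
apply: (unorm_complete uN) => e e0; have [n0 un] := u0 _ e0.
have key i j : (n0 <= i)%N -> (i <= j)%N ->
    N (\sum_(k < j) u k - \sum_(k < i) u k) < e.
  move=> ni ij; rewrite -!(big_mkord xpredT) /= (big_cat_nat (leq0n i) ij) //= addrAC subrr add0r.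
  rewrite big_nat_cond; apply: unorm_sum_lt => // k /andP[/andP[ik _] _].
  by rewrite -(subr0 (u k)) un // (leq_trans ni).
exists n0 => i j ni nj; have [ij|/ltnW ji] := leqP i j; last exact: key.
by rewrite unormBC; exact: key.
Qed.

Lemma ssumE u l : converges_for N (fun k => \sum_(i < k) u i) l -> ssum u = l.
Proof.
move=> ul; apply: cvg_for_unique (ul).
by rewrite /ssum; case: xgetP => [y -> //|/(_ l)].
Qed.

Lemma null_seqD u w : null_seq u -> null_seq w -> null_seq (fun i => u i + w i).
Proof. by move=> u0 w0; have := cvg_forD u0 w0; rewrite addr0. Qed.

Lemma ssumD u w : null_seq u -> null_seq w ->
  ssum (fun i => u i + w i) = ssum u + ssum w.
Proof.
move=> u0 w0; apply: ssumE.
have -> : (fun k => \sum_(i < k) (u i + w i)) =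
          (fun k => \sum_(i < k) u i + \sum_(i < k) w i).
  by apply/funext => k; rewrite big_split.
by apply: cvg_forD; apply: null_summable.
Qed.

Lemma ssum_le u M : 0 <= M -> null_seq u -> (forall i, N (u i) <= M) ->
  N (ssum u) <= M.
Proof.
move=> M0 u0 uM; rewrite -(subr0 (ssum u)).
apply: cvg_for_le (null_summable u0) _; exists 0 => i _.
by rewrite subr0 unorm_sum_le.
Qed.

Lemma ssum_telescope u : null_seq u -> ssum (fun k => u k - u k.+1) = u 0.
Proof.
move=> u0; apply: ssumE => e e0; have [n un] := u0 _ e0.
exists n => i ni; suff -> : \sum_(k < i) (u k - u k.+1) - u 0 = - u i.
  by rewrite (unormN uN) -(subr0 (u i)) un.
elim: {ni} i => [|i IH]; first by rewrite big_ord0 sub0r.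
by rewrite big_ord_recr /= addrAC IH addKr.
Qed.

Lemma ssum_single u i0 : (forall i, i != i0 -> u i = 0) -> ssum u = u i0.
Proof.
move=> u0; apply: ssumE => e e0; exists i0.+1 => i i0i.
rewrite (bigD1 (Ordinal i0i)) //= big1 ?addr0 ?subrr ?unorm_0 // => j ji.
by apply: u0; apply: contraNneq ji => e'; apply/eqP/val_inj.
Qed.

Lemma null_seq_geom (u : nat -> C) (M r : R) : 0 <= r -> r < 1 ->
  (forall k, N (u k) <= M * r ^+ k) -> null_seq u.
Proof.
move=> r0 r1 uM e e0.
suff [n nM] : exists n, M * r ^+ n < e.
  exists n => i ni; rewrite subr0 (le_lt_trans (uM i)) //.
  have [M0|M0] := leP 0 M; last first.
    by rewrite (le_lt_trans _ e0) // nmulr_rle0 // exprn_ge0.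
  by rewrite (le_lt_trans _ nM) // ler_wpM2l // ler_wiXn2l // ltW.
exact: geom_small.
Qed.

End UltrametricNorm.

Lemma ssum_map (R : realType) (C C' : comNzRingType) (N : C -> R) (N' : C' -> R)
    (phi : C -> C') (M : R) (u : nat -> C) :
  unorm N -> unorm N' -> {morph phi : x y / x + y} ->
  0 < M -> (forall x, N' (phi x) <= M * N x) ->
  null_seq N u ->
  null_seq N' (fun k => phi (u k)) /\ phi (ssum N u) = ssum N' (fun k => phi (u k)).
Proof.
move=> uN uN' phiD M0 phiM u0.
have phi0 : phi 0 = 0.
  by apply: (addrI (phi 0)); rewrite -phiD !addr0.
have phiB : {morph phi : x y / x - y}.
  move=> x y; apply: (addIr (phi y)); rewrite -phiD !subrK //.
have cvg w l : converges_for N w l -> converges_for N' (fun k => phi (w k)) (phi l).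
  move=> wl e e0; have [n wn] := wl _ (divr_gt0 e0 M0); exists n => i /wn.
  by rewrite -phiB ltr_pdivlMr // mulrC; apply: le_lt_trans.
split; first by have := cvg _ _ u0; rewrite phi0.
apply/esym/ssumE => //; have := cvg _ _ (null_summable uN u0).
congr converges_for; apply/funext => k; elim: k => [|k IH]; first by rewrite !big_ord0.
by rewrite !big_ord_recr phiD IH.
Qed.

Section RealRoots.
Variables (R : realType) (C : comNzRingType) (N : C -> R) (uN : unorm N).

(* Newton-type iteration: y solves (1 + y)^l = 1 + x iff y is a fixed point of
   the contraction y |-> l^-1 (x - h y), where h y = (1 + y)^l - 1 - l y. *)
Lemma root_one_plus (l : nat) (c : C) (x : C) :
  c * l%:R = 1 -> N c <= 1 -> N x < 1 ->
  exists2 y, N y <= N x & (1 + y) ^+ l = 1 + x.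
Proof.
move=> cl c1 x1; pose r := N x; have r0 : 0 <= r := unorm_ge0 uN x.
pose h (y : C) : C := (1 + y) ^+ l - 1 - l%:R * y.
have pw i y : N y <= r -> N ((1 + y) ^+ i - 1) <= r.
  move=> yr; rewrite -{2}(expr1n _ i) subrXX -addrAC subrr add0r.
  rewrite (le_trans (unormM uN _ _)) // -[leRHS]mulr1 ler_pM ?unorm_ge0 //.
  apply: unorm_sum_le => // j _; rewrite expr1n mulr1.
  by rewrite unormX_le1 // unormD_le ?(unorm1 uN) // (le_trans yr) // ltW.
(* The sum has l terms; subtracting 1 from each accounts for the linear term l y of h, and each
   difference has norm at most r. *)
have hB y z : N y <= r -> N z <= r -> N (h y - h z) <= r * N (y - z).
  move=> yr zr; have -> : h y - h z = (y - z) *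
      \sum_(i < l) ((1 + y) ^+ (l.-1 - i) * (1 + z) ^+ i - 1).
    rewrite sumrB sumr_const card_ord.
    have := subrXX (1 + y) (1 + z) l; set sm := \sum_(i < l) _ => e.
    rewrite /h mulrBr; have -> : (y - z) * sm = (1 + y) ^+ l - (1 + z) ^+ l.
      by rewrite e; ring.
    by ring.
  apply: le_trans (unormM uN _ _) _.
  rewrite mulrC ler_wpM2r ?unorm_ge0 //.
  apply: unorm_sum_le => // i _.
  set a := _ ^+ _; set b := _ ^+ _.
  have -> : a * b - 1 = (a - 1) * (b - 1) + (a - 1) + (b - 1) by ring.
  have ar : N (a - 1) <= r by apply: pw.
  have br : N (b - 1) <= r by apply: pw.
  do 2!apply: unormD_le => //; apply: le_trans (unormM uN _ _) _.
  rewrite -[leRHS]mulr1 ler_pM ?unorm_ge0 //.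
  by rewrite (le_trans br) // ltW.
have h0 : h 0 = 0 by rewrite /h addr0 expr1n mulr0; ring.
have hr y : N y <= r -> N (h y) <= r.
  move=> yr; have := hB y 0 yr; rewrite h0 !subr0 unorm_0 // => /(_ r0).
  move=> /le_trans; apply.
  by rewrite -[leRHS]mulr1 ler_pM ?unorm_ge0 // (le_trans yr) // ltW.
pose Phi (y : C) : C := c * (x - h y).
have Phir y : N y <= r -> N (Phi y) <= r.
  move=> yr; rewrite (le_trans (unormM uN _ _)) // -[leRHS]mul1r.
  by rewrite ler_pM ?unorm_ge0 // unormB_le // hr.
have PhiB y z : N y <= r -> N z <= r -> N (Phi y - Phi z) <= r * N (y - z).
  move=> yr zr; have -> : Phi y - Phi z = c * (h z - h y) by rewrite /Phi; ring.
  rewrite (le_trans (unormM uN _ _)) // -[leRHS]mul1r ler_pM ?unorm_ge0 //.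
  by rewrite (unormBC uN y) hB.
pose s k := iter k Phi 0.
have sr k : N (s k) <= r by elim: k => [|k IH]; rewrite ?unorm_0 //=; apply: Phir.
pose u k := s k.+1 - s k.
have ur k : N (u k) <= 1 * r ^+ k.
  elim: k => [|k IH]; first by rewrite /u /= subr0 expr0 mulr1 (le_trans (sr 1)) // ltW.
  have -> : u k.+1 = Phi (s k.+1) - Phi (s k) by [].
  apply: le_trans (PhiB _ _ (sr k.+1) (sr k)) _.
  by rewrite mul1r exprS ler_wpM2l // -[leRHS]mul1r.
have u0 : null_seq N u by apply: null_seq_geom ur.
have su : (fun k => \sum_(i < k) u i) = s.
  apply/funext; elim=> [|k IH]; first by rewrite big_ord0.
  by rewrite big_ord_recr /= IH /u addrC subrK.
have := null_summable uN u0; rewrite su; set y := ssum N u => sy.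
have yr : N y <= r.
  rewrite -(subr0 y); apply: cvg_for_le sy _ => //; exists 0 => i _.
  by rewrite subr0.
exists y => //.
have yfix : y = Phi y.
  apply/eqP; rewrite -subr_eq0; apply/eqP/(unorm_eq0_small uN) => e e0.
  have [n sn] := sy _ e0.
  have -> : y - Phi y = (Phi (s n) - Phi y) - (s n.+1 - y) by rewrite /=; ring.
  apply: unormB_lt => //; last exact: sn.
  apply: le_lt_trans (PhiB _ _ (sr n) yr) _.
  apply: le_lt_trans (sn n (leqnn n)).
  by rewrite -[leRHS]mul1r ler_wpM2r ?unorm_ge0 // ltW.
have : l%:R * y = x - h y by rewrite {1}yfix /Phi mulrA (mulrC l%:R) cl mul1r.
by rewrite /h => /eqP; rewrite eq_sym subr_eq => /eqP ->; ring.
Qed.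

End RealRoots.

(** * Discrete valuations *)

Section RingValuations.

(* The value of lam at 0 is junk. *)
Definition rval (L : idomainType) (lam : L -> int) : Prop :=
  (forall x y, x != 0 -> y != 0 -> lam (x * y) = lam x + lam y) /\
  (forall x y, x != 0 -> y != 0 -> x + y != 0 ->
     Num.min (lam x) (lam y) <= lam (x + y)).

Variables (L : idomainType) (lam : L -> int) (lamP : rval lam).

Lemma rvalM x y : x != 0 -> y != 0 -> lam (x * y) = lam x + lam y.
Proof. exact: lamP.1. Qed.

Lemma rval1 : lam 1 = 0.
Proof. by apply: (addIr (lam 1)); rewrite -rvalM ?oner_eq0 // mulr1 add0r. Qed.

Lemma rvalX x k : x != 0 -> lam (x ^+ k) = lam x *+ k.
Proof.
move=> x0; elim: k => [|k IH]; first by rewrite expr0 rval1.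
by rewrite exprS rvalM ?expf_neq0 // IH mulrS.
Qed.

Lemma rvalN x : x != 0 -> lam (- x) = lam x.
Proof.
move=> x0; rewrite -mulN1r rvalM ?oppr_eq0 ?oner_eq0 //.
have : lam ((- 1) ^+ 2) = lam (- 1) *+ 2 by rewrite rvalX // oppr_eq0 oner_eq0.
rewrite sqrrN expr1n rval1 => /esym/eqP; rewrite mulrn_eq0 /= => /eqP ->.
by rewrite add0r.
Qed.

Lemma rval_add x y : x != 0 -> (y != 0 -> lam x < lam y) ->
  x + y != 0 /\ lam (x + y) = lam x.
Proof.
move=> x0; have [->|y0 /(_ isT) xy] := eqVneq y 0; first by rewrite addr0.
have xy0 : x + y != 0.
  apply/eqP => e; have : lam y = lam x.
    have -> : x = - y by apply/eqP; rewrite -addr_eq0 e.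
    by rewrite rvalN.
  by move=> e'; rewrite e' ltxx in xy.
split=> //; apply/eqP; rewrite eq_le; apply/andP; split.
  rewrite leNgt; apply/negP => lt.
  have := lamP.2 (x + y) (- y); rewrite addrK oppr_eq0 rvalN // => /(_ xy0 y0 x0).
  by rewrite leNgt lt_min lt xy.
by have := lamP.2 _ _ x0 y0 xy0; rewrite min_l // ltW.
Qed.

End RingValuations.

Lemma rvalV (L : fieldType) (lam : L -> int) (x : L) :
  rval lam -> x != 0 -> lam x^-1 = - lam x.
Proof.
move=> lamP x0; apply/eqP; rewrite -addr_eq0 addrC -rvalM ?invr_eq0 //.
by rewrite divff // (rval1 lamP).
Qed.

Lemma rval_comp (L L' : idomainType) (h : {rmorphism L -> L'}) (lam : L' -> int) :
  injective h -> rval lam -> rval (lam \o h).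
Proof.
move=> hI [lM lD]; have h0 x : x != 0 -> h x != 0.
  by apply: contraNneq => e; apply/eqP/hI; rewrite e rmorph0.
split=> x y x0 y0 /=; first by rewrite rmorphM lM ?h0.
by move=> xy0; rewrite rmorphD lD ?h0 // -rmorphD h0.
Qed.

Lemma fracE (T : idomainType) (q : {fraction T}) :
  exists a b : T, b != 0 /\ q = tofrac a / tofrac b.
Proof.
elim/quotW: q => x; exists \n_x, \d_x; split; first exact: denom_ratioP.
have d0 := denom_ratioP x.
suff e : \pi_{fraction T}%qT x * tofrac \d_x = tofrac \n_x.
  by rewrite -e mulfK // tofrac_eq0.
unlock FracField.tofrac; rewrite -[LHS]FracField.pi_mul.
apply/eqmodP; rewrite /= FracField.equivfE /FracField.mulf.
by rewrite !numden_Ratio ?oner_eq0 ?mulf_neq0 ?oner_eq0 // ?mul1r ?mulr1 mulrC.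
Qed.

Lemma tofrac_inj (T : idomainType) : injective (@tofrac T).
Proof. by move=> x y /eqP; rewrite tofrac_eq => /eqP. Qed.

Lemma rval_fraction (T : idomainType) (lam : T -> int) : rval lam ->
  exists lam' : {fraction T} -> int, rval lam' /\
    forall x, x != 0 -> lam' (tofrac x) = lam x.
Proof.
move=> lamP.
have /choice[nd ndP] : forall q : {fraction T}, exists p : T * T,
    p.2 != 0 /\ q = tofrac p.1 / tofrac p.2.
  by move=> q; have [a [b [b0 ->]]] := fracE q; exists (a, b).
pose lam' q := lam (nd q).1 - lam (nd q).2.
have lamE (a b : T) : a != 0 -> b != 0 -> lam' (tofrac a / tofrac b) = lam a - lam b.
  move=> a0 b0; rewrite /lam'; set q := _ / _.
  have [d0 qE] := ndP q; set c := (nd q).1 in qE *; set d := (nd q).2 in d0 qE *.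
  have e : a * d = c * b.
    apply: tofrac_inj; rewrite !rmorphM; apply/eqP.
    by rewrite -eqr_div ?tofrac_eq0 // -qE.
  have c0 : c != 0.
    apply: contraTneq isT => c0; move/eqP: e; rewrite c0 mul0r mulf_eq0.
    by rewrite (negPf a0) (negPf d0).
  move/(congr1 lam): e; rewrite !rvalM // => e.
  by apply/eqP; rewrite subr_eq addrAC eq_sym subr_eq e.
exists lam'; split; last first.
  move=> x x0; have := lamE x 1 x0 (oner_neq0 _).
  by rewrite rmorph1 divr1 rval1 // subr0.
have nz (a b : T) : b != 0 -> tofrac a / tofrac b != 0 -> a != 0.
  by move=> b0; apply: contraNneq => ->; rewrite rmorph0 mul0r.
split=> x y; have [a [b [b0 ->]]] := fracE x; have [c [d [d0 ->]]] := fracE y.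
  move=> /(nz _ _ b0) a0 /(nz _ _ d0) c0.
  rewrite mulf_div -!rmorphM !lamE ?mulf_neq0 // !rvalM //; ring.
move=> /(nz _ _ b0) a0 /(nz _ _ d0) c0.
rewrite addf_div ?tofrac_eq0 // -!rmorphM -rmorphD.
have bd0 : b * d != 0 by rewrite mulf_neq0.
move=> /(nz _ _ bd0) s0; rewrite !lamE ?mulf_neq0 //.
have := lamP.2 (a * d) (c * b); rewrite !mulf_neq0 //= => /(_ isT isT s0).
rewrite !rvalM // !ge_min => /orP[] ?; apply/orP; [left|right]; lra.
Qed.

Section FieldValuations.
Variable F : fieldType.

(** The values of lam form a nonzero subgroup of the integers, generated by its least positive
    element g; division by g makes lam surjective. Hence arbitrary integer-valued valuations can be
    used in place of normalized ones. *)
Lemma rval_normalize (lam : F -> int) (c : F) :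
  rval lam -> c != 0 -> lam c != 0 ->
  exists2 v, discrete_valuations v &
    forall a, a != 0 -> (0 <= v a)%E = (0 <= lam a).
Proof.
move=> lamP c0 lc0.
pose P (k : nat) := `[< (0 < k)%N /\ exists2 a, a != 0 & lam a = k%:Z >].
have exP : exists k, P k.
  exists `|lam c|%N; apply/asboolP; split; first by rewrite absz_gt0.
  have [lc|lc] := leP 0 (lam c); first by exists c => //; rewrite gez0_abs.
  by exists c^-1; rewrite ?invr_eq0 // rvalV // ltz0_abs.
have [g /asboolP[g0 [u u0 lu]] gmin] := ex_minnP exP.
have gz : g%:Z != 0 by rewrite -lt0n in g0 *; lia.
have lamg (a : F) : a != 0 -> lam a = (lam a %/ g%:Z)%Z * g%:Z.
  move=> a0; have := divz_eq (lam a) g%:Z; set q := (_ %/ _)%Z => E.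
  suff m0 : (lam a %% g%:Z)%Z = 0 by rewrite {1}E m0 addr0.
  have [b b0 lb] : exists2 b, b != 0 & lam b = (lam a %% g%:Z)%Z.
    case: q E => q E; [exists (a / u ^+ q)|exists (a * u ^+ q.+1)].
    - by rewrite mulf_neq0 ?invr_eq0 ?expf_neq0.
    - rewrite rvalM ?invr_eq0 ?expf_neq0 // rvalV ?expf_neq0 // rvalX // lu.
      by rewrite {1}E -mulr_natr mulrC; lia.
    - by rewrite mulf_neq0 ?expf_neq0.
    - rewrite rvalM ?expf_neq0 // rvalX // lu.
      by rewrite {1}E NegzE -mulr_natr; lia.
  have m0 := modz_ge0 (lam a) gz; have := ltz_pmod (lam a) (_ : 0 < g%:Z).
  rewrite -lb in m0 * => /(_ _)/wrap[]; first by lia.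
  move=> lt; apply/eqP; rewrite -[_ == _]negbK; apply/negP => n0.
  have /gmin : P `|lam b|%N.
    apply/asboolP; split; first by rewrite absz_gt0.
    by exists b => //; rewrite gez0_abs.
  lia.
pose v (a : F) : \bar int := if a == 0 then +oo%E else (lam a %/ g%:Z)%Z%:E.
have vE (a : F) : a != 0 -> v a = (lam a %/ g%:Z)%Z%:E by rewrite /v => /negPf ->.
have v0 : v 0 = +oo%E by rewrite /v eqxx.
have dM (a b : F) : a != 0 -> b != 0 ->
    (lam (a * b) %/ g%:Z)%Z = (lam a %/ g%:Z)%Z + (lam b %/ g%:Z)%Z.
  move=> a0 b0; apply: (mulIf gz); rewrite mulrDl -!lamg ?mulf_neq0 //.
  by rewrite rvalM.
exists v; last first.
  move=> a a0; rewrite vE // lee_fin [in RHS]lamg //.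
  by rewrite pmulr_lge0 //; lia.
split.
- apply/seteqP; split=> [_ [a _ <-]|[z| |]] //=.
  + by rewrite /v; case: ifP.
  + move=> _; have du : (lam u %/ g%:Z)%Z = 1 by rewrite lu divzz gz.
    have dX k : (lam (u ^+ k) %/ g%:Z)%Z = k%:Z.
      elim: k => [|k IH]; first by rewrite expr0 (rval1 lamP) div0z.
      by rewrite exprS dM ?expf_neq0 // du IH; lia.
    have dV (a : F) : a != 0 -> (lam a^-1 %/ g%:Z)%Z = - (lam a %/ g%:Z)%Z.
      move=> a0; apply/eqP; rewrite -addr_eq0 -dM ?invr_eq0 // mulVf //.
      by rewrite (rval1 lamP) div0z.
    case: z => k; [exists (u ^+ k)|exists (u ^- k.+1)] => //.
      by rewrite vE ?expf_neq0 // dX.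
    by rewrite vE ?invr_eq0 ?expf_neq0 // dV ?expf_neq0 // dX NegzE.
  + by move=> _; exists 0.
- move=> a; split; last by move=> ->.
  by rewrite /v; case: eqP.
- move=> a b; have [->|a0] := eqVneq a 0.
    by rewrite mul0r v0 /v; case: ifP.
  have [->|b0] := eqVneq b 0; first by rewrite mulr0 v0 /v; case: ifP.
  by rewrite !vE ?mulf_neq0 // dM.
- move=> a b; have [->|a0] := eqVneq a 0.
    by rewrite add0r v0 ge_min lexx orbT.
  have [->|b0] := eqVneq b 0; first by rewrite addr0 ge_min lexx.
  have [ab|ab0] := eqVneq (a + b) 0; first by rewrite ab v0 leey.
  rewrite !vE // -EFin_min lee_fin.
  have := lamP.2 _ _ a0 b0 ab0.
  rewrite (lamg _ a0) (lamg _ b0) (lamg _ ab0) !(mulzK _ gz).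
  rewrite -minr_pMl; last by lia.
  by rewrite ler_pM2r //; lia.
Qed.

Lemma discrete_valuations_rval (v : F -> \bar int) : discrete_valuations v ->
  exists lam : F -> int, [/\ rval lam, forall a, a != 0 -> v a = (lam a)%:E
    & exists2 u, u != 0 & lam u = 1].
Proof.
move=> [vr v0 vM vD].
have vE (a : F) : a != 0 -> v a = (fine (v a))%:E.
  move=> a0; have : range v (v a) by exists a.
  rewrite vr; case E : (v a) => [z| |] //= _.
  by move/v0: E => /eqP; rewrite (negPf a0).
pose lam a := fine (v a); rewrite -/(lam _) in vE.
have {}vE : forall a, a != 0 -> v a = (lam a)%:E by [].
move: lam vE => lam vE; exists lam; split=> //.
- split=> a b a0 b0.
    by have := vM a b; rewrite !vE ?mulf_neq0 // -EFinD => -[].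
  by move=> ab0; have := vD a b; rewrite !vE // -EFin_min lee_fin.
have : range v 1%:E by rewrite vr.
move=> [u _ vu]; have u0 : u != 0 by apply/eqP => /v0; rewrite vu.
by exists u => //; move: vu; rewrite vE // => -[].
Qed.

End FieldValuations.

(* If lam (h x) < 0 then lam (h (1 + x)) = lam (h x), which is divisible by all the
   powers of l, since 1 + x has roots of order l^k. *)
Lemma rval_ge0_of_roots (R : realType) (C : comNzRingType) (N : C -> R)
    (L : fieldType) (h : {rmorphism C -> L}) (lam : L -> int)
    (l : nat) (c x : C) :
  unorm N -> rval lam -> (1 < l)%N -> c * l%:R = 1 -> N c <= 1 ->
  N x < 1 -> h x != 0 -> 0 <= lam (h x).
Proof.
move=> uN lamP l1 cl c1 x1 hx0; rewrite leNgt; apply/negP => lx.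
have [|s0 lamE] := @rval_add _ _ lamP (h x) 1 hx0.
  by rewrite (rval1 lamP).
have rt k : exists2 y, N y < 1 & (1 + y) ^+ (l ^ k) = 1 + x.
  elim: k => [|k [y y1 yE]]; first by exists x; rewrite ?expn0.
  have [z zy zE] := root_one_plus uN cl c1 y1.
  by exists z; [apply: le_lt_trans y1|rewrite expnS exprM zE yE].
have [y y1 yE] := rt `|lam (h x)|%N.
have hy0 : h (1 + y) != 0.
  apply: contraNneq s0 => e; rewrite addrC -(rmorph1 h) -rmorphD -yE rmorphXn e.
  by rewrite expr0n gtn_eqF ?expn_gt0 ?(ltn_trans _ l1).
have : lam (h x) = lam (h (1 + y)) *+ (l ^ `|lam (h x)|%N).
  by rewrite -{1}lamE addrC -(rmorph1 h) -rmorphD -yE rmorphXn rvalX.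
have := ltn_expl `|lam (h x)|%N l1; move: (l ^ _)%N => p.
rewrite -mulr_natr; move: (lam (h (1 + y))) (lam (h x)) lx => z m m0 mp E.
have z0 : z < 0 by nia.
by nia.
Qed.

Section AbsvalNat.
Variables (R : realType) (K : fieldType) (abs : nonarch_absval R K).

Lemma unorm_absval : complete_for abs -> unorm abs.
Proof.
split=> //; [exact: absval_eq0|exact: absvalD|exact: absvalN| |exact: absval1].
by move=> x y; rewrite absvalM.
Qed.

Lemma absvalX x k : abs (x ^+ k) = abs x ^+ k.
Proof.
elim: k => [|k IH]; first by rewrite !expr0 absval1.
by rewrite !exprS absvalM IH.
Qed.

Lemma absvalV x : abs x^-1 = (abs x)^-1.
Proof.
have [->|x0] := eqVneq x 0; first by rewrite invr0 absval0 invr0.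
have ax : abs x != 0 by apply: contraNneq x0 => /absval_eq0/eqP.
by apply: (mulfI ax); rewrite -absvalM !divff // absval1.
Qed.

Lemma absval_gt0 x : x != 0 -> 0 < abs x.
Proof.
move=> x0; rewrite lt0r absval_ge0 andbT.
by apply: contraNneq x0 => /absval_eq0/eqP.
Qed.

Lemma absval_nat k : abs k%:R <= 1.
Proof.
elim: k => [|k IH]; first by rewrite absval0.
by rewrite -natr1 (le_trans (absvalD _ _ _)) // ge_max IH absval1 lexx.
Qed.

(* 2 and 3 are coprime, so they are not both of absolute value < 1. *)
Lemma absval_unit_nat : exists2 l : nat, (1 < l)%N & abs l%:R = 1.
Proof.
have [l l1 al] : exists2 l : nat, (1 < l)%N & 1 <= abs l%:R.
  have [?|a2] := leP 1 (abs 2%:R); first by exists 2%N.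
  have [?|a3] := leP 1 (abs 3%:R); first by exists 3%N.
  have : abs (3%:R - 2%:R) < 1.
    by rewrite (le_lt_trans (absvalD _ _ _)) // gt_max absvalN a3.
  by rewrite -natrB // absval1 ltxx.
by exists l => //; apply/eqP; rewrite eq_le absval_nat.
Qed.

Lemma nontrivial_small : nontrivial_absval abs ->
  exists c, [/\ c != 0, 0 < abs c & abs c < 1].
Proof.
move=> [x [x0 x1]]; have [lt|ge] := ltP (abs x) 1.
  by exists x; split => //; exact: absval_gt0.
have gt : 1 < abs x by rewrite lt_neqAle eq_sym x1.
exists x^-1; split; first by rewrite invr_eq0.
  by rewrite absvalV invr_gt0 absval_gt0.
by rewrite absvalV invf_lt1 ?absval_gt0.
Qed.

End AbsvalNat.

Section PositivityOfValuations.
Variables (R : realType) (K : fieldType) (abs : nonarch_absval R K).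
Variables (C : comNzRingType) (N : C -> R) (iota : {rmorphism K -> C}).
Variables (L : fieldType) (h : {rmorphism C -> L}) (lam : L -> int).
Hypotheses (abs_nontrivial : nontrivial_absval abs) (uN : unorm N).
Hypothesis N_iota : forall c x, N (iota c * x) = abs c * N x.
Hypothesis lamP : rval lam.

Lemma rval_ge0_small x : N x < 1 -> h x != 0 -> 0 <= lam (h x).
Proof.
have [l l1 al] := absval_unit_nat abs.
have l0 : l%:R != 0 :> K.
  by apply: contra_eq_neq al => ->; rewrite absval0 eq_sym oner_neq0.
apply: (@rval_ge0_of_roots _ _ N L h lam l (iota l%:R^-1)) => //.
  by rewrite -(rmorph_nat iota) -rmorphM mulVf // rmorph1.
by rewrite -[iota _]mulr1 N_iota (unorm1 uN) absvalV al invr1 mulr1.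
Qed.

(** For a suitable scalar c^s all products c^s x^k have norm less than 1, so lam (c^s) + k lam x >=
    0 for every k, which excludes lam x < 0. *)
Lemma rval_ge0_bounded x M : (forall k, N (x ^+ k) <= M) -> h x != 0 ->
  0 <= lam (h x).
Proof.
move=> xM hx0; have [c [c0 ac0 ac1]] := nontrivial_small abs_nontrivial.
have [s sM] := geom_small M (ltW ac0) ac1 ltr01.
have hc : h (iota (c ^+ s)) != 0 by rewrite -[h _]/((h \o iota) _) fmorph_eq0 expf_neq0.
have key k : 0 <= lam (h (iota (c ^+ s))) + lam (h x) *+ k.
  rewrite -rvalX // -rvalM ?expf_neq0 // -rmorphXn -rmorphM rval_ge0_small //.
    rewrite N_iota absvalX (le_lt_trans _ sM) // mulrC ler_wpM2r //.
    by rewrite exprn_ge0 // ltW.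
  by rewrite rmorphM mulf_neq0 // rmorphXn expf_neq0.
rewrite leNgt; apply/negP => lt; have := key `|lam (h (iota (c ^+ s)))|.+1%N.
by rewrite -mulr_natr; move: (lam (h (iota _))) (lam (h x)) lt => a b; nia.
Qed.

End PositivityOfValuations.

(** * Tate algebras *)

Lemma seq_max (T : eqType) (le : T -> T -> Prop) (s : seq T) (x0 : T) :
  (forall x y, le x y \/ le y x) -> (forall x y z, le x y -> le y z -> le x z) ->
  x0 \in s -> exists2 x, x \in s & forall y, y \in s -> le y x.
Proof.
move=> tot tr; elim: s x0 => // a s IH x0 _.
case: s IH => [_|b s /(_ b (mem_head _ _))[m ms mP]].
  exists a; first exact: mem_head.
  by move=> y; rewrite inE => /eqP ->; case: (tot a a).
have [am|ma] := tot a m.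
  exists m; first by rewrite inE ms orbT.
  by move=> y; rewrite inE => /orP[/eqP -> //|/mP].
exists a; first exact: mem_head.
move=> y; rewrite inE => /orP[/eqP -> |/mP ym]; last exact: tr ym ma.
by case: (tot a a).
Qed.

Section MultiIndices.
Variable n : nat.

(** The full box of side d: a finite list containing all exponents of degree at most d. *)
Definition mons (d : nat) : seq (mindex n) :=
  [seq mbox u | u <- enum {ffun 'I_n -> 'I_d.+1}].

Lemma mem_mons d (a : mindex n) : (mdegree a <= d)%N -> a \in mons d.
Proof.
move=> ad; have [i|u <-] := @mbox_surj n d a.
  exact: leq_trans (leq_mdegree a i) ad.
by apply: map_f; rewrite mem_enum.
Qed.

Definition mpickle (a : mindex n) : nat := pickle (a : {ffun 'I_n -> nat}).

Definition munpickle (i : nat) : option (mindex n) :=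
  @pickle_inv {ffun 'I_n -> nat} i.

Lemma mpickleK a : munpickle (mpickle a) = Some a.
Proof. exact: pickleK_inv. Qed.

Lemma munpickleK i a : munpickle i = Some a -> mpickle a = i.
Proof. by move=> e; have := @pickle_invK {ffun 'I_n -> nat} i; rewrite /oapp -/(munpickle i) e. Qed.

End MultiIndices.

Section IndexedSums.
Variables (R : realType) (C : comNzRingType) (N : C -> R) (uN : unorm N) (n : nat).

Definition null_family (G : mindex n -> C) : Prop :=
  forall e : R, 0 < e ->
  exists d : nat, forall a, (d <= mdegree a)%N -> N (G a) < e.

(** Exponents are enumerated by [pickle], so that a null family becomes a null sequence; numbers
    that code no exponent contribute 0. *)
Definition pterm (G : mindex n -> C) (i : nat) : C :=
  if munpickle n i is Some a then G a else 0.

Definition psum (G : mindex n -> C) : C := ssum N (pterm G).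

Lemma null_pterm G : null_family G -> null_seq N (pterm G).
Proof.
move=> G0 e e0; have [d Gd] := G0 e e0.
exists (\max_(a <- mons n d) (mpickle a).+1)%N => i di; rewrite subr0 /pterm.
case E: (munpickle n i) => [a|]; last by rewrite unorm_0.
apply: Gd; rewrite leqNgt; apply/negP => /ltnW/mem_mons am.
have := leq_bigmax_seq _ am isT (F := fun a => (mpickle a).+1).
by rewrite (munpickleK E) => /leq_trans/(_ di); rewrite ltnn.
Qed.

Lemma psumD G G' : null_family G -> null_family G' ->
  psum (fun a => G a + G' a) = psum G + psum G'.
Proof.
move=> G0 G0'; rewrite /psum -(ssumD uN (null_pterm G0) (null_pterm G0')).
have -> : pterm (fun a => G a + G' a) = (fun i => pterm G i + pterm G' i).
  by apply/funext => i; rewrite /pterm; case: (munpickle n i) => [//|]; rewrite addr0.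
by [].
Qed.

Lemma psum_le G M : 0 <= M -> null_family G -> (forall a, N (G a) <= M) ->
  N (psum G) <= M.
Proof.
move=> M0 G0 GM; apply: ssum_le => //; first exact: null_pterm.
by move=> i; rewrite /pterm; case: (munpickle n i) => [a|]; rewrite ?unorm_0.
Qed.

Lemma psum_single G a : (forall b, b != a -> G b = 0) -> psum G = G a.
Proof.
move=> Ga; rewrite /psum (@ssum_single _ _ _ uN _ (mpickle a)).
  by rewrite /pterm mpickleK.
move=> i ia; rewrite /pterm; case E: (munpickle n i) => [b|] //.
by apply: Ga; apply: contraNneq ia => <-; rewrite (munpickleK E).
Qed.

End IndexedSums.

Lemma psum_map (R : realType) (C C' : comNzRingType) (N : C -> R) (N' : C' -> R)
    (n : nat) (phi : C -> C') (M : R) (G : mindex n -> C) :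
  unorm N -> unorm N' -> {morph phi : x y / x + y} ->
  0 < M -> (forall x, N' (phi x) <= M * N x) ->
  null_family N G -> phi (psum N G) = psum N' (phi \o G).
Proof.
move=> uN uN' phiD M0 phiM G0.
have [_ ->] := ssum_map uN uN' phiD M0 phiM (null_pterm uN G0).
have phi0 : phi 0 = 0 by apply: (addrI (phi 0)); rewrite -phiD !addr0.
by congr ssum; apply/funext => i; rewrite /pterm; case: (munpickle n i).
Qed.

Section TateAlgebra.
Variables (R : realType) (K : fieldType) (abs : nonarch_absval R K) (n : nat).
Hypothesis abs_complete : complete_for abs.
Local Notation T := (tate abs n).
Local Notation gn := (@gauss_norm R K abs n).
Implicit Types (f g : T) (a b : mindex n) (c : K).

Lemma tateP f g : (forall a, f a = g a) -> f = g.
Proof. by move=> fg; apply: val_inj; apply: psP. Qed.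

Lemma tate_vanish f : coef_vanishes abs f.
Proof. by apply/asboolP; exact: (valP f). Qed.

Lemma tateDE f g a : (f + g) a = f a + g a. Proof. by []. Qed.
Lemma tateNE f a : (- f) a = - f a. Proof. by []. Qed.
Lemma tateBE f g a : (f - g) a = f a - g a. Proof. by []. Qed.
Lemma tate0E a : (0 : T) a = 0. Proof. by []. Qed.

Lemma tateME f g a : (f * g) a = \sum_(p \in antidiag a) f p.1 * g p.2.
Proof. by []. Qed.

Lemma gauss_attained f : exists a, forall b, abs (f b) <= abs (f a).
Proof.
have [f0|/existsNP[a0 /eqP fa0]] := pselect (forall a, f a = 0).
  by exists 0 => b; rewrite !f0.
have [d fd] := tate_vanish f (absval_gt0 abs fa0).
have a0d : a0 \in mons n d.
  by apply: mem_mons; rewrite leqNgt; apply/negP => /ltnW/fd; rewrite ltxx.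
have [x y|x y z|a ad aP] :=
    @seq_max _ (fun a b => abs (f a) <= abs (f b)) (mons n d) a0 _ _ a0d.
- by case: (leP (abs (f x)) (abs (f y))) => [|/ltW]; [left|right].
- exact: le_trans.
exists a => b; have [bd|/ltnW bd] := leqP (mdegree b) d.
  exact/aP/mem_mons.
by rewrite (le_trans _ (aP _ a0d)) // ltW // fd.
Qed.

Lemma gaussE f a : (forall b, abs (f b) <= abs (f a)) -> gn f = abs (f a).
Proof.
move=> fa; apply/eqP; rewrite eq_le; apply/andP; split.
  apply: ge_sup; first by exists (abs (f a)); exists a.
  by move=> _ [b _ <-].
apply: ub_le_sup; last by exists a.
by exists (abs (f a)) => _ [b _ <-].
Qed.

Lemma gauss_ub f a : abs (f a) <= gn f.
Proof. by have [b fb] := gauss_attained f; rewrite (gaussE fb). Qed.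

Lemma gauss_le f M : (forall a, abs (f a) <= M) -> gn f <= M.
Proof. by have [a fa] := gauss_attained f; rewrite (gaussE fa). Qed.

Lemma gauss_lt f M : (forall a, abs (f a) < M) -> gn f < M.
Proof. by have [a fa] := gauss_attained f; rewrite (gaussE fa). Qed.

Lemma gauss_ge0 f : 0 <= gn f.
Proof. exact: le_trans (absval_ge0 abs _) (gauss_ub f 0). Qed.

Lemma gauss_eq0 f : gn f = 0 <-> f = 0.
Proof.
split=> [f0|->].
  apply: tateP => a; apply/(absval_eq0 abs)/eqP.
  by rewrite eq_le absval_ge0 andbT -f0 gauss_ub.
by rewrite (@gaussE _ 0) ?tate0E ?absval0 // => b; rewrite !tate0E.
Qed.

Lemma gauss1 : gn 1 = 1.
Proof.
rewrite (@gaussE _ 0) /= ?eqxx ?absval1 // => b.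
by case: ifP; rewrite ?absval1 // absval0.
Qed.

Lemma gauss_complete : complete_for gn.
Proof.
move=> u uC.
have cvg a : exists l, converges_for abs (fun k => u k a) l.
  apply: abs_complete => e e0; have [n0 un] := uC e e0.
  exists n0 => i j ni nj; apply: le_lt_trans (un i j ni nj).
  by rewrite -tateBE gauss_ub.
have [l ul] := choice cvg.
have unif e : 0 < e -> exists n0, forall i a, (n0 <= i)%N -> abs (u i a - l a) < e.
  move=> e0; have [n0 un] := uC _ e0; exists n0 => i a ni.
  have [n1 ul1] := ul a _ e0; pose j := maxn n0 n1.
  have -> : u i a - l a = (u i a - u j a) + (u j a - l a) by ring.
  rewrite (le_lt_trans (absvalD _ _ _)) // gt_max ul1 ?leq_maxr // andbT.
  by rewrite -tateBE (le_lt_trans (gauss_ub _ _)) // un // leq_maxl.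
have lv : coef_vanishes abs (PSeries l).
  move=> e e0; have [n0 un] := unif e e0; have [d ud] := tate_vanish (u n0) e0.
  exists d => a da /=; have -> : l a = u n0 a - (u n0 a - l a) by ring.
  by rewrite (le_lt_trans (absvalD _ _ _)) // gt_max ud // absvalN un.
exists (Tate (asboolT lv)) => e e0; have [n0 un] := unif e e0.
by exists n0 => i ni; apply: gauss_lt => a; apply: un.
Qed.

Lemma unorm_gauss : unorm gn.
Proof.
split=> [f|f g|f|f g| |]; first exact: gauss_eq0.
- apply: gauss_le => a; rewrite tateDE (le_trans (absvalD _ _ _)) //.
  by rewrite ge_max !le_max !gauss_ub orbT.
- have [a fa] := gauss_attained f; rewrite (gaussE fa) (@gaussE _ a).
    by rewrite tateNE absvalN.
  by move=> b; rewrite !tateNE !absvalN.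
- apply: gauss_le => a; rewrite tateME (antidiag_sumE _ (leq_mdegree a)).
  have uabs := unorm_absval abs_complete.
  have fg0 : 0 <= gn f * gn g by rewrite mulr_ge0 ?gauss_ge0.
  do 2!apply: unorm_sum_le => // ? _.
  by rewrite absvalM ler_pM ?absval_ge0 ?gauss_ub.
- exact: gauss1.
- exact: gauss_complete.
Qed.

Lemma mono_vanish c a : coef_vanishes abs (PSeries (fun b => if b == a then c else 0)).
Proof.
move=> e e0; exists (mdegree a).+1 => b ab /=; rewrite ifN ?absval0 //.
by apply: contraTneq ab => ->; rewrite ltnn.
Qed.

Definition mono c a : T := Tate (asboolT (mono_vanish c a)).

Lemma monoE c a b : mono c a b = if b == a then c else 0. Proof. by []. Qed.

Lemma tateCE c : tateC abs n c = mono c 0. Proof. by apply: tateP. Qed.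

Lemma gauss_mono c a : gn (mono c a) = abs c.
Proof.
rewrite (@gaussE _ a) ?monoE ?eqxx // => b; rewrite !monoE ?eqxx.
by case: ifP; rewrite ?absval0 ?absval_ge0.
Qed.

Lemma mono0 a : mono 0 a = 0.
Proof. by apply: tateP => b; rewrite monoE if_same. Qed.

Lemma monoM c c' a b : mono c a * mono c' b = mono (c * c') (a + b).
Proof.
apply: tateP => d; rewrite monoE tateME.
case: eqP => [->|ne]; last first.
  apply: fsbig1 => -[p q] /= pq.
  case: eqP => [pa|]; case: eqP => [qb|]; rewrite ?mul0r ?mulr0 //.
  by case: ne; rewrite -pq /= pa qb.
have fin : finite_set (antidiag (a + b)).
  pose m := mdegree (a + b); pose s := [seq (p, q) | p <- mons n m, q <- mons n m].
  apply: (@sub_finite_set _ _ [set` s]); last exact: finite_seq.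
  move=> [p q] /= pq; apply/allpairsP; exists (p, q); split => //=;
  by apply: mem_mons; rewrite /m -pq mdegreeD ?leq_addr ?leq_addl.
rewrite (fsbigD1 (a, b)) //=.
rewrite !eqxx fsbig1 ?addr0 // => -[p q] [/= pq ne].
case: eqP => [pa|]; case: eqP => [qb|]; rewrite ?mul0r ?mulr0 //.
by case: ne; rewrite pa qb.
Qed.

Lemma null_mono f : null_family gn (fun a => mono (f a) a).
Proof.
move=> e e0; have [d fd] := tate_vanish f e0; exists d => a da.
by rewrite gauss_mono fd.
Qed.

Lemma tate_expansion f : f = psum gn (fun a => mono (f a) a).
Proof.
apply: tateP => a; have uabs := unorm_absval abs_complete.
have := @psum_map _ _ _ _ _ _ (fun f => f a) 1 _ unorm_gauss uabs
  _ ltr01 _ (null_mono f).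
move=> -> //; last by move=> x; rewrite mul1r gauss_ub.
rewrite (@psum_single _ _ _ uabs _ _ a) /= ?eqxx // => b ba.
by rewrite eq_sym (negPf ba).
Qed.

Section Density.
Variables (C : comNzRingType) (N : C -> R) (uN : unorm N).

(** Finite sums of monomials are dense and both maps are continuous. Identities between bounded
    additive maps can thus be checked on monomials, without computing convolutions. *)
Lemma tate_ext (phi psi : T -> C) (M : R) : 0 < M ->
  {morph phi : x y / x + y} -> {morph psi : x y / x + y} ->
  (forall f, N (phi f) <= M * gn f) -> (forall f, N (psi f) <= M * gn f) ->
  (forall c a, phi (mono c a) = psi (mono c a)) -> phi =1 psi.
Proof.
move=> M0 phiD psiD phiM psiM e f; rewrite [f]tate_expansion.
have n0 := null_mono f.
rewrite (psum_map unorm_gauss uN phiD M0 phiM n0).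
rewrite (psum_map unorm_gauss uN psiD M0 psiM n0).
by congr psum; apply/funext => a /=.
Qed.

End Density.

Lemma gaussM_le f g : gn (f * g) <= gn f * gn g.
Proof. exact: unormM unorm_gauss f g. Qed.

Fact tateC_zmod_morphism : zmod_morphism (@tateC R K abs n).
Proof.
move=> c c'; apply: tateP => a; rewrite tateBE !tateCE !monoE.
by case: ifP; rewrite ?subr0.
Qed.

Fact tateC_monoid_morphism : monoid_morphism (@tateC R K abs n).
Proof.
split; first by apply: tateP.
by move=> c c'; rewrite !tateCE monoM addr0.
Qed.

HB.instance Definition _ := GRing.isZmodMorphism.Build K T
  (@tateC R K abs n) tateC_zmod_morphism.
HB.instance Definition _ := GRing.isMonoidMorphism.Build K T
  (@tateC R K abs n) tateC_monoid_morphism.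

Lemma tateC_mono c c' a : tateC abs n c * mono c' a = mono (c * c') a.
Proof. by rewrite tateCE monoM add0r. Qed.

Lemma tateCM_E c f a : (tateC abs n c * f) a = c * f a.
Proof.
have uabs := unorm_absval abs_complete; pose M := abs c + 1.
have M0 : 0 < M by rewrite ltr_wpDl ?absval_ge0.
have cM : abs c <= M by rewrite lerDl.
apply: (@tate_ext _ _ uabs (fun f => (tateC abs n c * f) a) (fun f => c * f a) M M0).
- by move=> x y; rewrite mulrDr.
- by move=> x y; rewrite tateDE mulrDr.
- move=> x; rewrite (le_trans (gauss_ub _ _)) // (le_trans (gaussM_le _ _)) //.
  by rewrite tateCE gauss_mono ler_wpM2r ?gauss_ge0.
- by move=> x; rewrite absvalM ler_pM ?absval_ge0 ?gauss_ub.
by move=> c' b; rewrite tateC_mono !monoE; case: ifP; rewrite ?mulr0.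
Qed.

Lemma gauss_tateC c f : gn (tateC abs n c * f) = abs c * gn f.
Proof.
have [a fa] := gauss_attained f; rewrite (gaussE fa) (@gaussE _ a).
  by rewrite tateCM_E absvalM.
by move=> b; rewrite !tateCM_E !absvalM ler_wpM2l ?absval_ge0.
Qed.

Definition mdelta (i : 'I_n) : mindex n := [ffun j => (j == i : nat)].

Definition tvar i : T := mono 1 (mdelta i).

Lemma mono_prod c a : mono c a = tateC abs n c * \prod_i tvar i ^+ a i.
Proof.
have tX b k : (mono 1 b) ^+ k = mono 1 (b *+ k).
  elim: k => [|k IH]; first by rewrite expr0 mulr0n -tateCE rmorph1.
  by rewrite exprS IH monoM mulr1 mulrS.
have -> : \prod_i tvar i ^+ a i = mono 1 (\sum_i mdelta i *+ a i).
  apply: (big_ind2 (fun x b => x = mono 1 b)) => [|x b y d -> ->|i _].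
  - by rewrite -tateCE rmorph1.
  - by rewrite monoM mulr1.
  - exact: tX.
rewrite tateC_mono mulr1; congr mono; apply/ffunP => j.
rewrite sum_ffunE (bigD1 j) //= big1 => [|i ij].
  rewrite addr0 ffunMnE ffunE eqxx.
  by elim: (a j) => // k IH; rewrite mulrS -[in RHS]IH.
by rewrite ffunMnE ffunE eq_sym (negPf ij) mul0rn.
Qed.

End TateAlgebra.

Section UniversalProperty.
Variables (R : realType) (K : fieldType) (abs : nonarch_absval R K) (n : nat).
Hypothesis abs_complete : complete_for abs.
Local Notation T := (tate abs n).
Local Notation gn := (@gauss_norm R K abs n).
Variables (C : comNzRingType) (N : C -> R) (uN : unorm N).
Variable iota : {rmorphism K -> C}.
Hypothesis N_iota : forall c x, N (iota c * x) = abs c * N x.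
Variable b : 'I_n -> C.
Hypothesis b1 : forall i, N (b i) <= 1.

(** The map sends f to the sum of the iota (f a) b^a, a null family because the monomials b^a have
    norm at most 1. *)
Lemma tate_universal : exists phi : {rmorphism T -> C},
  [/\ forall c, phi (tateC abs n c) = iota c, forall i, phi (tvar abs i) = b i
    & forall f, N (phi f) <= gn f].
Proof.
pose bp (a : mindex n) := \prod_i b i ^+ a i.
have bp1 a : N (bp a) <= 1 by apply: unorm_prod_le1 => // i; apply: unormX_le1.
have bp0 : bp 0 = 1 by rewrite /bp big1 // => i _; rewrite ffunE expr0.
have bpD a a' : bp (a + a') = bp a * bp a'.
  by rewrite /bp -big_split; apply: eq_bigr => i _; rewrite ffunE exprD.
pose G (f : T) a := iota (f a) * bp a.
have Gle (f : T) a : N (G f a) <= abs (f a).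
  by rewrite /G N_iota -[leRHS]mulr1 ler_wpM2l ?absval_ge0.
have G0 (f : T) : null_family N (G f).
  move=> e e0; have [d fd] := tate_vanish f e0; exists d => a da.
  exact: le_lt_trans (Gle f a) (fd a da).
pose phi f := psum N (G f).
have phiD f g : phi (f + g) = phi f + phi g.
  rewrite /phi -psumD //; congr psum; apply/funext => a.
  by rewrite /G tateDE rmorphD mulrDl.
have phi_le f : N (phi f) <= gn f.
  apply: psum_le => //; first exact: gauss_ge0.
  by move=> a; apply: le_trans (Gle f a) (gauss_ub f a).
have phi_mono c a : phi (mono abs c a) = iota c * bp a.
  rewrite /phi (@psum_single _ _ _ uN _ _ a); first by rewrite /G /= eqxx.
  by move=> a' ne; rewrite /G monoE (negPf ne) rmorph0 mul0r.
have phiN f : phi (- f) = - phi f.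
  apply/eqP; rewrite -addr_eq0 -phiD addNr -(mono0 abs 0) phi_mono.
  by rewrite rmorph0 mul0r.
have phiB : zmod_morphism phi by move=> f g; rewrite phiD phiN.
have gM := @gaussM_le _ _ _ n abs_complete.
have phiM f g : phi (f * g) = phi f * phi g.
  (* Multiplicativity is checked on monomials, one factor at a time; adding 1 makes the bound
     positive even for f = 0. *)
  pose M f := gn f + 1.
  have M0 f' : 0 < M f' by rewrite ltr_wpDl ?gauss_ge0.
  have leM f' : gn f' <= M f' by rewrite lerDl.
  apply: (@tate_ext _ _ _ _ abs_complete _ _ uN (fun f => phi (f * g))
    (fun f => phi f * phi g) (M g)) => //.
  - by move=> x y; rewrite mulrDl phiD.
  - by move=> x y; rewrite phiD mulrDl.
  - move=> x; rewrite (le_trans (phi_le _)) // (le_trans (gM _ _)) //.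
    by rewrite mulrC ler_wpM2r ?gauss_ge0.
  - move=> x; rewrite (le_trans (unormM uN _ _)) // mulrC.
    by rewrite ler_pM ?unorm_ge0 // (le_trans (phi_le _)).
  move=> c a.
  apply: (@tate_ext _ _ _ _ abs_complete _ _ uN (fun g => phi (mono abs c a * g))
    (fun g => phi (mono abs c a) * phi g) (M (mono abs c a))) => //.
  - by move=> x y; rewrite mulrDr phiD.
  - by move=> x y; rewrite phiD mulrDr.
  - move=> x; rewrite (le_trans (phi_le _)) // (le_trans (gM _ _)) //.
    by rewrite ler_wpM2r ?gauss_ge0.
  - move=> x; rewrite (le_trans (unormM uN _ _)) //.
    by rewrite ler_pM ?unorm_ge0 // (le_trans (phi_le _)).
  move=> c' a'; rewrite monoM // !phi_mono rmorphM bpD; ring.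
have phi1 : phi 1 = 1.
  have -> : 1 = tateC abs n 1 by rewrite rmorph1.
  by rewrite tateCE phi_mono rmorph1 bp0 mulr1.
pose phiZ := GRing.isZmodMorphism.Build T C phi phiB.
pose phiR := GRing.isMonoidMorphism.Build T C phi (conj phi1 phiM).
pose Phi : {rmorphism T -> C} := HB.pack phi phiZ phiR.
exists Phi; split=> [c|i|f] /=; last exact: phi_le.
  by rewrite tateCE phi_mono bp0 mulr1.
rewrite phi_mono rmorph1 mul1r /bp (bigD1 i) //= ffunE eqxx expr1 big1 ?mulr1 //.
by move=> j ji; rewrite ffunE (negPf ji) expr0.
Qed.

Lemma tate_hom_ext (phi psi : {rmorphism T -> C}) (M : R) : 0 < M ->
  (forall f, N (phi f) <= M * gn f) -> (forall f, N (psi f) <= M * gn f) ->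
  (forall c, phi (tateC abs n c) = psi (tateC abs n c)) ->
  (forall i, phi (tvar abs i) = psi (tvar abs i)) -> phi =1 psi.
Proof.
move=> M0 phiM psiM phiC phiV.
apply: (tate_ext abs_complete uN M0) => //; [exact: rmorphD|exact: rmorphD|].
move=> c a; rewrite mono_prod // !rmorphM !rmorph_prod phiC; congr (_ * _).
by apply: eq_bigr => i _; rewrite !rmorphXn phiV.
Qed.

End UniversalProperty.

(** * Leading exponents *)

Section LexicographicOrder.
Variable n : nat.
Implicit Types a b c : mindex n.

(** Lexicographic, index 0 being the most significant. With this choice [lead f (mcons s 0)] below
    says exactly that f is distinguished of order s in the first variable. *)
Definition mlt a b : Prop :=
  exists i : 'I_n, (a i < b i)%N /\ forall j : 'I_n, (j < i)%N -> a j = b j.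

Lemma mlt_irr a : ~ mlt a a.
Proof. by move=> [i []]; rewrite ltnn. Qed.

Lemma mlt_trans a b c : mlt a b -> mlt b c -> mlt a c.
Proof.
move=> [i [abi abj]] [k [bck bcj]]; have [ik|ki|/val_inj ik] := ltngtP i k.
- exists i; rewrite -bcj //; split=> // j ji.
  by rewrite abj // bcj // (ltn_trans ji).
- exists k; rewrite abj //; split=> // j jk.
  by rewrite abj ?bcj // (ltn_trans jk).
- exists i; split; first by rewrite (ltn_trans abi) // ik.
  by move=> j ji; rewrite abj // bcj // -ik.
Qed.

Lemma mlt_asym a b : mlt a b -> ~ mlt b a.
Proof. by move=> ab /(mlt_trans ab)/mlt_irr. Qed.

Lemma mlt_total a b : [\/ a = b, mlt a b | mlt b a].
Proof.
have [->|ab] := eqVneq a b; first by constructor 1.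
have /existsP[i0 i0P] : [exists i, a i != b i].
  rewrite -negb_forall; apply: contra ab => /forallP ab.
  by apply/eqP/ffunP => i; apply/eqP.
case: (@arg_minnP _ i0 (fun i => a i != b i) (@nat_of_ord n) i0P) => i abi imin.
have ltE (j : 'I_n) : (j < i)%N -> a j = b j.
  move=> ji; apply/eqP; apply: contraLR ji => /imin.
  by rewrite -leqNgt.
move: abi; rewrite neq_ltn => /orP[lt|lt]; [constructor 2|constructor 3]; exists i.
  by split.
by split=> // j /ltE.
Qed.

Lemma mltD2r c a b : mlt (a + c) (b + c) <-> mlt a b.
Proof.
split=> -[i [lt eq]]; exists i; rewrite !ffunE ?ltn_add2r in lt *; split=> // j /eq.
  by rewrite !ffunE => /addIn.
by rewrite !ffunE => ->.
Qed.

Lemma mlt0 a : ~ mlt a 0.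
Proof. by move=> [i []]; rewrite ffunE. Qed.

Lemma mindex_addIr c : injective (fun a => a + c).
Proof.
by move=> a b /ffunP e; apply/ffunP => i; have := e i; rewrite !ffunE => /addIn.
Qed.

Lemma mlt_split a b c d : c + d = a + b -> (c, d) <> (a, b) -> mlt a c \/ mlt b d.
Proof.
move=> e ne; have [ca|ca|] := mlt_total c a; last by left.
  by case: ne; rewrite -ca in e *; congr pair; apply: (@mindex_addIr c); rewrite addrC e addrC.
right; have [db|db|//] := mlt_total d b.
  by case: ne; rewrite -db in e *; congr pair; apply: (@mindex_addIr d).
have l1 : mlt (c + d) (a + d) by apply/mltD2r.
have l2 : mlt (a + d) (a + b) by rewrite ![a + _]addrC; apply/mltD2r.
by have := mlt_trans l1 l2; rewrite e => /mlt_irr.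
Qed.

End LexicographicOrder.

Section FirstExponent.
Variable n : nat.

Definition mcons (k : nat) (a : mindex n) : mindex n.+1 :=
  [ffun i => oapp a k (unlift ord0 i)].

Definition mtail (b : mindex n.+1) : mindex n := [ffun i => b (lift ord0 i)].

Arguments mcons : simpl never.
Arguments mtail : simpl never.

Lemma mcons0E k a : mcons k a ord0 = k. Proof. by rewrite ffunE unlift_none. Qed.

Lemma mconsSE k a i : mcons k a (lift ord0 i) = a i.
Proof. by rewrite ffunE liftK. Qed.

Lemma mcons_tail (b : mindex n.+1) : mcons (b ord0) (mtail b) = b.
Proof.
apply/ffunP => i; have [j ->|->] := unliftP ord0 i; last by rewrite mcons0E.
by rewrite mconsSE ffunE.
Qed.

Lemma mtail_cons k a : mtail (mcons k a) = a.
Proof. by apply/ffunP => i; rewrite ffunE mconsSE. Qed.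

Lemma mcons_ex (b : mindex n.+1) : exists k a, b = mcons k a.
Proof. by exists (b ord0), (mtail b); rewrite mcons_tail. Qed.

Lemma mcons_inj k l a b : mcons k a = mcons l b -> k = l /\ a = b.
Proof.
move=> e; split; first by rewrite -(mcons0E k a) e mcons0E.
by apply/ffunP => i; rewrite -(mconsSE k a) e mconsSE.
Qed.

Lemma mcons_eq k l a b : (mcons k a == mcons l b) = (k == l) && (a == b).
Proof. by apply/eqP/andP => [/mcons_inj[-> ->]|[/eqP -> /eqP ->]]. Qed.

Lemma mconsD k l a b : mcons k a + mcons l b = mcons (k + l) (a + b).
Proof.
apply/ffunP => i; rewrite ffunE.
have [j ->|->] := unliftP ord0 i; last by rewrite !mcons0E.
by rewrite !mconsSE ffunE.
Qed.

Lemma mcons00 : mcons 0 0 = 0.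
Proof.
apply/ffunP => i; have [j ->|->] := unliftP ord0 i; last by rewrite mcons0E ffunE.
by rewrite mconsSE !ffunE.
Qed.

Lemma mdegree_mcons k a : mdegree (mcons k a) = (k + mdegree a)%N.
Proof.
rewrite /mdegree big_ord_recl mcons0E; congr addn.
by apply: eq_bigr => i _; rewrite mconsSE.
Qed.

Lemma mlt_mcons k l a b : mlt (mcons k a) (mcons l b) <->
  (k < l)%N \/ k = l /\ mlt a b.
Proof.
split=> [[i [lt eq]]|[kl|[-> [i [lt eq]]]]].
- have [j ij|i0] := unliftP ord0 i; last by left; move: lt; rewrite i0 !mcons0E.
  right; split; first by have := eq ord0; rewrite ij !mcons0E; apply.
  exists j; rewrite ij !mconsSE in lt; split=> // j' j'j.
  by have := eq (lift ord0 j'); rewrite ij !mconsSE !lift0 ltnS; apply.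
- by exists ord0; rewrite !mcons0E.
- exists (lift ord0 i); rewrite !mconsSE; split=> // j.
  have [j' ->|->] := unliftP ord0 j; last by rewrite !mcons0E.
  by rewrite !mconsSE !lift0 ltnS => /eq.
Qed.

End FirstExponent.

Lemma mindex0_eq (a b : mindex 0) : a = b.
Proof. by apply/ffunP => -[]. Qed.

Lemma mlt_wf n : well_founded (@mlt n).
Proof.
elim: n => [|n IH]; first by move=> a; constructor => b [[]].
suff H k a : Acc (@mlt n.+1) (mcons k a) by move=> b; rewrite -(mcons_tail b).
elim/ltn_ind: k a => k IHk a; elim/(well_founded_ind IH): a => a IHa.
constructor => b; have [l [c ->]] := mcons_ex b.
by move=> /mlt_mcons[lk|[-> ca]]; [exact: IHk|exact: IHa].
Qed.

Lemma finite_antidiag n (a : mindex n) : finite_set (antidiag a).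
Proof.
pose m := mdegree a; pose s := [seq (p, q) | p <- mons n m, q <- mons n m].
apply: (@sub_finite_set _ _ [set` s]); last exact: finite_seq.
move=> [p q] /= pq; apply/allpairsP; exists (p, q); split => //=;
by apply: mem_mons; rewrite /m -pq mdegreeD ?leq_addr ?leq_addl.
Qed.

Section LeadingExponent.
Variables (R : realType) (K : fieldType) (abs : nonarch_absval R K) (n : nat).
Local Notation T := (tate abs n).
Local Notation gn := (@gauss_norm R K abs n).
Implicit Types (f g : T) (a b : mindex n) (c : K).

Lemma absval_fsbig_lt (I : choiceType) (A : set I) (F : I -> K) (e : R) :
  0 < e -> finite_set A -> (forall i, A i -> abs (F i) < e) ->
  abs (\sum_(i \in A) F i) < e.
Proof.
move=> e0 Af FA; rewrite fsbig_finite // big_seq; apply: absval_sum_lt => // i.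
by rewrite in_fset_set // inE => /FA.
Qed.

Lemma absval_eq_of_lt (x y : K) : abs y < abs x -> abs (x + y) = abs x.
Proof.
move=> yx; apply/eqP; rewrite eq_le; apply/andP; split.
  by rewrite (le_trans (absvalD _ _ _)) // ge_max lexx ltW.
rewrite leNgt; apply/negP => lt.
suff : abs x < abs x by rewrite ltxx.
have {1}-> : x = (x + y) + - y by rewrite addrK.
by rewrite (le_lt_trans (absvalD _ _ _)) // gt_max lt absvalN.
Qed.

(** The last exponent at which the Gauss norm is attained, that is, for f of norm 1, the leading
    exponent of its reduction. *)
Definition lead f a : Prop :=
  [/\ f a != 0, forall b, abs (f b) <= abs (f a)
    & forall b, mlt a b -> abs (f b) < abs (f a)].

(** The pair (Gauss norm, leading exponent) of f is strictly below (r, a). *)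
Definition vbelow f a (r : R) : Prop :=
  (forall b, abs (f b) <= r) /\ (forall b, ~ mlt b a -> abs (f b) < r).

Lemma lead_exists f : f != 0 -> exists a, lead f a.
Proof.
move=> f0; have [a0 fa0] := gauss_attained f.
have a00 : f a0 != 0.
  apply: contraNneq f0 => e; apply/eqP/tateP => b; apply/(absval_eq0 abs)/eqP.
  by rewrite eq_le absval_ge0 andbT (le_trans (fa0 b)) // e absval0.
have [d fd] := tate_vanish f (absval_gt0 abs a00).
have small b : abs (f b) = abs (f a0) -> b \in mons n d.
  move=> e; apply: mem_mons; rewrite leqNgt; apply/negP => /ltnW/fd.
  by rewrite e ltxx.
pose s := [seq b <- mons n d | abs (f b) == abs (f a0)].
have s0 : a0 \in s by rewrite mem_filter eqxx small.
have [x y|x y z|a] := @seq_max _ (fun a b => a = b \/ mlt a b) s a0 _ _ s0.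
- by case: (mlt_total x y) => h; [left; left|left; right|right; right].
- move=> [->//|xy] [<-|yz]; first by right.
  by right; apply: mlt_trans yz.
rewrite mem_filter => /andP[/eqP fa _] amax; exists a; rewrite /lead fa.
split=> // [|b ab].
  apply: contraNneq a00 => e; apply/eqP/(absval_eq0 abs).
  by rewrite -fa e absval0.
rewrite lt_neqAle fa0 andbT; apply/eqP => e.
have /amax : b \in s by rewrite mem_filter e eqxx small.
by case=> [ba|/(mlt_trans ab)/mlt_irr//]; rewrite ba in ab; case: (mlt_irr ab).
Qed.

Lemma lead_neq0 f a : lead f a -> f != 0.
Proof. by case=> fa _ _; apply: contraNneq fa => ->. Qed.

Lemma lead_gauss f a : lead f a -> gn f = abs (f a).
Proof. by case=> _ fa _; apply: gaussE. Qed.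

Lemma lead_unique f a b : lead f a -> lead f b -> a = b.
Proof.
move=> [_ fa fa'] [_ fb fb']; have [//|ab|ba] := mlt_total a b.
  by have := fa' _ ab; rewrite ltNge fb.
by have := fb' _ ba; rewrite ltNge fa.
Qed.

Lemma lead_mono c a : c != 0 -> lead (mono abs c a) a.
Proof.
move=> c0; split; rewrite ?monoE ?eqxx // => b; rewrite !monoE.
  by case: ifP; rewrite ?absval0 ?absval_ge0.
by case: eqP => [-> /mlt_irr//|_ _]; rewrite absval0 absval_gt0.
Qed.

Lemma lead1 : lead 1 0.
Proof.
by have := lead_mono 0 (oner_neq0 K); rewrite -tateCE; congr lead; apply: tateP.
Qed.

(** If c + d = a + b and (c, d) differs from (a, b), then a < c or b < d, so the term at (a, b)
    strictly dominates the convolution. Multiplicativity of the Gauss norm and integrality of T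
    follow. *)
Lemma leadM f g a b : lead f a -> lead g b ->
  lead (f * g) (a + b) /\ abs ((f * g) (a + b)) = abs (f a) * abs (g b).
Proof.
move=> [fa0 fa fa'] [gb0 gb gb']; have pf := absval_gt0 abs fa0.
have pg := absval_gt0 abs gb0; have pfg := mulr_gt0 pf pg.
have small (c d : mindex n) : mlt a c \/ mlt b d -> abs (f c * g d) < abs (f a) * abs (g b).
  rewrite absvalM => -[/fa'|/gb'] lt.
    by rewrite (le_lt_trans (ler_wpM2l _ (gb d))) ?absval_ge0 // ltr_pM2r.
  by rewrite (le_lt_trans (ler_wpM2r _ (fa c))) ?absval_ge0 // ltr_pM2l.
have main : abs ((f * g) (a + b)) = abs (f a) * abs (g b).
  rewrite tateME (fsbigD1 (a, b)) //=; last exact: finite_antidiag.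
  rewrite absval_eq_of_lt ?absvalM // -absvalM absvalM.
  apply: absval_fsbig_lt => //.
    by apply: sub_finite_set (finite_antidiag (a + b)) => x [].
  by move=> [c d] [/= e ne]; apply: small; apply: mlt_split e _ => -[? ?]; apply: ne; congr pair.
have main0 : (f * g) (a + b) != 0.
  by apply/eqP => e; move: pfg; rewrite -main e absval0 ltxx.
split; last exact: main.
split; first exact: main0.
- move=> c; rewrite [leRHS]main (tateME f g c).
  rewrite fsbig_finite; last exact: finite_antidiag.
  apply: (big_ind (fun x => abs x <= abs (f a) * abs (g b))).
  - by rewrite absval0 ltW.
  - by move=> x y hx hy; rewrite (le_trans (absvalD _ _ _)) // ge_max hx.
  - by move=> i _; rewrite absvalM ler_pM ?absval_ge0.
- move=> c abc; rewrite [ltRHS]main (tateME f g c); apply: absval_fsbig_lt => //.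
    exact: finite_antidiag.
  move=> [p q] /= pq; apply: small.
  have [ap|ap|] := mlt_total p a; last by left.
    right; rewrite -pq -ap in abc.
    by move: abc; rewrite ![p + _]addrC => /mltD2r.
  have [qb|qb|] := mlt_total q b; last by right.
    by move: abc; rewrite -pq -qb => /mltD2r /(mlt_asym ap).
  have l1 : mlt (p + q) (a + q) by apply/mltD2r.
  have l2 : mlt (a + q) (a + b) by rewrite ![a + _]addrC; apply/mltD2r.
  by have := mlt_trans l1 l2; rewrite pq => /(mlt_asym abc).
Qed.

Lemma leadX f a k : lead f a -> lead (f ^+ k) (a *+ k).
Proof.
move=> fa; elim: k => [|k IH].
  by rewrite expr0 mulr0n; exact: lead1.
by rewrite exprS mulrS; have [] := leadM fa IH.
Qed.

Lemma leadD f g a : lead f a -> vbelow g a (abs (f a)) ->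
  lead (f + g) a /\ abs ((f + g) a) = abs (f a).
Proof.
move=> [fa0 fa fa'] [ga ga'].
have main : abs ((f + g) a) = abs (f a).
  by rewrite tateDE absval_eq_of_lt // ga' //; apply: mlt_irr.
split=> //; split.
- by apply: contraTneq (absval_gt0 abs fa0) => e; rewrite -main e absval0 ltxx.
- by move=> b; rewrite [leRHS]main tateDE (le_trans (absvalD _ _ _)) // ge_max fa ga.
- move=> b ab; rewrite [ltRHS]main tateDE (le_lt_trans (absvalD _ _ _)) //.
  by rewrite gt_max fa' // ga' //; apply: mlt_asym.
Qed.

Lemma vbelowD f g a r : vbelow f a r -> vbelow g a r -> vbelow (f + g) a r.
Proof.
move=> [fr fa] [gr ga]; split=> b.
  by rewrite tateDE (le_trans (absvalD _ _ _)) // ge_max fr gr.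
by move=> ba; rewrite tateDE (le_lt_trans (absvalD _ _ _)) // gt_max fa ?ga.
Qed.

Lemma vbelow_gauss f a r : gn f < r -> vbelow f a r.
Proof.
by move=> fr; split=> b; rewrite ?ltW // => *; apply: le_lt_trans (gauss_ub f b) _.
Qed.

Lemma vbelow_lead f a b : lead f b -> mlt b a -> vbelow f a (abs (f b)).
Proof.
move=> [f0 fb fb'] ba; split=> // c ca; apply: fb'.
have [cb|cb|//] := mlt_total c b; first by rewrite cb in ca.
by case: ca; apply: mlt_trans ba.
Qed.

Lemma tate_mulf_eq0 f g : f * g = 0 -> (f == 0) || (g == 0).
Proof.
move=> fg0; rewrite -[_ || _]negbK negb_or; apply/negP => /andP[].
move=> /lead_exists[a fa] /lead_exists[b gb].
by have [/lead_neq0] := leadM fa gb; rewrite fg0 eqxx.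
Qed.

Lemma gaussM f g : gn (f * g) = gn f * gn g.
Proof.
have g0 : gn 0 = 0 by apply/gauss_eq0.
have [->|/lead_exists[a fa]] := eqVneq f 0; first by rewrite mul0r g0 mul0r.
have [->|/lead_exists[b gb]] := eqVneq g 0; first by rewrite mulr0 g0 mulr0.
by have [fg e] := leadM fa gb; rewrite (lead_gauss fg) (lead_gauss fa) (lead_gauss gb).
Qed.

End LeadingExponent.

Section TateDomain.
Variables (R : realType) (K : fieldType) (abs : nonarch_absval R K) (n : nat).
Local Notation T := (tate abs n).

Definition tate_unit : {pred T} := fun f => `[< exists g, g * f = 1 >].
Definition tate_inv (f : T) : T := xget f [set g | g * f = 1].

Fact tate_mulVf : {in tate_unit, left_inverse 1 tate_inv *%R}.
Proof.
by move=> f /asboolP[g gf]; rewrite /tate_inv; case: xgetP => [h -> //|/(_ g)].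
Qed.

Fact tate_unitPl f g : g * f = 1 -> f \in tate_unit.
Proof. by move=> gf; apply/asboolP; exists g. Qed.

Fact tate_inv_out : {in [predC tate_unit], tate_inv =1 id}.
Proof.
move=> f /asboolP nf; rewrite /tate_inv; case: xgetP => [h -> /= hf|//].
by case: nf; exists (xget f [set g | g * f = 1]).
Qed.

HB.instance Definition _ := GRing.ComNzRing_hasMulInverse.Build T
  tate_mulVf tate_unitPl tate_inv_out.

HB.instance Definition _ := GRing.ComUnitRing_isIntegral.Build T
  (@tate_mulf_eq0 R K abs n).

End TateDomain.

Section TateUnits.
Variables (R : realType) (K : fieldType) (abs : nonarch_absval R K) (n : nat).
Hypothesis abs_complete : complete_for abs.
Local Notation T := (tate abs n).
Local Notation gn := (@gauss_norm R K abs n).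

(** Divided by its constant coefficient, f becomes 1 - e with |e| < 1, which the geometric series
    inverts. *)
Lemma lead0_unit (f : T) : lead f 0 -> exists g, f * g = 1.
Proof.
move=> [f0 _ fb].
have gU := unorm_gauss n abs_complete.
pose e : T := 1 - tateC abs n (f 0)^-1 * f.
have e1 : gn e < 1.
  apply: gauss_lt => b; rewrite tateBE tateCM_E //.
  have [->|b0] := eqVneq b 0.
    by rewrite /= eqxx mulVf // subrr absval0.
  rewrite /= (negPf b0) sub0r absvalN absvalM absvalV.
  rewrite mulrC ltr_pdivrMr ?absval_gt0 // mul1r; apply: fb.
  have [b0'|//|/mlt0//] := mlt_total 0 b.
  by rewrite b0' eqxx in b0.
have eX k : gn (e ^+ k) <= 1 * gn e ^+ k.
  rewrite mul1r; elim: k => [|k IH]; first by rewrite !expr0 gauss1.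
  by rewrite !exprS gaussM ler_wpM2l ?gauss_ge0.
have en : null_seq gn (fun k => e ^+ k) := null_seq_geom (gauss_ge0 e) e1 eX.
pose s := ssum gn (fun k => e ^+ k).
have se : (1 - e) * s = 1.
  have [_ ->] := @ssum_map _ _ _ _ _ (fun x => (1 - e) * x) (gn (1 - e) + 1) _ gU gU
    (mulrDr _) (ltr_wpDl (gauss_ge0 _) ltr01)
    (fun x => le_trans (gaussM_le abs_complete _ _)
                (ler_wpM2r (gauss_ge0 _) (ler_wpDr ler01 (lexx _)))) en.
  have -> : (fun k => (1 - e) * e ^+ k) = (fun k => e ^+ k - e ^+ k.+1).
    by apply/funext => k; rewrite mulrBl mul1r exprS.
  by rewrite ssum_telescope // expr0.
exists (tateC abs n (f 0)^-1 * s).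
by rewrite -[RHS]se /e subKr [in RHS]mulrAC mulrC.
Qed.

End TateUnits.

(** * Weierstrass division *)

Lemma tate_mult_ext (R : realType) (K : fieldType) (abs : nonarch_absval R K)
    (n : nat) (C : comNzRingType) (N : C -> R) (phi : tate abs n -> C) :
  complete_for abs -> unorm N -> {morph phi : f g / f + g} ->
  (forall f, N (phi f) <= gauss_norm f) ->
  (forall c a c' a', phi (mono abs c a * mono abs c' a') =
     phi (mono abs c a) * phi (mono abs c' a')) ->
  {morph phi : f g / f * g}.
Proof.
move=> abs_complete uN phiD phi_le phi_mono f g.
have gM := @gaussM_le _ _ _ n abs_complete.
pose M (f : tate abs n) := gauss_norm f + 1.
have M0 f' : 0 < M f' by rewrite ltr_wpDl ?gauss_ge0.
have leM f' : gauss_norm f' <= M f' by rewrite lerDl.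
apply: (@tate_ext _ _ _ _ abs_complete _ _ uN (fun f => phi (f * g))
  (fun f => phi f * phi g) (M g)) => //.
- by move=> x y; rewrite mulrDl phiD.
- by move=> x y; rewrite phiD mulrDl.
- move=> x; rewrite (le_trans (phi_le _)) // (le_trans (gM _ _)) //.
  by rewrite mulrC ler_wpM2r ?gauss_ge0.
- move=> x; rewrite (le_trans (unormM uN _ _)) // mulrC.
  by rewrite ler_pM ?unorm_ge0 // (le_trans (phi_le _)).
move=> c a.
apply: (@tate_ext _ _ _ _ abs_complete _ _ uN (fun g => phi (mono abs c a * g))
  (fun g => phi (mono abs c a) * phi g) (M (mono abs c a))) => //.
- by move=> x y; rewrite mulrDr phiD.
- by move=> x y; rewrite phiD mulrDr.
- move=> x; rewrite (le_trans (phi_le _)) // (le_trans (gM _ _)) //.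
  by rewrite ler_wpM2r ?gauss_ge0.
- move=> x; rewrite (le_trans (unormM uN _ _)) //.
  by rewrite ler_pM ?unorm_ge0 // (le_trans (phi_le _)).
Qed.

Section Filter.
Variables (R : realType) (K : fieldType) (abs : nonarch_absval R K) (n : nat).
Local Notation T := (tate abs n).
Local Notation gn := (@gauss_norm R K abs n).

Lemma tfilter_vanish (P : set (mindex n)) (f : T) :
  coef_vanishes abs (PSeries (fun b => if `[< P b >] then f b else 0)).
Proof.
move=> e e0; have [d fd] := tate_vanish f e0; exists d => b /fd /=.
by case: ifP; rewrite ?absval0.
Qed.

Definition tfilter P (f : T) : T := Tate (asboolT (tfilter_vanish P f)).

Lemma tfilterE P f b : tfilter P f b = if `[< P b >] then f b else 0.
Proof. by []. Qed.

End Filter.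

Section WeierstrassDivision.
Variables (R : realType) (K : fieldType) (abs : nonarch_absval R K) (n : nat).
Hypothesis abs_complete : complete_for abs.
Local Notation Td := (tate abs n).
Local Notation T := (tate abs n.+1).
Local Notation gnd := (@gauss_norm R K abs n).
Local Notation gn := (@gauss_norm R K abs n.+1).
Local Notation mono := (mono abs).
Let gU := unorm_gauss n.+1 abs_complete.
Let gUd := unorm_gauss n abs_complete.
Implicit Types (f g q u v : T) (h c : Td) (k s : nat) (p r w : {poly Td}).

Lemma tcoef_vanish (k : nat) (f : T) :
  coef_vanishes abs (PSeries (fun a => f (mcons k a))).
Proof.
move=> e e0; have [d fd] := tate_vanish f e0; exists d => a da /=.
by apply: fd; rewrite mdegree_mcons (leq_trans da) // leq_addl.
Qed.

(** T_(n+1) is viewed as a ring of series in X, the variable of index 0, with coefficients in T_n;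
    this is the coefficient of X^k. *)
Definition tcoef k (f : T) : Td := Tate (asboolT (tcoef_vanish k f)).

Lemma tcoefE k f a : tcoef k f a = f (mcons k a). Proof. by []. Qed.

Lemma tcoefD k : {morph tcoef k : f g / f + g}.
Proof. by move=> f g; apply: tateP => a. Qed.

Lemma tcoefB k : {morph tcoef k : f g / f - g}.
Proof. by move=> f g; apply: tateP => a. Qed.

Lemma tcoef0 k : tcoef k 0 = 0. Proof. by apply: tateP => a. Qed.

Lemma gauss_tcoef k f : gnd (tcoef k f) <= gn f.
Proof. by apply: gauss_le => a; rewrite tcoefE gauss_ub. Qed.

Lemma tcoef_ext f g : (forall k, tcoef k f = tcoef k g) -> f = g.
Proof.
move=> fg; apply: tateP => b; have [k [a ->]] := mcons_ex b.
by rewrite -!tcoefE fg.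
Qed.

Lemma tcoef_mono k l (c : K) a : tcoef k (mono c (mcons l a)) =
  if k == l then mono c a else 0.
Proof.
apply: tateP => b; rewrite tcoefE monoE mcons_eq.
by case: (k == l).
Qed.

Lemma incl_vanish (g : Td) : coef_vanishes abs
  (PSeries (fun b : mindex n.+1 => if b ord0 == 0%N then g (mtail b) else 0)).
Proof.
move=> e e0; have [d gd] := tate_vanish g e0; exists d => b.
have [k [a ->]] := mcons_ex b; rewrite /= mcons0E mdegree_mcons.
case: eqP => [->|_]; last by rewrite absval0.
by rewrite mtail_cons add0n => /gd.
Qed.

Definition incl (g : Td) : T := Tate (asboolT (incl_vanish g)).

Lemma inclE h k a : incl h (mcons k a) = if k == 0%N then h a else 0.
Proof.
by rewrite /= mcons0E mtail_cons.
Qed.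

Lemma tcoef_incl k h : tcoef k (incl h) = if k == 0%N then h else 0.
Proof. by apply: tateP => a; rewrite tcoefE inclE; case: ifP. Qed.

Lemma gauss_incl h : gn (incl h) = gnd h.
Proof.
apply/eqP; rewrite eq_le; apply/andP; split.
  apply: gauss_le => b; have [k [a ->]] := mcons_ex b; rewrite inclE.
  by case: ifP => _; rewrite ?absval0 ?gauss_ge0 ?gauss_ub.
by have := gauss_tcoef 0 (incl h); rewrite tcoef_incl.
Qed.

Lemma incl_mono (c : K) a : incl (mono c a) = mono c (mcons 0 a).
Proof. by apply: tcoef_ext => k; rewrite tcoef_incl tcoef_mono. Qed.

Fact incl_zmod_morphism : zmod_morphism incl.
Proof.
move=> f g; apply: tcoef_ext => k; rewrite tcoefB !tcoef_incl.
by case: ifP; rewrite ?subr0.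
Qed.

Fact incl_monoid_morphism : monoid_morphism incl.
Proof.
split.
  have := incl_mono 1 0; rewrite mcons00 -!tateCE => e.
  by rewrite -(rmorph1 (tateC abs n)) e rmorph1.
apply: (tate_mult_ext abs_complete gU).
- by move=> f g; apply: tcoef_ext => k; rewrite tcoefD !tcoef_incl; case: ifP; rewrite ?addr0.
- by move=> f; rewrite gauss_incl.
by move=> c a c' a'; rewrite monoM // !incl_mono monoM // mconsD.
Qed.

HB.instance Definition _ := GRing.isZmodMorphism.Build Td T incl incl_zmod_morphism.
HB.instance Definition _ := GRing.isMonoidMorphism.Build Td T incl incl_monoid_morphism.

Definition inclR : {rmorphism Td -> T} := incl.

Lemma incl_tateC (c : K) : incl (tateC abs n c) = tateC abs n.+1 c.
Proof. by rewrite !tateCE incl_mono mcons00. Qed.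

Definition tX : T := mono 1 (mcons 1 0).

Lemma tXE k : tX ^+ k = mono 1 (mcons k 0).
Proof.
elim: k => [|k IH]; first by rewrite expr0 mcons00 -tateCE rmorph1.
by rewrite exprS IH monoM // mulr1 mconsD addr0 add1n.
Qed.

Lemma tcoef_mul k m h f : tcoef k (incl h * tX ^+ m * f) =
  if (m <= k)%N then h * tcoef (k - m) f else 0.
Proof.
have M0 h' : 0 < gnd h' + 1 by rewrite ltr_wpDl ?gauss_ge0.
have leM h' : gnd h' <= gnd h' + 1 by rewrite lerDl.
have gX : gn (tX ^+ m) = 1 by rewrite tXE gauss_mono absval1.
apply: (tate_ext abs_complete gUd (M0 h) (phi := fun f => tcoef k (incl h * tX ^+ m * f))
  (psi := fun f => if (m <= k)%N then h * tcoef (k - m) f else 0)).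
- by move=> x y; rewrite mulrDr tcoefD.
- by move=> x y; case: ifP; rewrite ?addr0 // tcoefD mulrDr.
- move=> x; rewrite (le_trans (gauss_tcoef _ _)) // !gaussM gX mulr1 gauss_incl.
  by rewrite ler_wpM2r ?gauss_ge0.
- move=> x; case: ifP => _; last by rewrite (unorm_0 gUd) mulr_ge0 ?gauss_ge0 ?ltW.
  by rewrite gaussM ler_pM ?gauss_ge0 ?gauss_tcoef.
move=> c b; have [l [a ->]] := mcons_ex b; rewrite tXE.
apply: (tate_ext abs_complete gUd (M0 (mono c a))
  (phi := fun h => tcoef k (incl h * mono 1 (mcons m 0) * mono c (mcons l a)))
  (psi := fun h => if (m <= k)%N then h * tcoef (k - m) (mono c (mcons l a)) else 0)).
- by move=> x y; rewrite rmorphD !mulrDl tcoefD.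
- by move=> x y; case: ifP; rewrite ?addr0 // mulrDl.
- move=> x; rewrite (le_trans (gauss_tcoef _ _)) // !gaussM gauss_incl !gauss_mono.
  by rewrite absval1 mulr1 mulrC ler_wpM2r ?gauss_ge0 // lerDl.
- move=> x; case: ifP => _; last by rewrite (unorm_0 gUd) mulr_ge0 ?gauss_ge0 ?ltW.
  rewrite gaussM mulrC ler_pM ?gauss_ge0 // (le_trans (gauss_tcoef _ _)) //.
  by rewrite !gauss_mono lerDl.
move=> c' a'; rewrite incl_mono -mulrA !monoM // !mconsD !tcoef_mono add0n add0r mul1r.
have [mk|km] := leqP m k; last by rewrite ifN // neq_ltn (leq_trans km) ?leq_addr.
rewrite -{1}(subnKC mk) eqn_add2l; case: ifP => _; last by rewrite mulr0.
by rewrite monoM.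
Qed.

Definition wpoly_commr : commr_rmorph incl tX := fun x => mulrC _ _.

Definition wpoly : {rmorphism {poly Td} -> T} := horner_morph wpoly_commr.

Lemma wpolyC c : wpoly c%:P = incl c. Proof. exact: horner_morphC. Qed.

Lemma wpolyX : wpoly 'X = tX. Proof. exact: horner_morphX. Qed.

Lemma tcoef_wpoly k p : tcoef k (wpoly p) = p`_k.
Proof.
elim/poly_ind: p k => [|p c IH] k; first by rewrite rmorph0 tcoef0 coef0.
rewrite rmorphD rmorphM wpolyC wpolyX tcoefD tcoef_incl coefD coefMX coefC mulrC.
have := tcoef_mul k 1 1 (wpoly p); rewrite rmorph1 mul1r expr1 => ->.
by case: k => [|k] //=; rewrite mul1r IH subn1.
Qed.

Lemma wpoly_inj : injective wpoly.
Proof.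
by move=> p q e; apply/polyP => k; rewrite -!tcoef_wpoly e.
Qed.

Lemma wpoly_of_tcoef N f : (forall k, (N <= k)%N -> tcoef k f = 0) ->
  f = wpoly (\poly_(k < N) tcoef k f).
Proof.
move=> fN; apply: tcoef_ext => k; rewrite tcoef_wpoly coef_poly.
by case: ltnP => // /fN.
Qed.

Lemma lead_wpoly_size p k a : lead (wpoly p) (mcons k a) -> (k < size p)%N.
Proof.
case=> + _ _; rewrite -tcoefE tcoef_wpoly => p0; rewrite ltnNge.
by apply: contraNN p0 => /leq_sizeP/(_ _ (leqnn k)) ->.
Qed.

(** If q is nonzero, the leading exponent of q g has X-degree at least s, which exceeds the degree
    of r. *)
Lemma weierstrass_unique g s q r : lead g (mcons s 0) -> (size r <= s)%N ->
  q * g + wpoly r = 0 -> q = 0 /\ r = 0.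
Proof.
move=> gs rs e; have [q0|/lead_exists[b qb]] := eqVneq q 0.
  by split=> //; apply: wpoly_inj; move: e; rewrite q0 mul0r add0r rmorph0.
have [k [a bE]] := mcons_ex b; rewrite {}bE in qb.
have [+ _] := leadM qb gs; rewrite mconsD.
have -> : q * g = wpoly (- r) by rewrite rmorphN; apply/eqP; rewrite -addr_eq0 e.
move=> /lead_wpoly_size; rewrite size_polyN => lt.
by have := leq_trans lt rs; rewrite ltnNge leq_addl.
Qed.

(** Long division by a polynomial that is monic of degree s in X and has norm at most 1, so that no
    step increases the norm. *)
Lemma euclid_wpoly (g0 : T) (s : nat) :
  tcoef s g0 = 1 -> (forall k, (s < k)%N -> tcoef k g0 = 0) -> gn g0 <= 1 ->
  forall N f, (forall k, (N <= k)%N -> tcoef k f = 0) ->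
  exists q r, [/\ (size r <= s)%N, f = q * g0 + wpoly r & gn q <= gn f].
Proof.
move=> gs gk g1; elim=> [|N IH] f fN.
  exists 0, 0; rewrite size_poly0 mul0r add0r rmorph0 (unorm_0 gU) gauss_ge0.
  by split=> //; apply: tcoef_ext => k; rewrite fN // tcoef0.
have [Ns|sN] := ltnP N s.
  exists 0, (\poly_(k < N.+1) tcoef k f); rewrite mul0r add0r (unorm_0 gU) gauss_ge0.
  split=> //; first exact: leq_trans (size_poly _ _) Ns.
  exact: wpoly_of_tcoef.
pose q1 := incl (tcoef N f) * tX ^+ (N - s).
have q1f : gn q1 <= gn f.
  by rewrite gaussM gauss_incl tXE gauss_mono absval1 mulr1 gauss_tcoef.
have f1 : gn (f - q1 * g0) <= gn f.
  apply: (unormB_le gU) => //; rewrite gaussM -[leRHS]mulr1.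
  by rewrite ler_pM ?gauss_ge0.
have [|q [r [rs e qf]]] := IH (f - q1 * g0).
  move=> k Nk; rewrite tcoefB tcoef_mul (leq_trans (leq_subr _ _) Nk).
  move: Nk; rewrite leq_eqVlt => /orP[/eqP <-|Nk].
    by rewrite subKn // gs mulr1 subrr.
  rewrite fN // gk ?mulr0 ?subr0 //.
  by move: sN Nk; clear; lia.
exists (q + q1), r; split=> //.
  by rewrite mulrDl addrAC -e subrK.
by apply: (unormD_le gU) => //; apply: le_trans qf f1.
Qed.

(* Modulo its coefficients of norm < 1 beyond X^s, the divisor is a monic
   polynomial in X, by which polynomials can be divided; the error is contracted
   by a factor eps < 1. *)
Lemma weierstrass_approx (g : T) (s : nat) : lead g (mcons s 0) ->
  g (mcons s 0) = 1 ->
  exists2 eps : R, 0 < eps < 1 & forall f, exists q r,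
    [/\ (size r <= s)%N, gn q <= gn f & gn (f - q * g - wpoly r) <= eps * gn f].
Proof.
move=> gs g1; have gn1 : gn g = 1 by rewrite (lead_gauss gs) g1 absval1.
case: gs => _ gs gs'; rewrite g1 absval1 in gs gs'.
pose P : set (mindex n.+1) := mlt (mcons s 0).
(* [P] also removes the terms X^s z^a with a nonzero, so the coefficient of X^s in [g0] is exactly
   1. *)
pose h := tfilter P g; pose g0 := g - h.
have h1 : gn h < 1.
  apply: gauss_lt => b; rewrite tfilterE; case: asboolP => [/gs'//|_].
  by rewrite absval0.
have g0E b : g0 b = if `[< P b >] then 0 else g b.
  by rewrite tateBE tfilterE; case: asboolP; rewrite ?subrr ?subr0.
have g0s : tcoef s g0 = 1.
  apply: tateP => a; rewrite tcoefE g0E [RHS]/=; case: asboolP => [/mlt_mcons|].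
    case=> [|[_ a0]]; first by rewrite ltnn.
    by case: eqP => // a0'; move: a0; rewrite a0' => /mlt_irr.
  case: eqP => [-> //|a0] nP; case: nP; apply/mlt_mcons; right; split => //.
  by have [e|//|/mlt0//] := mlt_total 0 a; case: a0; rewrite -e.
have g0k k : (s < k)%N -> tcoef k g0 = 0.
  move=> sk; apply: tateP => a; rewrite tcoefE g0E ifT //; apply/asboolP/mlt_mcons.
  by left.
have g01 : gn g0 <= 1 by apply: (unormB_le gU); [rewrite gn1|exact: ltW].
(* The maximum keeps eps positive when h = 0; the tail of f in high X-degree can then be made
   smaller than eps |f|. *)
pose eps := Num.max (gn h) 2^-1.
have eps0 : 0 < eps by rewrite lt_max invr_gt0 ltr0n orbT.
exists eps; first by rewrite eps0 gt_max h1 invf_lt1 ?ltr0n // ltr1n.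
move=> f; have [->|f0] := eqVneq f 0.
  exists 0, 0; rewrite size_poly0 mul0r subr0 rmorph0 subr0 (unorm_0 gU).
  by rewrite mulr0.
have gf : 0 < gn f.
  by rewrite lt0r gauss_ge0 andbT; apply: contraNneq f0 => /gauss_eq0/eqP.
have [N fN] := tate_vanish f (mulr_gt0 eps0 gf).
pose f0' := tfilter (fun b : mindex n.+1 => (b ord0 < N)%N) f.
have ff0 : gn (f - f0') <= eps * gn f.
  apply: gauss_le => b; have [k [a ->]] := mcons_ex b.
  rewrite tateBE tfilterE mcons0E; case: asboolP => [_|/negP].
    by rewrite subrr absval0 mulr_ge0 ?ltW.
  rewrite -leqNgt subr0 => Nk; rewrite ltW // fN // mdegree_mcons.
  by rewrite (leq_trans Nk) ?leq_addr.
have f0f : gn f0' <= gn f.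
  apply: gauss_le => b; rewrite tfilterE; case: ifP => _; first exact: gauss_ub.
  by rewrite absval0 gauss_ge0.
have [k Nk|q [r [rs e qf]]] := @euclid_wpoly g0 s g0s g0k g01 N f0'.
  apply: tateP => a; rewrite tcoefE tfilterE mcons0E ifN //; apply/asboolP/negP.
  by rewrite -leqNgt.
exists q, r; split=> //; first exact: le_trans qf f0f.
have -> : f - q * g - wpoly r = (f - f0') - q * h by rewrite e /g0; ring.
apply: (unormB_le gU) => //; rewrite gaussM mulrC ler_pM ?gauss_ge0 //.
  by rewrite le_max lexx.
exact: le_trans qf f0f.
Qed.

(** The quotients of the iterated approximate division sum to q. Then f - q g is a convergent sum of
    polynomials of degree less than s, and the continuous maps [tcoef k] with k >= s kill each of
    them, so it is itself such a polynomial. *)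
Lemma weierstrass_division (g : T) (s : nat) : lead g (mcons s 0) ->
  forall f, exists q r, (size r <= s)%N /\ f = q * g + wpoly r.
Proof.
move=> gs.
wlog g1 : g gs / g (mcons s 0) = 1.
  move=> wl f; have [g0 _ _] := gs.
  have gc : lead (tateC abs n.+1 (g (mcons s 0))^-1 * g) (mcons s 0).
    have c0 : (g (mcons s 0))^-1 != 0 by rewrite invr_eq0.
    by have [] := leadM (lead_mono abs 0 c0) gs; rewrite -tateCE add0r.
  have [|q [r [rs e]]] := wl _ gc _ f; first by rewrite tateCM_E // mulVf.
  by exists (q * tateC abs n.+1 (g (mcons s 0))^-1), r; rewrite -mulrA.
move=> f; have [eps /andP[e0 e1] step] := weierstrass_approx gs g1.
have /choice[F FP] : forall f : T, exists p : T * {poly Td},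
    [/\ (size p.2 <= s)%N, gn p.1 <= gn f & gn (f - p.1 * g - wpoly p.2) <= eps * gn f].
  by move=> f'; have [q [r H]] := step f'; exists (q, r).
pose next f' := f' - (F f').1 * g - wpoly (F f').2.
pose u k := iter k next f.
have uS k : u k.+1 = u k - (F (u k)).1 * g - wpoly (F (u k)).2 by [].
have ule k : gn (u k) <= gn f * eps ^+ k.
  elim: k => [|k IH]; first by rewrite expr0 mulr1.
  have [_ _] := FP (u k); rewrite -uS => /le_trans; apply.
  by rewrite exprS mulrCA ler_wpM2l // ltW.
have u0 : null_seq gn u := null_seq_geom (ltW e0) e1 ule.
pose qs k := (F (u k)).1.
have q0 : null_seq gn qs.
  apply: (null_seq_geom (ltW e0) e1) => k; have [_ qle _] := FP (u k).
  exact: le_trans qle (ule k).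
pose q := ssum gn qs; pose rho := f - q * g.
have rs k : (s <= k)%N -> tcoef k rho = 0.
  move=> sk; pose w i := (u i - u i.+1) - qs i * g.
  have gM1 : 0 < gn g + 1 by rewrite ltr_wpDl ?gauss_ge0.
  have [qg0 qgE] := @ssum_map _ _ _ _ _ (fun x => x * g) (gn g + 1) qs gU gU
    (fun x y => mulrDl x y g) gM1
    (fun x => le_trans (gaussM_le abs_complete x g)
       (eq_ind_r (fun z => z <= _) (ler_wpM2r (gauss_ge0 x) (ler_wpDr ler01 (lexx (gn g)))) (mulrC _ _)))
    q0.
  have uu0 : null_seq gn (fun i => u i - u i.+1).
    move=> e e0'; have [m um] := u0 _ e0'; exists m => i mi.
    rewrite subr0; apply: unormB_lt => //.
      by have := um i mi; rewrite subr0.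
    by have := um i.+1 (leqW mi); rewrite subr0.
  have nqg0 : null_seq gn (fun i => - (qs i * g)).
    move=> e e0'; have [m um] := qg0 _ e0'; exists m => i /um.
    by rewrite !subr0 (unormN gU).
  have rhoE : rho = ssum gn w.
    rewrite /w ssumD // ssum_telescope // /rho qgE; congr (_ + _).
    have [_ <-] := @ssum_map _ _ _ _ _ (fun x => - x) 1 _ gU gU (@opprD _) ltr01
      (fun x => eq_ind_r (fun z => z <= _) (eq_ind_r (fun z => _ <= z) (lexx _) (mul1r _)) (unormN gU x)) qg0.
    by [].
  have w0 : null_seq gn w by apply: null_seqD.
  rewrite rhoE; have [_ ->] := @ssum_map _ _ _ _ _ (tcoef k) 1 w gU gUd (tcoefD k) ltr01
    (fun x => eq_ind_r (fun z => _ <= z) (gauss_tcoef k x) (mul1r _)) w0.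
  have -> : (fun i => tcoef k (w i)) = fun=> 0.
    apply/funext => i; have -> : w i = wpoly (F (u i)).2 by rewrite /w uS /qs; ring.
    rewrite tcoef_wpoly; have [ri _ _] := FP (u i).
    by move/leq_sizeP: (leq_trans ri sk); apply.
  by apply: (ssum_single gUd (i0 := 0)).
exists q, (\poly_(k < s) tcoef k rho); split; first exact: size_poly.
by rewrite -wpoly_of_tcoef // /rho addrC subrK.
Qed.

(** A monic polynomial of norm at most 1 is a Weierstrass polynomial: its coefficient at X^s is the
    constant 1, which dominates. *)
Lemma lead_monic p s : p \is monic -> size p = s.+1 -> gn (wpoly p) <= 1 ->
  lead (wpoly p) (mcons s 0) /\ gn (wpoly p) = 1.
Proof.
move=> pm ps p1; have top a : wpoly p (mcons s a) = if a == 0 then 1 else 0.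
  rewrite -tcoefE tcoef_wpoly.
  by have := monicP pm; rewrite /lead_coef ps /= => ->.
have l : lead (wpoly p) (mcons s 0).
  split; rewrite top eqxx ?oner_eq0 ?absval1 // => b.
    exact: le_trans (gauss_ub _ _) p1.
  have [k [a ->]] := mcons_ex b; move=> /mlt_mcons[sk|[<- a0]].
    rewrite -tcoefE tcoef_wpoly nth_default ?absval0 ?ltr01 // ps //.
  have /negPf aN0 : a != 0.
    by apply/eqP => a0'; move: a0; rewrite a0'; apply: mlt_irr.
  by rewrite top aN0 absval0.
by split=> //; rewrite (lead_gauss l) top eqxx absval1.
Qed.

Lemma gauss_monic_ge1 p : p \is monic -> 1 <= gn (wpoly p).
Proof.
move=> pm; have := gauss_ub (wpoly p) (mcons (size p).-1 0).
by rewrite -tcoefE tcoef_wpoly -/(lead_coef p) (monicP pm) /= eqxx absval1.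
Qed.

(** Division of X^s by g gives w = X^s - r = q g. Comparison of leading exponents shows that the one
    of q is 0, so q is a unit. *)
Lemma weierstrass_preparation g s : lead g (mcons s 0) ->
  exists w u v, [/\ w \is monic, size w = s.+1, lead (wpoly w) (mcons s 0),
    wpoly w = u * g & v * u = 1].
Proof.
move=> gs; have [q [r [rs e]]] := weierstrass_division gs (tX ^+ s).
pose w : {poly Td} := 'X^s - r.
have wE : wpoly w = q * g by rewrite rmorphB rmorphXn wpolyX e addrK.
have ws : size w = s.+1.
  by rewrite size_polyDl size_polyXn // size_polyN ltnS.
have wm : w \is monic.
  rewrite monicE /lead_coef ws /= coefB coefXn eqxx.
  by move/leq_sizeP: rs => /(_ _ (leqnn s)) ->; rewrite subr0.
have w0 : wpoly w != 0.
  rewrite -(rmorph0 wpoly) (inj_eq wpoly_inj).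
  by apply: monic_neq0.
have q0 : q != 0 by apply: contraNneq w0 => q0; rewrite wE q0 mul0r.
have [b qb] := lead_exists q0; have [k [a bE]] := mcons_ex b.
have [lw _] := leadM qb gs; rewrite bE mconsD addr0 -wE in lw.
have k0 : k = 0%N.
  by have := lead_wpoly_size lw; rewrite ws ltnS -{2}(add0n s) leq_add2r leqn0 => /eqP.
have a0 : a = 0.
  have [nz _ _] := lw; apply/eqP; apply: contraNT nz => /negPf aN0.
  rewrite -tcoefE tcoef_wpoly k0 add0n.
  by have := monicP wm; rewrite /lead_coef ws /= => -> /=; rewrite aN0.
have [v qv] : exists v, q * v = 1.
  by apply: lead0_unit => //; rewrite -mcons00 -a0 -k0 -bE.
exists w, q, v; split=> //; last by rewrite mulrC.
by rewrite k0 a0 add0n in lw.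
Qed.

(** The Euclidean division of r by p in T_n[X] is also a Weierstrass division, whose uniqueness
    makes the remainder vanish. Divisibility by p thus descends from T_(n+1) to T_n[X]. *)
Lemma wpoly_dvd p s q r : p \is monic -> lead (wpoly p) (mcons s 0) ->
  size p = s.+1 -> wpoly r = q * wpoly p ->
  exists h' : {poly Td}, r = h' * p.
Proof.
move=> pm ps sp e; exists (Pdiv.Idomain.divp r p).
have := Pdiv.IdomainMonic.divp_eq pm r; set h := Pdiv.Idomain.divp _ _.
set m := Pdiv.Idomain.modp _ _ => rE.
have ms : (size m <= s)%N.
  by rewrite -ltnS -sp Pdiv.Idomain.ltn_modpN0 // monic_neq0.
have [_ m0] : wpoly h - q = 0 /\ m = 0.
  apply: (weierstrass_unique ps) => //.
  by rewrite mulrBl -e rE rmorphD rmorphM; ring.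
by rewrite {1}rE m0 addr0.
Qed.

End WeierstrassDivision.

(** * Valuation rings and Gauss's lemma *)

Section ValuationRings.
Variable F : fieldType.

Record subring (W : set F) : Prop := Subring {
  subring1 : W 1;
  subringB : forall x y, W x -> W y -> W (x - y);
  subringM : forall x y, W x -> W y -> W (x * y) }.

Section SubringTheory.
Variables (W : set F) (sW : subring W).

Lemma subring0 : W 0.
Proof. by rewrite -(subrr 1); apply: (subringB sW); exact: subring1. Qed.

Lemma subringN x : W x -> W (- x).
Proof. by move=> Wx; rewrite -sub0r; apply: (subringB sW) => //; exact: subring0. Qed.

Lemma subringD x y : W x -> W y -> W (x + y).
Proof. by move=> Wx Wy; rewrite -(opprK y); apply: (subringB sW) => //; exact: subringN. Qed.

Lemma subringX x k : W x -> W (x ^+ k).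
Proof.
move=> Wx; elim: k => [|k IH]; first by rewrite expr0; exact: subring1.
by rewrite exprS; apply: (subringM sW).
Qed.

Lemma subring_sum (I : Type) (r : seq I) (P : pred I) (G : I -> F) :
  (forall i, P i -> W (G i)) -> W (\sum_(i <- r | P i) G i).
Proof.
move=> GW; apply: (big_ind W) => //; first exact: subring0.
by move=> x y; apply: subringD.
Qed.

End SubringTheory.

(** Valuation rings of arbitrary rank: neither the Gauss-lexicographic one nor those produced by
    Zorn's lemma need be discrete. *)
Record vring (W : set F) : Prop := Vring {
  vring_subring : subring W;
  vring_total : forall x, x != 0 -> W x \/ W x^-1 }.

(** The maximal ideal of W when W is a valuation ring. Zero is listed apart because 0^-1 = 0 lies in
    W. *)
Definition vmax (W : set F) : set F := [set x | x = 0 \/ ~ W x^-1].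

Section VringTheory.
Variables (W : set F) (vW : vring W).
Let sW := vring_subring vW.

Lemma vmax_sub x : vmax W x -> W x.
Proof.
move=> [->|]; first exact: subring0 sW.
have [->|x0] := eqVneq x 0; first by rewrite invr0; case; exact: subring0 sW.
by case: (vring_total vW x0).
Qed.

Lemma vmax1 : ~ vmax W 1.
Proof. by case=> [/eqP|]; rewrite ?oner_eq0 // invr1; apply; exact: subring1 sW. Qed.

Lemma vmaxM x y : W x -> vmax W y -> vmax W (x * y).
Proof.
move=> Wx [->|Wy]; first by left; rewrite mulr0.
have [->|x0] := eqVneq x 0; first by left; rewrite mul0r.
right; rewrite invfM => h; apply: Wy.
by rewrite -(mulKf x0 y^-1) mulrCA; apply: (subringM sW).
Qed.

Lemma vmaxD x y : vmax W x -> vmax W y -> vmax W (x + y).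
Proof.
wlog xy : x y / x != 0 -> y != 0 -> W (x / y).
  move=> wl mx my; have [x0|x0] := eqVneq x 0.
    by apply: wl => //; rewrite x0 eqxx.
  have [y0|y0] := eqVneq y 0; first by apply: wl => //; rewrite y0 eqxx.
  have xy0 : x / y != 0 by rewrite mulf_neq0 ?invr_eq0.
  case: (vring_total vW xy0) => h; first exact: wl.
  by rewrite addrC; apply: wl => // _ _; rewrite -invf_div.
move=> mx my; have [->|x0] := eqVneq x 0; first by rewrite add0r.
have [->|y0] := eqVneq y 0; first by rewrite addr0.
have -> : x + y = (1 + x / y) * y by rewrite mulrDl mul1r divfK // addrC.
apply: vmaxM => //; apply: (subringD sW); [exact: subring1|exact: xy].
Qed.

Lemma vmaxN x : vmax W x -> vmax W (- x).
Proof.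
by rewrite -mulN1r; apply: vmaxM; apply: (subringN sW); exact: subring1.
Qed.

Lemma vmax_sum (I : Type) (r : seq I) (P : pred I) (G : I -> F) :
  (forall i, P i -> vmax W (G i)) -> vmax W (\sum_(i <- r | P i) G i).
Proof.
move=> GW; apply: (big_ind (vmax W)) => //; first by left.
by move=> x y; apply: vmaxD.
Qed.

Lemma vring_unit x : W x -> ~ vmax W x -> x != 0 /\ W x^-1.
Proof.
move=> Wx nm; split; first by apply/eqP => x0; apply: nm; left.
by apply: contrapT => h; apply: nm; right.
Qed.

Lemma vmax_inv x : x != 0 -> vmax W x -> ~ W x^-1.
Proof. by move=> x0 [e|//]; rewrite e eqxx in x0. Qed.

Lemma vmax_or x : x != 0 -> W x \/ vmax W x^-1.
Proof.
move=> x0; have [h|h] := pselect (W x); [by left|right; right].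
by rewrite invrK.
Qed.

Lemma vmaxX x k : (0 < k)%N -> vmax W x -> vmax W (x ^+ k).
Proof.
move=> k0 mx; rewrite -(prednK k0) exprSr; apply: vmaxM => //.
by apply: (subringX sW); exact: vmax_sub.
Qed.

Lemma vmax_root x k : vmax W (x ^+ k) -> vmax W x.
Proof.
move=> mxk; have [->|x0] := eqVneq x 0; first by left.
right=> h; case: vmax1; rewrite -(@mulVf _ (x ^+ k)) ?expf_neq0 //.
by apply: vmaxM => //; rewrite -exprVn; apply: (subringX sW).
Qed.

Lemma vring_one_plus x : vmax W x -> 1 + x != 0 /\ W (1 + x)^-1.
Proof.
move=> mx; apply: vring_unit.
  by apply: (subringD sW); [exact: subring1|exact: vmax_sub].
move=> h; apply: vmax1; rewrite -(addrK x 1); apply: vmaxD => //; exact: vmaxN.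
Qed.

Lemma vring_div_trans y x z : y != 0 -> W (x / y) -> W (y / z) -> W (x / z).
Proof. by move=> y0 xy yz; rewrite -(divfK y0 x) -mulrA; apply: (subringM sW). Qed.

Lemma vring_max (I : eqType) (s : seq I) (y : I -> F) (i0 : I) :
  i0 \in s -> y i0 != 0 ->
  exists i, [/\ i \in s, y i != 0 & forall k, k \in s -> W (y k / y i)].
Proof.
move=> i0s yi0; pose le i k := y i = 0 \/ (y k != 0 /\ W (y i / y k)).
have [i k|i k l|i si imax] := @seq_max I le s i0 _ _ i0s.
- have [?|ti] := eqVneq (y i) 0; first by left; left.
  have [?|tk] := eqVneq (y k) 0; first by right; left.
  have [|h|h] := vring_total vW (x := y i / y k).
  + by rewrite mulf_neq0 ?invr_eq0.
  + by left; right.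
  + by right; right; rewrite invf_div in h.
- move=> [?|[tk Wik]] [tk0|[tl Wkl]]; try by left.
  + by rewrite tk0 eqxx in tk.
  + by right; split => //; apply: vring_div_trans Wik Wkl.
have yi : y i != 0.
  have [e|[//]] := imax i0 i0s.
  by rewrite e eqxx in yi0.
exists i; split=> // k /imax[->|[]//].
by rewrite mul0r; exact: subring0 sW.
Qed.

(** In a vanishing sum the largest value is attained twice: otherwise division by the unique largest
    term would write 1 as a sum of elements of the maximal ideal. *)
Lemma vring_sum0 (I : finType) (t : I -> F) (i0 : I) :
  \sum_i t i = 0 -> t i0 != 0 ->
  exists i k, [/\ i != k, t i != 0, t k != 0, W (t k / t i) & ~ vmax W (t k / t i)].
Proof.
move=> t0 ti0; have [i [_ ti imax]] := vring_max (mem_enum _ i0) ti0.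
apply: contrapT => nk; apply: vmax1.
have -> : 1 = - \sum_(k | k != i) t k / t i.
  rewrite -mulr_suml; apply: (mulIf ti); rewrite mulNr divfK // mul1r.
  by apply/eqP; rewrite -addr_eq0; move: t0; rewrite (bigD1 i) //= => ->.
apply/vmaxN/vmax_sum => k ki; apply: contrapT => nm.
apply: nk; exists i, k; split=> //; [by rewrite eq_sym| |exact: imax (mem_enum _ k)].
by apply/eqP => tk0; apply: nm; rewrite tk0 mul0r; left.
Qed.

End VringTheory.

Definition rval_ring (lam : F -> int) : set F := [set x | x != 0 -> 0 <= lam x].

Lemma vring_rval lam : rval lam -> vring (rval_ring lam).
Proof.
move=> lamP; have l1 : lam 1 = 0 := rval1 lamP; split; first split.
- by move=> _; rewrite l1.
- move=> x y Wx Wy xy0; have [x0|x0] := eqVneq x 0.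
    move: xy0; rewrite x0 sub0r oppr_eq0 => y0; rewrite rvalN //; exact: Wy.
  have [y0|y0] := eqVneq y 0; first by rewrite y0 subr0; exact: Wx.
  rewrite (le_trans _ (lamP.2 _ _ x0 _ xy0)) ?oppr_eq0 //.
  by rewrite le_min Wx //= rvalN // Wy.
- move=> x y Wx Wy; rewrite /rval_ring /= mulf_eq0 negb_or => /andP[x0 y0].
  by rewrite rvalM // addr_ge0 ?Wx ?Wy.
- move=> x x0; have [h|/ltW h] := leP 0 (lam x); [left=> _ //|right=> _].
  by rewrite rvalV // oppr_ge0.
Qed.

Section GaussLemma.
Variables (W : set F) (vW : vring W) (mu : F) (N : nat).
Hypotheses (mu0 : mu != 0) (N0 : (0 < N)%N).
Let sW := vring_subring vW.
Implicit Types p q : {poly F}.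

(* A valuation of wt p i is N times the value of p`_i plus i times that of mu: the
   weights define an N-th power of the Gauss norm of radius |mu|^(1/N), which is
   multiplicative. *)
Let wt p i := p`_i ^+ N * mu ^+ i.

Lemma leading_weight p : p \is monic -> exists i,
  [/\ (i < size p)%N, p`_i != 0, forall k, W (wt p k / wt p i)
    & forall k, (k < i)%N -> vmax W (wt p k / wt p i)].
Proof.
move=> pm; pose le i k := wt p i = 0 \/ (wt p k != 0 /\ W (wt p i / wt p k)).
have le_tot i k : le i k \/ le k i.
  have [?|ti] := eqVneq (wt p i) 0; first by left; left.
  have [?|tk] := eqVneq (wt p k) 0; first by right; left.
  have [|h|h] := vring_total vW (x := wt p i / wt p k).
  - by rewrite mulf_neq0 ?invr_eq0.
  - by left; right.
  - by right; right; rewrite invf_div in h.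
have le_tr i k l : le i k -> le k l -> le i l.
  move=> [?|[tk Wik]] [tk0|[tl Wkl]]; try by left.
    by rewrite tk0 eqxx in tk.
  by right; split => //; apply: vring_div_trans Wik Wkl.
have le_refl i : le i i by case: (le_tot i i).
have ex : forall m, exists i, [/\ (i <= m)%N,
    forall k, (k <= m)%N -> le k i & forall k, (k < i)%N -> ~ le i k].
  elim=> [|m [i [im imax imin]]].
    by exists 0%N; split => // k; rewrite leqn0 => /eqP ->.
  have [h|h] := pselect (le m.+1 i).
    exists i; split=> //; first exact: leqW.
    by move=> k; rewrite leq_eqVlt => /orP[/eqP -> //|]; rewrite ltnS => /imax.
  have im1 : le i m.+1 by case: (le_tot i m.+1).
  exists m.+1; split=> // k.
    rewrite leq_eqVlt => /orP[/eqP -> //|]; rewrite ltnS => /imax ki.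
    exact: le_tr ki im1.
  by rewrite ltnS => /imax ki hk; apply: h; apply: le_tr hk ki.
have [i [iN imax imin]] := ex (size p).-1.
have sp0 : (0 < size p)%N by rewrite size_poly_gt0 monic_neq0.
have top : wt p (size p).-1 != 0.
  by rewrite /wt -/(lead_coef p) (monicP pm) expr1n mul1r expf_neq0.
have wi : wt p i != 0.
  have [e|[//]] := imax _ (leqnn (size p).-1).
  by rewrite e eqxx in top.
exists i; split.
- by rewrite (leq_ltn_trans iN) // prednK.
- by apply: contraNneq wi => e; rewrite /wt e expr0n gtn_eqF // mul0r.
- move=> k; have [kp|pk] := leqP k (size p).-1.
    by have [->|[]//] := imax k kp; rewrite mul0r; exact: subring0 sW.
  rewrite /wt nth_default; first by rewrite expr0n gtn_eqF // !mul0r; exact: subring0 sW.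
  by rewrite -(prednK sp0).
- move=> k ki; apply: contrapT => nm.
  have [k0|[_ Wki]] := imax k (leq_trans (ltnW ki) iN).
    by apply: nm; rewrite k0 mul0r; left.
  have [r0 rV] := vring_unit Wki nm.
  apply: (imin k ki); right; split; last by rewrite -invf_div.
  by apply: contraNneq r0 => ->; rewrite mul0r.
Qed.

(** With i and k the least indices of maximal weight, any other term p_l q_(i+k-l) has l < i or i +
    k - l < k and is strictly smaller. So the coefficient of p q at i + k has the weight of p_i q_k
    up to a unit. *)
Lemma gauss_lemma_aux p q : p \is monic -> q \is monic -> exists i k,
  [/\ (i < size p)%N /\ (k < size q)%N, p`_i != 0 /\ q`_k != 0,
      W (mu ^+ (size p).-1 / wt p i) /\ W (mu ^+ (size q).-1 / wt q k),
      (forall l, W (wt p l / wt p i)) /\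
      (forall l, (l < i)%N -> vmax W (wt p l / wt p i))
    & exists2 u, W u & wt p i * wt q k = u * wt (p * q) (i + k)].
Proof.
move=> pm qm; have [i [ip pi pW pV]] := leading_weight pm.
have [k [kq qk qW qV]] := leading_weight qm.
have tp : wt p (size p).-1 = mu ^+ (size p).-1.
  by rewrite /wt -/(lead_coef p) (monicP pm) expr1n mul1r.
have tq : wt q (size q).-1 = mu ^+ (size q).-1.
  by rewrite /wt -/(lead_coef q) (monicP qm) expr1n mul1r.
exists i, k; split=> //; first by rewrite -tp -tq; split.
have wp : wt p i != 0 by rewrite mulf_neq0 ?expf_neq0.
have wq : wt q k != 0 by rewrite mulf_neq0 ?expf_neq0.
pose S := \sum_(l < (i + k).+1 | l != inord i) p`_l * q`_(i + k - l).
have ik : (i < (i + k).+1)%N by rewrite ltnS leq_addr.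
have E : (p * q)`_(i + k) = p`_i * q`_k + S.
  by rewrite coefM (bigD1 (inord i)) //= inordK // addKn.
have mS : vmax W (S / (p`_i * q`_k)).
  rewrite /S mulr_suml; apply: vmax_sum => // l lk.
  apply: (@vmax_root W vW _ N).
  have -> : (p`_l * q`_(i + k - l) / (p`_i * q`_k)) ^+ N =
      (wt p l / wt p i) * (wt q (i + k - l) / wt q k).
    have muE : mu ^+ l * mu ^+ (i + k - l) = mu ^+ i * mu ^+ k.
      by rewrite -!exprD subnKC // -ltnS.
    transitivity ((p`_l * q`_(i + k - l)) ^+ N * (mu ^+ l * mu ^+ (i + k - l)) /
                  ((p`_i * q`_k) ^+ N * (mu ^+ i * mu ^+ k))).
      by rewrite muE -[in RHS]mulf_div divff ?mulr1 ?expr_div_n // mulf_neq0 ?expf_neq0.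
    by rewrite /wt !exprMn; field; rewrite !expf_neq0.
  have [li|il] := ltnP l i.
    by rewrite mulrC; apply: vmaxM => //; exact: pV.
  apply: vmaxM => //; apply: qV.
  have {}il : (i < l)%N.
    rewrite ltn_neqAle il andbT; apply: contra lk => /eqP e.
    by apply/eqP/val_inj; rewrite /= inordK // -e.
  by have := ltn_ord l; lia.
have [u0 uV] := vring_one_plus vW mS.
exists ((1 + S / (p`_i * q`_k))^-1 ^+ N); first exact: (subringX sW).
have -> : wt (p * q) (i + k) = (wt p i * wt q k) * (1 + S / (p`_i * q`_k)) ^+ N.
  have E2 : p`_i * q`_k + S = p`_i * q`_k * (1 + S / (p`_i * q`_k)).
    by rewrite mulrDr mulr1 mulrCA divff ?mulr1 // mulf_neq0.
  by rewrite /wt E E2 !exprMn exprD; set y := (1 + _) ^+ N; ring.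
by rewrite [RHS]mulrCA -exprMn mulVf // expr1n mulr1.
Qed.

Lemma size_monicM_pred p q : p \is monic -> q \is monic ->
  (size (p * q)%R).-1 = ((size p).-1 + (size q).-1)%N.
Proof.
move=> pm qm; rewrite size_monicM ?monic_neq0 //.
have : (0 < size p)%N by rewrite size_poly_gt0 monic_neq0.
have : (0 < size q)%N by rewrite size_poly_gt0 monic_neq0.
lia.
Qed.

(** The maximal weights of p and q are at least those of their leading coefficients, while their
    product is at most that of the leading coefficient of p q; hence equality for both factors. *)
Lemma gauss_lemma p q : p \is monic -> q \is monic ->
  (forall i, W (wt (p * q) i / mu ^+ (size (p * q)).-1)) ->
  forall i, W (wt p i / mu ^+ (size p).-1).
Proof.
move=> pm qm PW l.
have [i [k [[ip kq] [pi0 qk0] [Ap Aq] [Wp _] [u Wu uE]]]] := gauss_lemma_aux pm qm.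
have mu' m : mu ^+ m != 0 by rewrite expf_neq0.
have wp : wt p i != 0 by rewrite mulf_neq0 ?expf_neq0.
have wq : wt q k != 0 by rewrite mulf_neq0 ?expf_neq0.
have := PW (i + k)%N; rewrite size_monicM_pred // exprD => {}PW.
have -> : wt p l / mu ^+ (size p).-1 = (wt p l / wt p i) *
    (u * (wt (p * q) (i + k) / (mu ^+ (size p).-1 * mu ^+ (size q).-1)) *
     (mu ^+ (size q).-1 / wt q k)).
  rewrite [u * (_ / _)]mulrA -uE; field.
  by rewrite !mu' wp wq.
apply: (subringM sW) => //; apply: (subringM sW) => //.
exact: (subringM sW).
Qed.

(** By the hypothesis the index i + k must be the degree of p q, so i is the degree of p; being the
    least index of maximal weight, it leaves all lower weights strictly smaller. *)
Lemma gauss_lemma_strict p q : p \is monic -> q \is monic ->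
  (forall i, (i < (size (p * q)%R).-1)%N ->
     vmax W (wt (p * q) i / mu ^+ (size (p * q)).-1)) ->
  forall i, (i < (size p).-1)%N -> vmax W (wt p i / mu ^+ (size p).-1).
Proof.
move=> pm qm PW l lp.
have [i [k [[ip kq] [pi0 qk0] [Ap Aq] [Wp Vp] [u Wu uE]]]] := gauss_lemma_aux pm qm.
have mu' m : mu ^+ m != 0 by rewrite expf_neq0.
have wp : wt p i != 0 by rewrite mulf_neq0 ?expf_neq0.
have wq : wt q k != 0 by rewrite mulf_neq0 ?expf_neq0.
have tp : wt p (size p).-1 = mu ^+ (size p).-1.
  by rewrite /wt -/(lead_coef p) (monicP pm) expr1n mul1r.
have sp : size p = (size p).-1.+1 by rewrite (ltn_predK ip).
have sq : size q = (size q).-1.+1 by rewrite (ltn_predK kq).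
have [lt|ge] := ltnP (i + k) (size (p * q)).-1; last first.
  have ip' : i = (size p).-1.
    by move: ge; rewrite size_monicM_pred //; lia.
  by rewrite -tp -ip'; apply: Vp; rewrite ip'.
case: (vmax1 vW).
have := PW _ lt; rewrite size_monicM_pred // exprD => {}PW.
have -> : 1 = (mu ^+ (size p).-1 / wt p i * (mu ^+ (size q).-1 / wt q k)) *
    (u * (wt (p * q) (i + k) / (mu ^+ (size p).-1 * mu ^+ (size q).-1))).
  rewrite [u * (_ / _)]mulrA -uE; field.
  by rewrite !mu' wp wq.
by apply: vmaxM => //; [apply: (subringM sW)|apply: vmaxM].
Qed.

End GaussLemma.
End ValuationRings.

(** * Extension of valuations *)

Section ValuationRingExistence.
Variable E : fieldType.

Definition ideal_span (W J : set E) : set E :=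
  [set x | exists k (a b : 'I_k -> E),
     (forall i, W (a i) /\ J (b i)) /\ x = \sum_i a i * b i].

Section IdealSpan.
Variables (W J : set E) (sW : subring W).
Implicit Types x y w : E.

Lemma ideal_span_mem w x : W w -> J x -> ideal_span W J (w * x).
Proof.
by move=> Ww Jx; exists 1%N, (fun=> w), (fun=> x); split=> //; rewrite big_ord1.
Qed.

Lemma ideal_span0 : ideal_span W J 0.
Proof. by exists 0%N, (fun=> 0), (fun=> 0); split=> [[]|] //; rewrite big_ord0. Qed.

Lemma ideal_spanD x y : ideal_span W J x -> ideal_span W J y -> ideal_span W J (x + y).
Proof.
move=> [k [a [b [ab ->]]]] [l [c [d [cd ->]]]].
exists (k + l)%N, (fun i => match fintype.split i with inl i => a i | inr i => c i end),
  (fun i => match fintype.split i with inl i => b i | inr i => d i end).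
split; first by move=> i; case: (fintype.split i).
rewrite big_split_ord /=; congr (_ + _); apply: eq_bigr => i _.
  by case: splitP => j //= [e]; [congr (a _ * b _)|have := ltn_ord i; rewrite e; lia]; apply/val_inj.
by case: splitP => j //= e; [have := ltn_ord j; rewrite -e; lia|move/addnI/val_inj: e => ->].
Qed.

Lemma ideal_spanM w x : W w -> ideal_span W J x -> ideal_span W J (w * x).
Proof.
move=> Ww [k [a [b [ab ->]]]]; exists k, (fun i => w * a i), b; split.
  by move=> i; have [? ?] := ab i; split=> //; apply: (subringM sW).
by rewrite mulr_sumr; apply: eq_bigr => i _; rewrite mulrA.
Qed.

Lemma ideal_span_sum (I : Type) (r : seq I) (P : pred I) (G : I -> E) :
  (forall i, P i -> ideal_span W J (G i)) ->
  ideal_span W J (\sum_(i <- r | P i) G i).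
Proof.
move=> GW; apply: (big_ind (ideal_span W J)) => //; first exact: ideal_span0.
by move=> x y; apply: ideal_spanD.
Qed.

Lemma ideal_spanN x : ideal_span W J x -> ideal_span W J (- x).
Proof.
by move=> hx; rewrite -mulN1r; apply: ideal_spanM => //; apply: subringN => //; apply: subring1.
Qed.

Lemma ideal_span_sub x : J `<=` W -> ideal_span W J x -> W x.
Proof.
move=> JW [k [a [b [ab ->]]]]; apply: (subring_sum sW) => i _.
by have [? ?] := ab i; apply: (subringM sW) => //; apply: JW.
Qed.

End IdealSpan.

Definition adjoin (W : set E) (z : E) : set E :=
  [set x | exists2 p : {poly E}, (forall i, W p`_i) & x = p.[z]].

Section Adjoin.
Variables (W J : set E) (z : E) (sW : subring W).

Lemma adjoin_sub : W `<=` adjoin W z.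
Proof.
move=> x Wx; exists x%:P; last by rewrite hornerC.
by move=> i; rewrite coefC; case: ifP => // _; exact: subring0.
Qed.

Lemma adjoin_gen : adjoin W z z.
Proof.
exists 'X; last by rewrite hornerX.
by move=> i; rewrite coefX; case: eqP => _; [exact: subring1|exact: subring0].
Qed.

Lemma adjoin_subring : subring (adjoin W z).
Proof.
split; first by apply: adjoin_sub; exact: subring1.
- move=> _ _ [p pW ->] [q qW ->]; exists (p - q); last by rewrite hornerD hornerN.
  by move=> i; rewrite coefB; apply: (subringB sW).
- move=> _ _ [p pW ->] [q qW ->]; exists (p * q); last by rewrite hornerM.
  move=> i; rewrite coefM; apply: (subring_sum sW) => k _.
  exact: (subringM sW).
Qed.

Lemma adjoin_span x : ideal_span (adjoin W z) J x ->
  exists2 p : {poly E}, (forall i, ideal_span W J p`_i) & x = p.[z].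
Proof.
move=> [k [a [b [ab ->]]]].
have /choice[p pP] : forall i, exists p : {poly E}, (forall j, W p`_j) /\ a i = p.[z].
  by move=> i; have [[p pW pE] _] := ab i; exists p.
exists (\sum_i b i *: p i).
  move=> j; rewrite coef_sum; apply: ideal_span_sum => i _; rewrite coefZ mulrC.
  by apply: ideal_span_mem; [exact: (pP i).1|exact: (ab i).2].
rewrite horner_sum; apply: eq_bigr => i _.
by rewrite hornerZ (pP i).2 mulrC.
Qed.

End Adjoin.

Definition proper_over (R0 J W : set E) : Prop :=
  [/\ subring W, R0 `<=` W & ~ ideal_span W J 1].

Lemma proper_over_maximal (R0 J : set E) : proper_over R0 J R0 ->
  exists W, proper_over R0 J W /\ forall W', proper_over R0 J W' -> W `<=` W' -> W' `<=` W.
Proof.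
(* The alternative [set0] accounts for the union of an empty chain in Zorn's lemma. *)
move=> R0P; pose P (W : set E) := W = set0 \/ proper_over R0 J W.
have [S SP Stot|W [WP Wmax]] := @Zorn_bigcup _ P.
  have [S0|/existsNP[W0 /not_implyP[SW0 W00]]] := pselect (forall X, S X -> X = set0).
    by left; rewrite -subset0 => x [X /S0 ->].
  have good X : S X -> X !=set0 -> proper_over R0 J X.
    by move=> /SP[-> [x []]|].
  have W0P : proper_over R0 J W0 by case: (SP _ SW0) => // e; case: W00.
  have two x y : (\bigcup_(X in S) X) x -> (\bigcup_(X in S) X) y ->
      exists X, [/\ S X, proper_over R0 J X, X x & X y].
    move=> [X SX Xx] [Y SY Yy]; have [XY|YX] := Stot _ _ SX SY.
      by exists Y; split=> //; [apply: good => //; exists y|apply: XY].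
    by exists X; split=> //; [apply: good => //; exists x|apply: YX].
  right; split.
  - split.
    + by exists W0 => //; case: W0P => s _ _; exact: subring1 s.
    + move=> x y Ux Uy; have [X [SX [sX _ _] Xx Xy]] := two x y Ux Uy.
      by exists X => //; apply: (subringB sX).
    + move=> x y Ux Uy; have [X [SX [sX _ _] Xx Xy]] := two x y Ux Uy.
      by exists X => //; apply: (subringM sX).
  - by move=> x R0x; exists W0 => //; case: W0P => _ + _; apply.
  - move=> [k [a [b [ab e]]]].
    (* The finitely many coefficients of a relation lie in a single member of the chain. *)
    have [X [SX XP aX]] : exists X, [/\ S X, proper_over R0 J X & forall i, X (a i)].
      elim: k a b ab {e} => [|k IH] a b ab.
        by exists W0; split => // -[].
      have [X [SX XP aX]] := IH (a \o lift ord0) (b \o lift ord0) (fun i => ab (lift ord0 i)).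
      have [Y SY Ya] : (\bigcup_(X in S) X) (a ord0) by case: (ab ord0).
      have YP : proper_over R0 J Y by apply: good => //; exists (a ord0).
      have [XY|YX] := Stot _ _ SX SY; [exists Y|exists X]; split=> // i;
        have [j ->|->] := unliftP ord0 i => //; [exact/XY/aX|exact: aX|exact: YX].
    have [_ _] := XP; apply; exists k, a, b; split=> // i.
    by split; [exact: aX|exact: (ab i).2].
have {}WP : proper_over R0 J W.
  case: WP => // W0; case: (Wmax R0); last by right.
  rewrite W0; split=> // R00; apply: (R00 1).
  by case: R0P => s _ _; exact: subring1 s.
exists W; split=> // W' W'P WW'; apply: contrapT => nW.
by apply: (Wmax W'); [split|right].
Qed.

(** Chevalley's theorem: W is maximal among the rings over R0 in which J generates a proper ideal I.
    If neither y nor y^-1 were in W, then 1 would be a polynomial in y, and another in y^-1, with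
    coefficients in I; of two such polynomials of minimal degree, the longer could be shortened by
    the other. *)
Lemma dominating_vring (R0 J : set E) : subring R0 -> J `<=` R0 ->
  ~ ideal_span R0 J 1 ->
  exists W, [/\ vring W, R0 `<=` W & J `<=` vmax W].
Proof.
move=> sR0 JR0 nJ; have [|W [[sW R0W nW] Wmax]] := @proper_over_maximal R0 J.
  by split.
pose I := ideal_span W J.
have JW : J `<=` W by move=> x /JR0/R0W.
have IW x : I x -> W x by apply: ideal_span_sub.
have ID x y : I x -> I y -> I (x + y) by apply: ideal_spanD.
have IB x y : I x -> I y -> I (x - y).
  by move=> Ix Iy; apply: ID => //; apply: ideal_spanN.
have adj z : ~ W z -> exists2 p : {poly E}, (forall i, I p`_i) & 1 = p.[z].
  move=> nz; apply: adjoin_span; apply: contrapT => h; apply: nz.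
  apply: (Wmax (adjoin W z)); last exact: adjoin_gen.
    split=> //; first exact: adjoin_subring.
    by move=> x /R0W; apply: adjoin_sub.
  exact: adjoin_sub.
(* I lies in the Jacobson radical of W: otherwise adjoining (1 - c)^-1 would put a power of 1 - c in
   I, although 1 - c is 1 modulo I. *)
have unit c : I c -> 1 - c != 0 /\ W (1 - c)^-1.
  move=> Ic; have c1 : 1 - c != 0.
    by apply/eqP => e; apply: nW; rewrite -(subrK c 1) e add0r.
  split=> //; apply: contrapT => /adj[p pI e]; apply: nW.
  have W1c : W (1 - c) by apply: (subringB sW); [exact: subring1|exact: IW].
  have Ik k : I ((1 - c) ^+ k) -> I 1.
    elim: k => [|k IH]; first by rewrite expr0.
    rewrite exprS mulrBl mul1r => h; apply: IH; rewrite -(subrK (c * (1 - c) ^+ k) (_ ^+ k)).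
    apply: ID => //; rewrite mulrC; apply: ideal_spanM => //; exact: subringX.
  apply: (Ik (size p)).
  have -> : (1 - c) ^+ size p = \sum_(i < size p) p`_i * (1 - c) ^+ (size p - i).
    rewrite -[LHS]mulr1 [X in _ * X]e horner_coef mulr_sumr; apply: eq_bigr => i _.
    rewrite mulrCA; congr (_ * _); rewrite -{1}(subnK (ltnW (ltn_ord i))) exprD exprVn.
    by rewrite mulfK // expf_neq0.
  apply: ideal_span_sum => // i _; rewrite mulrC.
  by apply: (ideal_spanM sW); [exact: subringX|exact: pI].
have Wvr : vring W.
  split=> // y y0; apply: contrapT => /not_orP[ny nyV].
  have minpoly (z : E) : ~ W z -> exists p : {poly E}, [/\ forall i, I p`_i, p.[z] = 1 &
      forall q : {poly E}, (forall i, I q`_i) -> q.[z] = 1 -> (size p <= size q)%N].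
    move=> /adj[p0 p0I p0E].
    pose Q k := `[< exists r : {poly E}, [/\ forall i, I r`_i, r.[z] = 1 & size r = k] >].
    have exQ : exists k, Q k by exists (size p0); apply/asboolP; exists p0.
    case: (ex_minnP exQ) => k /asboolP[r [rI rz rk]] kmin.
    by exists r; split=> // q qI qz; rewrite rk; apply: kmin; apply/asboolP; exists q.
  have key : forall (z : E) (p q : {poly E}), z != 0 -> (forall i, I p`_i) -> p.[z] = 1 ->
      (forall r : {poly E}, (forall i, I r`_i) -> r.[z] = 1 -> (size p <= size r)%N) ->
      (forall i, I q`_i) -> q.[z^-1] = 1 -> (size q <= size p)%N -> False.
    move=> z p q z0 pI pz pmin qI qz qp.
    have [n qn] : exists n, size q = n.+2.
      have : (1 < size q)%N; last by case: (size q) => [|[|n]] // _; exists n.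
      rewrite ltnNge; apply/negP => /size1_polyC qC; apply: nW.
      by rewrite -qz qC hornerC; apply: qI.
    have [m pm] : exists m, size p = m.+1 by case: (size p) qp => [|m]; rewrite qn // => _; exists m.
    have nm : (n < m)%N by rewrite qn pm ltnS in qp.
    have [e0 We] := unit _ (qI 0%N); set e := (1 - q`_0)^-1 in We.
    have qE : 1 = \sum_(j < n.+1) e * q`_j.+1 * z^-1 ^+ j.+1.
      move: qz; rewrite horner_coef qn big_ord_recl expr0 mulr1 => qz.
      apply: (mulfI e0); rewrite mulr1 -[X in X - _ = _]qz addrAC subrr add0r mulr_sumr.
      by apply: eq_bigr => j _; rewrite !mulrA mulfV // mul1r.
    (* The top term p_m z^m is rewritten by the relation [qE] for 1. As n < m, only powers z^i with
       0 <= i < m arise, against the minimality of p. *)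
    pose r : {poly E} := \poly_(i < m) p`_i +
       \sum_(j < n.+1) (p`_m * (e * q`_j.+1)) *: 'X^(m - j.+1).
    have : (size p <= size r)%N.
      apply: pmin.
        move=> i; rewrite coefD coef_poly coef_sum; apply: ID.
          by case: ifP => // _; exact: ideal_span0.
        apply: ideal_span_sum => // j _; rewrite coefZ coefXn.
        case: eqP => _; last by rewrite mulr0; exact: ideal_span0.
        rewrite mulr1 mulrC; apply: (ideal_spanM sW); last exact: pI.
        by apply: (subringM sW) => //; apply: IW.
      rewrite hornerD horner_poly horner_sum -[RHS]pz [in RHS]horner_coef pm [in RHS]big_ord_recr /=.
      congr (_ + _); rewrite -[RHS]mulr1 qE mulr_sumr; apply: eq_bigr => j _.
      rewrite hornerZ hornerXn.
      have jm : (j.+1 <= m)%N by apply: leq_trans nm.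
      have -> : z ^+ m = z ^+ (m - j.+1) * z ^+ j.+1 by rewrite -exprD subnK.
      by rewrite exprVn; field; rewrite expf_neq0.
    have sr : (size r <= m)%N.
      apply: (leq_trans (size_polyD _ _)); rewrite geq_max size_poly /=.
      apply: (leq_trans (size_sum _ _ _)); apply/bigmax_leqP => j _.
      apply: (leq_trans (size_scale_leq _ _)); rewrite size_polyXn.
      by have := leq_trans (ltn_ord j) nm; lia.
    by rewrite pm => /leq_trans/(_ sr); rewrite ltnn.
  have [p [pI pz pmin]] := minpoly y ny; have [q [qI qz qmin]] := minpoly _ nyV.
  have [qp|/ltnW pq] := leqP (size q) (size p).
    exact: (key y p q).
  by apply: (key y^-1 q p); rewrite ?invr_eq0 ?invrK.
exists W; split=> // x Jx.
apply: contrapT => nm; apply: nW.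
have [x0 WxV] := vring_unit (JW _ Jx) nm.
by rewrite -(mulVf x0); apply: ideal_span_mem.
Qed.

End ValuationRingExistence.

Section Extension.
Variables (F E : fieldType) (j : {rmorphism F -> E}).

Definition dominates (O : set F) (W : set E) : Prop :=
  [/\ vring W, forall c, O c -> W (j c) & forall c, vmax O c -> vmax W (j c)].

Lemma dominates_ring O W c : dominates O W -> vring O -> W (j c) -> O c.
Proof.
move=> [vW OW mW] vO Wc; have [->|c0] := eqVneq c 0; first exact: subring0 (vring_subring vO).
have [//|/mW] := vmax_or O c0; rewrite fmorphV => h; exfalso.
by apply: (vmax_inv _ h); rewrite ?invr_eq0 ?fmorph_eq0 ?invrK.
Qed.

(* The ideal generated by the maximal ideal of O (and by z if b) in O[z] is either
   the unit ideal, which yields an equation for z, or contained in the maximal ideal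
   of a valuation ring. *)
Lemma dominating_or_equation (O : set F) (z : E) (b : bool) : vring O ->
  (exists W, [/\ dominates O W, W z & b -> vmax W z]) \/
  (exists p : {poly F}, [/\ forall i, O p`_i, vmax O p`_0,
     ~~ b -> forall i, vmax O p`_i & (map_poly j p).[z] = 1]).
Proof.
move=> vO; have sO := vring_subring vO.
pose R0 : set E := [set x | exists2 p : {poly F}, (forall i, O p`_i) & x = (map_poly j p).[z]].
pose J : set E := [set x | (exists2 c, vmax O c & x = j c) \/ (b /\ x = z)].
have OR0 c : O c -> R0 (j c).
  move=> Oc; exists c%:P; last by rewrite map_polyC hornerC.
  by move=> i; rewrite coefC; case: ifP => // _; exact: subring0.
have R0z : R0 z.
  exists 'X; last by rewrite map_polyX hornerX.
  by move=> i; rewrite coefX; case: eqP => _; [exact: subring1|exact: subring0].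
have sR0 : subring R0.
  split; first by rewrite -(rmorph1 j); apply: OR0; exact: subring1.
  - move=> _ _ [p pO ->] [q qO ->]; exists (p - q); last by rewrite rmorphB hornerD hornerN.
    by move=> i; rewrite coefB; apply: (subringB sO).
  - move=> _ _ [p pO ->] [q qO ->]; exists (p * q); last by rewrite rmorphM hornerM.
    move=> i; rewrite coefM; apply: (subring_sum sO) => k _.
    exact: (subringM sO).
have JR0 : J `<=` R0.
  by move=> x [[c mc ->]|[_ ->]] //; apply: OR0; apply: vmax_sub.
have [sp|nsp] := pselect (ideal_span R0 J 1); last first.
  have [W [vW R0W JW]] := dominating_vring sR0 JR0 nsp.
  left; exists W; split; [split=> // c| |].
  - by move=> /OR0/R0W.
  - by move=> mc; apply: JW; left; exists c.
  - exact: R0W.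
  - by move=> hb; apply: JW; right.
right; case: sp => k [u [w [uw e]]].
have /choice[p pP] : forall i, exists p : {poly F}, [/\ forall i, O p`_i, vmax O p`_0,
    ~~ b -> forall i, vmax O p`_i & u i * w i = (map_poly j p).[z]].
  move=> i; have [[p pO ->] [[c mc ->]|[hb ->]]] := uw i.
    exists (c *: p); split.
    + by move=> l; rewrite coefZ; apply: (subringM sO) => //; apply: vmax_sub.
    + by rewrite coefZ mulrC; apply: vmaxM.
    + by move=> _ l; rewrite coefZ mulrC; apply: vmaxM.
    + by rewrite map_polyZ hornerZ mulrC.
  exists (p * 'X); split.
  + by move=> l; rewrite coefMX; case: ifP => // _; exact: subring0.
  + by rewrite coefMX; left.
  + by rewrite hb.
  + by rewrite rmorphM /= map_polyX hornerMX.
exists (\sum_i p i); split.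
- move=> l; rewrite coef_sum; apply: (subring_sum sO) => i _.
  by have [] := pP i.
- by rewrite coef_sum; apply: vmax_sum => // i _; have [] := pP i.
- move=> hb l; rewrite coef_sum; apply: vmax_sum => // i _.
  by have [_ _ + _] := pP i; apply.
- rewrite raddf_sum /= horner_sum e; apply: eq_bigr => i _.
  by have [_ _ _ ->] := pP i.
Qed.

(** Multiply 1 = sum of the p_i y^-i by y^n and divide by 1 - p_0, a unit because p_0 is in the
    maximal ideal. *)
Lemma reciprocal_equation (O : set F) (p : {poly F}) (y : E) : vring O ->
  y != 0 -> (forall i, O p`_i) -> vmax O p`_0 -> (map_poly j p).[y^-1] = 1 ->
  exists q : {poly F}, [/\ q \is monic, root (map_poly j q) y, forall i, O q`_i
    & (forall i, vmax O p`_i) -> forall i, (i < (size q).-1)%N -> vmax O q`_i].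
Proof.
move=> vO y0 pO p0 pe; have sO := vring_subring vO.
have [e0 eO] := vring_one_plus vO (vmaxN vO p0).
set e := (1 - p`_0)^-1 in eO.
have [n pn] : exists n, size p = n.+1.
  case E' : (size p) => [|n]; last by exists n.
  move/eqP: E'; rewrite size_poly_eq0 => /eqP p00; move: pe.
  by rewrite p00 rmorph0 horner0 => /esym/eqP; rewrite oner_eq0.
pose r : {poly F} := \sum_(i < n) (e * p`_i.+1) *: 'X^(n - i.+1).
have sr : (size r <= n)%N.
  apply: (leq_trans (size_sum _ _ _)); apply/bigmax_leqP => i _.
  apply: (leq_trans (size_scale_leq _ _)); rewrite size_polyXn.
  by have := ltn_ord i; lia.
pose q := 'X^n - r.
have sq : size q = n.+1 by rewrite size_polyDl size_polyXn // size_polyN ltnS.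
have qm : q \is monic.
  rewrite monicE /lead_coef sq /= coefB coefXn eqxx.
  by move/leq_sizeP: sr => /(_ _ (leqnn n)) ->; rewrite subr0.
exists q; split=> //.
- rewrite /root rmorphB hornerD hornerN /= map_polyXn hornerXn subr_eq0; apply/eqP.
  rewrite raddf_sum /= horner_sum.
  have -> : \sum_(i < n) (map_poly j ((e * p`_i.+1) *: 'X^(n - i.+1))).[y] =
      y ^+ n * (j e * \sum_(i < n) j p`_i.+1 * y^-1 ^+ i.+1).
    rewrite !mulr_sumr; apply: eq_bigr => i _.
    rewrite map_polyZ map_polyXn hornerZ hornerXn rmorphM.
    have -> : y ^+ n = y ^+ (n - i.+1) * y ^+ i.+1 by rewrite -exprD subnK.
    by rewrite exprVn; field; rewrite expf_neq0.
  move: pe; rewrite horner_coef size_map_poly pn big_ord_recl coef_map expr0 mulr1.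
  under eq_bigr => i _ do rewrite coef_map.
  move=> /(canRL (addKr _)) ->.
  rewrite addrC -(rmorph1 j) -rmorphB -rmorphM mulVf // rmorph1 mulr1 //.
- move=> i; rewrite coefB coefXn; apply: (subringB sO).
    by case: eqP => _; [exact: subring1|exact: subring0].
  rewrite coef_sum; apply: (subring_sum sO) => l _; rewrite coefZ coefXn.
  apply: (subringM sO); first exact: (subringM sO).
  by case: eqP => _; [exact: subring1|exact: subring0].
- move=> pm i; rewrite sq /= => ni; rewrite coefB coefXn ltn_eqF // sub0r.
  apply: vmaxN => //; rewrite coef_sum; apply: vmax_sum => // l _.
  rewrite coefZ coefXn mulrC; apply: vmaxM => //; last exact: vmaxM.
  by case: eqP => _; [exact: subring1|exact: subring0].
Qed.

(** The dichotomy is applied to z = x^-1, with z put into the ideal: in its second case the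
    reciprocal equation makes x integral over O. *)
Lemma not_integral_dominates (O : set F) (x : E) : vring O ->
  ~ (exists q : {poly F}, [/\ q \is monic, root (map_poly j q) x & forall i, O q`_i]) ->
  exists W, dominates O W /\ x != 0 /\ vmax W x^-1.
Proof.
move=> vO nx; have x0 : x != 0.
  apply/eqP => x0; apply: nx; exists 'X; split; first exact: monicX.
    by rewrite map_polyX x0 rootX.
  move=> i; rewrite coefX.
  by case: eqP => _; [exact: subring1 (vring_subring vO)|exact: subring0 (vring_subring vO)].
have [[W [dW _ mW]]|[p [pO p0 _ pe]]] := dominating_or_equation x^-1 true vO.
  by exists W; split=> //; split=> //; exact: mW.
case: nx; have [q [qm qx qO _]] := reciprocal_equation vO x0 pO p0 pe.
by exists q.
Qed.

(** Here z = y^-1 is not put into the ideal. A dominating ring containing y^-1 contradicts the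
    hypothesis, and in the other case all nonleading coefficients lie in the maximal ideal. *)
Lemma vmax_all_equation (O : set F) (y : E) : vring O ->
  (forall W, dominates O W -> vmax W y) ->
  exists q : {poly F}, [/\ q \is monic, root (map_poly j q) y &
    forall i, (i < (size q).-1)%N -> vmax O q`_i].
Proof.
move=> vO my; have [->|y0] := eqVneq y 0.
  exists 'X; split; [exact: monicX|by rewrite map_polyX rootX|].
  by move=> i; rewrite size_polyX /= => i1; rewrite coefX ltn_eqF //; left.
have [[W [dW Wy _]]|[p [pO p0 pm pe]]] := dominating_or_equation y^-1 false vO.
  by have [vW _ _] := dW; case: (vmax_inv y0 (my W dW)).
have [q [qm qx qO qv]] := reciprocal_equation vO y0 pO p0 pe.
by exists q; split=> //; apply: qv; apply: pm.
Qed.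

(** The degree of E over F is at most m, expressed by linear dependence. *)
Definition finite_over (m : nat) : Prop := forall y : 'I_m.+1 -> E,
  exists c : 'I_m.+1 -> F, (exists i, c i != 0) /\ \sum_i j (c i) * y i = 0.

(* A valuation ring W dominating that of lam has a value group in which that of lam
   has finite index: by a linear relation between powers, y^k is a unit of W times an
   element of F for some k <= m.  So lam extends to W after scaling by m!. *)
Lemma rval_extension (m : nat) (lam : F -> int) (x : E) : finite_over m -> rval lam ->
  ~ (exists q : {poly F}, [/\ q \is monic, root (map_poly j q) x &
       forall i, rval_ring lam q`_i]) ->
  exists lam' : E -> int, [/\ rval lam', x != 0 & lam' x < 0].
Proof.
move=> fin lamP nx; have vO := vring_rval lamP.
have [W [dW [x0 mx]]] := not_integral_dominates vO nx.
have [vW OW mW] := dW; have sW := vring_subring vW.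
pose U (u : E) := W u /\ W u^-1.
have j0 c : c != 0 -> j c != 0 by rewrite fmorph_eq0.
have UX u k : U u -> U (u ^+ k) by move=> [? ?]; split; rewrite -?exprVn; exact: subringX.
have UV u : U u -> U u^-1 by move=> [? ?]; split; rewrite ?invrK.
have UM u v : U u -> U v -> U (u * v).
  by move=> [? ?] [? ?]; split; rewrite ?invfM; apply: (subringM sW).
have pow (y : E) : y != 0 -> exists c k, [/\ c != 0, (0 < k <= m)%N & U (y ^+ k / j c)].
  move=> y0; have [c [[i0 ci0] ce]] := fin (fun i => y ^+ i).
  have ti0 : j (c i0) * y ^+ i0 != 0 by rewrite mulf_neq0 ?expf_neq0 ?j0.
  have [i [l [il ti tl Wil nm]]] := vring_sum0 vW ce ti0.
  have {nm} Uil : U (j (c l) * y ^+ l / (j (c i) * y ^+ i)).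
    by split=> //; case: (vring_unit Wil nm).
  have ci : c i != 0 by apply: contraNneq ti => ->; rewrite rmorph0 mul0r.
  have cl : c l != 0 by apply: contraNneq tl => ->; rewrite rmorph0 mul0r.
  have {}Uil : U (j (c l) * y ^+ l / (j (c i) * y ^+ i)) := Uil.
  clear Wil ti tl; wlog lt : i l il Uil ci cl / (i < l)%N.
    move=> wl; have [lt|lt|/val_inj e] := ltngtP i l; first exact: (wl i l).
      have {}il : l != i by rewrite eq_sym.
      apply: (wl l i il _ cl ci lt).
      have -> : j (c i) * y ^+ i / (j (c l) * y ^+ l) =
                (j (c l) * y ^+ l / (j (c i) * y ^+ i))^-1 by rewrite invf_div.
      exact: UV.
    by rewrite e eqxx in il.
  exists (c i / c l), (l - i)%N; rewrite mulf_neq0 ?invr_eq0 // subn_gt0 lt.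
  rewrite (leq_trans (leq_subr _ _)) -1?ltnS ?ltn_ord //; split=> //.
  congr U: Uil; rewrite -[in LHS](subnK (ltnW lt)) exprD fmorph_div.
  by field; rewrite expf_neq0 // !j0.
pose M := m`!.
have pow' (y : E) : exists c, y != 0 -> c != 0 /\ U (y ^+ M / j c).
  have [->|y0] := eqVneq y 0; first by exists 0.
  have [c [k [c0 /andP[k0 km] Uk]]] := pow y y0.
  have kM : (k %| M)%N by apply: dvdn_fact; rewrite k0.
  exists (c ^+ (M %/ k)) => _; split; first exact: expf_neq0.
  by rewrite rmorphXn -{1}(divnK kM) mulnC exprM -expr_div_n; apply: UX.
have {pow'} [C CP] := choice pow'.
have M0 : (0 < M)%N by exact: fact_gt0.
have Wlam c : c != 0 -> W (j c) -> 0 <= lam c.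
  by move=> c0 /(dominates_ring dW vO); apply.
have Ulam c d : c != 0 -> d != 0 -> U (j c / j d) -> lam c = lam d.
  move=> c0 d0; rewrite -fmorph_div => -[/Wlam h1]; rewrite -fmorphV => /Wlam h2.
  have := h1 _; have := h2 _; rewrite !invr_eq0 mulf_neq0 ?invr_eq0 //.
  move=> /(_ isT) + /(_ isT).
  rewrite rvalV ?mulf_neq0 ?invr_eq0 // rvalM ?invr_eq0 // rvalV // => h3 h4.
  by apply/eqP; rewrite eq_le; lra.
(* Up to a unit of W, C y is y^M, so this is M times the extension of lam. *)
exists (fun y => lam (C y)); split=> //; last first.
  have [c0 Uc] := CP x x0; rewrite ltNge; apply/negP => lc.
  have mxM : vmax W (x ^- M) by rewrite -exprVn; apply: vmaxX.
  case: (vmax1 vW); rewrite -(mulfV (expf_neq0 M x0)); apply: vmaxM => //.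
  rewrite -(divfK (j0 _ c0) (x ^+ M)); apply: (subringM sW); first by case: Uc.
  by apply: OW => _.
split=> y z y0 z0.
  have [c0 Uc] := CP y y0; have [d0 Ud] := CP z z0.
  have yz0 : y * z != 0 by rewrite mulf_neq0.
  have [e0 Ue] := CP _ yz0.
  rewrite -rvalM //; apply: Ulam => //; first by rewrite mulf_neq0.
  have -> : j (C (y * z)) / j (C y * C z) =
      ((y * z) ^+ M / j (C (y * z)))^-1 * (y ^+ M / j (C y) * (z ^+ M / j (C z))).
    by rewrite rmorphM exprMn; field; rewrite !j0 // !expf_neq0.
  by apply: (UM); [exact: UV|exact: UM].
move=> yz0.
have half (u v : E) : u != 0 -> u + v != 0 -> W (v / u) -> lam (C u) <= lam (C (u + v)).
  move=> u0 uv0 Wvu; have [c0 Uc] := CP u u0; have [d0 Ud] := CP _ uv0.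
  rewrite -subr_ge0 -rvalV // -rvalM ?invr_eq0 //; apply: Wlam.
    by rewrite mulf_neq0 ?invr_eq0.
  have -> : j (C (u + v) / C u) =
     ((u + v) ^+ M / j (C (u + v)))^-1 * (u ^+ M / j (C u)) * (1 + v / u) ^+ M.
    have -> : 1 + v / u = (u + v) / u by rewrite mulrDl divff.
    by rewrite fmorph_div expr_div_n; field; rewrite !j0 // !expf_neq0.
  apply: (subringM sW); last first.
    by apply: (subringX sW); apply: (subringD sW) => //; exact: subring1.
  by apply: (subringM sW); [case: (UV _ Ud)|case: Uc].
have zy0 : z / y != 0 by rewrite mulf_neq0 ?invr_eq0.
have [h|h] := vring_total vW zy0.
  by rewrite ge_min half.
by rewrite ge_min addrC half ?orbT // 1?addrC // -invf_div.
Qed.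

End Extension.

(** * Separation by discrete valuations and Noether normalization *)

Section PrimeElements.
Variables (T : idomainType) (p : T).
Hypothesis p_nonunit : ~ exists u, u * p = 1.
Hypothesis p_prime : forall x y z, x * y = z * p ->
  (exists q, x = q * p) \/ (exists q, y = q * p).
Hypothesis p_sep : forall x, x != 0 ->
  exists N, forall k q, x = q * p ^+ k -> (k <= N)%N.

(** The p-adic valuation of a prime element; [p_sep] bounds multiplicities, as a Noetherian
    hypothesis would. *)
Lemma padic_rval : p != 0 -> exists lam : T -> int,
  [/\ rval lam, forall x, x != 0 -> 0 <= lam x,
      forall x, x != 0 -> ~ (exists q, x = q * p) -> lam x = 0 & lam p = 1].
Proof.
move=> p0; pose prim (x : T) := ~ exists q, x = q * p.
have ex (x : T) : x != 0 -> exists k q, prim q /\ x = q * p ^+ k.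
  move=> x0; have [N xN] := p_sep x0.
  have exP : exists k, `[< exists q, x = q * p ^+ k >].
    by exists 0%N; apply/asboolP; exists x; rewrite expr0 mulr1.
  have ubP k : `[< exists q, x = q * p ^+ k >] -> (k <= N)%N.
    by move=> /asboolP[q]; apply: xN.
  case: (ex_maxnP exP ubP) => k /asboolP[q qE] kmax.
  exists k, q; split=> // -[r rE].
  have /kmax : `[< exists q, x = q * p ^+ k.+1 >].
    by apply/asboolP; exists r; rewrite exprS mulrA -rE.
  by rewrite ltnn.
have /choice[v vP] : forall x, exists k : nat, x != 0 -> exists q, prim q /\ x = q * p ^+ k.
  move=> x; have [->|x0] := eqVneq x 0; first by exists 0%N.
  by have [k [q H]] := ex x x0; exists k => _; exists q.
have uniq k l q r : prim q -> prim r -> q * p ^+ k = r * p ^+ l -> (k <= l)%N.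
  move=> pq pr e; rewrite leqNgt; apply/negP => lk; case: pr.
  exists (q * p ^+ (k - l).-1).
  apply: (mulIf (expf_neq0 l p0)); rewrite -e -!mulrA -exprS -exprD.
  by congr (_ * _ ^+ _); lia.
have vE x k q : x != 0 -> prim q -> x = q * p ^+ k -> v x = k.
  move=> x0 pq xE; have [r [pr xE']] := vP x x0.
  by apply/eqP; rewrite eqn_leq (uniq _ _ r q) ?(uniq _ _ q r) // -xE.
exists (fun x => (v x)%:Z); split.
- split=> x y x0 y0.
    have [q [pq xE]] := vP x x0; have [r [pr yE]] := vP y y0.
    rewrite (vE (x * y) (v x + v y)%N (q * r)) ?mulf_neq0 //.
      by move=> [s] /p_prime[].
    by rewrite {1}xE {1}yE exprD; ring.
  move=> xy0; have [q [pq xE]] := vP x x0; have [r [pr yE]] := vP y y0.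
  pose m := minn (v x) (v y).
  have sE : x + y = (q * p ^+ (v x - m) + r * p ^+ (v y - m)) * p ^+ m.
    by rewrite mulrDl -!mulrA -!exprD !subnK ?geq_minl ?geq_minr // -xE -yE.
  set s := q * _ + _ in sE; have s0 : s != 0.
    by apply: contraNneq xy0 => s0; rewrite sE s0 mul0r.
  have [u [pu uE]] := vP s s0.
  have -> : v (x + y) = (v s + m)%N.
    by apply: (vE _ _ u) => //; rewrite [LHS]sE {1}uE exprD mulrA.
  by rewrite ge_min !lez_nat /m; apply/orP; lia.
- by [].
- by move=> x x0 px; rewrite (vE x 0%N x) // expr0 mulr1.
- rewrite (vE p 1%N 1) ?mul1r ?expr1 // => -[q qE].
  by apply: p_nonunit; exists q.
Qed.

End PrimeElements.

Section PolynomialFactors.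

Lemma irreducible_factor (F : fieldType) (P : {poly F}) :
  P \is monic -> (1 < size P)%N ->
  exists p q, [/\ p \is monic, q \is monic, P = p * q & irreducible_poly p].
Proof.
move=> Pm sP.
pose Q k := `[< exists p q : {poly F}, [/\ p \is monic, P = p * q, (1 < size p)%N & size p = k] >].
have exQ : exists k, Q k.
  by exists (size P); apply/asboolP; exists P, 1; rewrite mulr1.
case: (ex_minnP exQ) => k /asboolP[p [q [pm PE sp pk]]] kmin.
have qm : q \is monic by rewrite -(monicMl _ pm) -PE.
exists p, q; split=> //; split=> // r sr rp.
have [h pE] := dvdpP _ _ rp.
have r0 : r != 0.
  by apply: contraNneq (monic_neq0 pm) => r0; rewrite pE r0 mulr0.
have lr0 : lead_coef r != 0 by rewrite lead_coef_eq0.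
have sr1 : (1 < size r)%N by rewrite ltn_neqAle eq_sym sr size_poly_gt0.
have /kmin : Q (size r).
  apply/asboolP; exists ((lead_coef r)^-1 *: r), (lead_coef r *: (h * q)).
  rewrite size_scale ?invr_eq0 //; split=> //.
    by rewrite monicE lead_coefZ mulVf.
  rewrite -scalerAl -scalerAr scalerA mulVf // scale1r PE pE; ring.
rewrite -pk => pr; rewrite -dvdp_size_eqp // eqn_leq pr andbT.
by apply: dvdp_leq => //; exact: monic_neq0.
Qed.

Lemma irreducible_prime (F : fieldType) (p a b : {poly F}) :
  irreducible_poly p -> p %| a * b -> (p %| a) || (p %| b).
Proof.
move=> [sp ip]; have [//|npa /=] := boolP (p %| a).
rewrite Gauss_dvdpr // coprimep_def; apply: contraNT npa => sg.
have /eqp_dvdl <- : gcdp p a %= p by apply: ip => //; exact: dvdp_gcdl.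
exact: dvdp_gcdr.
Qed.

Variable D : idomainType.
Local Notation F := {fraction D}.
Local Notation mapF := (map_poly (@tofrac D)).

Lemma mapF_inj : injective mapF.
Proof.
by move=> p q e; apply/polyP => i; apply: tofrac_inj; rewrite -!coef_map e.
Qed.

Lemma mapF_monic (p : {poly D}) : (mapF p \is monic) = (p \is monic).
Proof.
by rewrite !monicE lead_coef_map_inj ?rmorph0 //; [rewrite -tofrac1 tofrac_eq|exact: tofrac_inj].
Qed.

Lemma size_mapF (p : {poly D}) : size (mapF p) = size p.
Proof. by rewrite size_map_inj_poly ?rmorph0 //; exact: tofrac_inj. Qed.

Lemma mapF_dvd (p a : {poly D}) : p \is monic -> mapF p %| mapF a ->
  exists h, a = h * p.
Proof.
move=> pm pa; exists (Pdiv.Idomain.divp a p).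
have := Pdiv.IdomainMonic.divp_eq pm a; set h := Pdiv.Idomain.divp _ _.
set m := Pdiv.Idomain.modp _ _ => aE.
have ms : (size m < size p)%N by rewrite Pdiv.Idomain.ltn_modpN0 // monic_neq0.
suff m0 : m = 0 by rewrite {1}aE m0 addr0.
apply: mapF_inj; rewrite rmorph0; apply/eqP; apply: contraTT pa => m0.
rewrite aE rmorphD rmorphM /= dvdp_addr ?dvdp_mull //.
by apply/negP => /(dvdp_leq m0); rewrite !size_mapF leqNgt ms.
Qed.

Lemma mapF_prime (p a b h : {poly D}) : p \is monic -> irreducible_poly (mapF p) ->
  a * b = h * p -> (exists q, a = q * p) \/ (exists q, b = q * p).
Proof.
move=> pm ip e; have : mapF p %| mapF a * mapF b.
  by rewrite -rmorphM e rmorphM /= dvdp_mull.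
by move=> /(irreducible_prime ip)/orP[] /(mapF_dvd pm); [left|right].
Qed.

(** In terms of fractions: D is the intersection of the rings of those integer-valued valuations of
    its fraction field that are nonnegative on D. *)
Definition separated : Prop := forall f g : D, g != 0 ->
  ~ (exists q, f = q * g) ->
  exists lam : D -> int, [/\ rval lam, forall x, x != 0 -> 0 <= lam x & lam f < lam g].

Lemma separated_coef (x : F) : separated ->
  (forall lam : F -> int, rval lam -> (forall d, d != 0 -> 0 <= lam (tofrac d)) ->
     rval_ring lam x) ->
  exists d, x = tofrac d.
Proof.
move=> sep xO; have [f [g [g0 xE]]] := fracE x.
have [[q fE]|nq] := pselect (exists q, f = q * g).
  by exists q; rewrite xE fE rmorphM mulfK // tofrac_eq0.
have [lam [lamP lam0 lt]] := sep f g g0 nq.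
have f0 : f != 0 by apply/eqP => f0; apply: nq; exists 0; rewrite f0 mul0r.
have [lam' [lamP' lamE]] := rval_fraction lamP.
have : rval_ring lam' x by apply: xO => // d d0; rewrite lamE // lam0.
rewrite /rval_ring /= xE mulf_neq0 ?invr_eq0 ?tofrac_eq0 // => /(_ isT).
by rewrite rvalM ?rvalV ?invr_eq0 ?tofrac_eq0 // !lamE // subr_ge0 leNgt lt.
Qed.

(** A separated domain is an intersection of valuation rings, and Gauss's lemma holds for each of
    them. *)
Lemma separated_monic_factor (w : {poly D}) (P Q : {poly F}) : separated ->
  w \is monic -> P \is monic -> Q \is monic -> mapF w = P * Q ->
  exists p, P = mapF p.
Proof.
move=> sep wm Pm Qm wE.
have /choice[c cP] : forall i, exists d, P`_i = tofrac d.
  move=> i; apply: separated_coef => // lam lamP lam0.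
  suff : rval_ring lam (P`_i ^+ 1 * 1 ^+ i / 1 ^+ (size P).-1).
    by rewrite !expr1n divr1 mulr1 expr1.
  apply: (gauss_lemma (vring_rval lamP) (oner_neq0 _) (ltn0Sn 0) Pm Qm) => k.
  rewrite !expr1n divr1 mulr1 expr1 -wE coef_map => k0; apply: lam0.
  by rewrite -tofrac_eq0.
exists (\poly_(i < size P) c i); apply/polyP => i; rewrite coef_map coef_poly.
by case: ltnP => h; [rewrite cP|rewrite nth_default // rmorph0].
Qed.

End PolynomialFactors.

Section Separation.
Variables (R : realType) (K : fieldType) (abs : nonarch_absval R K).
Hypothesis abs_complete : complete_for abs.

Lemma mcons_mulrn n k (a : mindex n) m : mcons k a *+ m = mcons (k * m) (a *+ m).
Proof.
elim: m => [|m IH]; first by rewrite !mulr0n muln0 mcons00.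
by rewrite !mulrS IH mconsD mulnS.
Qed.

Lemma lead_prod n (I : Type) (r : seq I) (F : I -> tate abs n) (a : I -> mindex n) :
  (forall i, lead (F i) (a i)) -> lead (\prod_(i <- r) F i) (\sum_(i <- r) a i).
Proof.
move=> Fa; elim: r => [|i r IH]; first by rewrite !big_nil; exact: lead1.
by rewrite !big_cons; have [] := leadM (Fa i) IH.
Qed.

Section Shear.
Variable n : nat.
Local Notation T := (tate abs n.+1).
Local Notation gn := (@gauss_norm R K abs n.+1).
Local Notation tX := (tX abs n).
Let gU := unorm_gauss n.+1 abs_complete.

Lemma tvar0 : tvar abs ord0 = tX.
Proof.
congr mono; apply/ffunP => i; rewrite ffunE.
by have [j ->|->] := unliftP ord0 i; rewrite ?mconsSE ?mcons0E ?ffunE.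
Qed.

Lemma tvarS (i : 'I_n) : tvar abs (lift ord0 i) = mono abs 1 (mcons 0 (mdelta i)).
Proof.
congr mono; apply/ffunP => k; rewrite ffunE.
have [j ->|->] := unliftP ord0 k; rewrite ?mconsSE ?mcons0E ?ffunE //.
Qed.

(** The universal property gives z_i -> z_i + X^(w i) and its inverse z_i -> z_i - X^(w i); the sign
    is the parameter e of the proof. *)
Lemma shear_exists (w : 'I_n -> nat) : exists s t : {rmorphism T -> T},
  [/\ cancel s t /\ cancel t s,
      (forall c, s (tateC abs n.+1 c) = tateC abs n.+1 c) /\
      (forall c, t (tateC abs n.+1 c) = tateC abs n.+1 c),
      (forall f, gn (s f) <= gn f) /\ s tX = tX
    & forall i, s (tvar abs (lift ord0 i)) = tvar abs (lift ord0 i) + tX ^+ w i].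
Proof.
have gX k : gn (tX ^+ k) = 1 by rewrite tXE // gauss_mono absval1.
have gv i : gn (tvar abs i) = 1 by rewrite gauss_mono absval1.
have univ (e : T) : gn e <= 1 -> exists s : {rmorphism T -> T},
  [/\ forall c, s (tateC abs n.+1 c) = tateC abs n.+1 c, s tX = tX,
      forall i, s (tvar abs (lift ord0 i)) = tvar abs (lift ord0 i) + e * tX ^+ w i
    & forall f, gn (s f) <= gn f].
  move=> e1; pose b (i : 'I_n.+1) : T :=
    if unlift ord0 i is Some j then tvar abs i + e * tX ^+ w j else tX.
  have b1 i : gn (b i) <= 1.
    rewrite /b; case: unliftP => [j _|_]; last by rewrite -(expr1 tX) gX.
    by apply: (unormD_le gU); rewrite ?gv // gaussM gX mulr1.
  have [s [sC sv sle]] := tate_universal abs_complete gU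
    (iota := tateC abs n.+1) (@gauss_tateC _ _ _ _ abs_complete) b1.
  exists s; split=> //; first by rewrite -tvar0 sv /b unlift_none tvar0.
  by move=> i; rewrite sv /b liftK.
have [|s [sC sX sv sle]] := univ 1; first by rewrite gauss1.
have [|t [tC tX' tv tle]] := univ (- 1); first by rewrite (unormN gU) gauss1.
have canc (e : T) (s' t' : {rmorphism T -> T}) : e * e = 1 ->
    (forall c, s' (tateC abs n.+1 c) = tateC abs n.+1 c) -> s' tX = tX ->
    (forall i, s' (tvar abs (lift ord0 i)) = tvar abs (lift ord0 i) + e * tX ^+ w i) ->
    (forall f, gn (s' f) <= gn f) ->
    (forall c, t' (tateC abs n.+1 c) = tateC abs n.+1 c) -> t' tX = tX ->
    (forall i, t' (tvar abs (lift ord0 i)) = tvar abs (lift ord0 i) - e * tX ^+ w i) ->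
    (forall f, gn (t' f) <= gn f) -> t' e = e ->
    cancel s' t'.
  move=> ee s'C s'X s'v s'le t'C t'X t'v t'le t'e.
  have H := @tate_hom_ext _ _ _ _ abs_complete _ _ gU (t' \o s') idfun 1 ltr01.
  apply: H => [f|f|c|i] /=.
  - by rewrite mul1r (le_trans (t'le _)).
  - by rewrite mul1r.
  - by rewrite s'C t'C.
  - have [j ->|->] := unliftP ord0 i; last by rewrite tvar0 s'X t'X.
    by rewrite s'v rmorphD rmorphM rmorphXn t'v t'X t'e subrK.
exists s, t; split; [split|by []|by []|].
- apply: (canc 1) => //; rewrite ?mulr1 ?rmorph1 //.
  by move=> i; rewrite tv mulN1r mul1r.
- apply: (canc (- 1)) => //; rewrite ?mulrNN ?mulr1 ?rmorphN ?rmorph1 //.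
  by move=> i; rewrite sv mulN1r mul1r opprK.
- by move=> i; rewrite sv mul1r.
Qed.

Lemma base_inj B m (a b : 'I_m -> nat) : (forall i, a i < B)%N -> (forall i, b i < B)%N ->
  (\sum_i a i * B ^ i = \sum_i b i * B ^ i)%N -> a =1 b.
Proof.
elim: m a b => [|m IH] a b aB bB; first by move=> _ [].
rewrite !big_ord_recl !expn0 !muln1.
have shift (c : 'I_m.+1 -> nat) : (\sum_(i < m) c (lift ord0 i) * B ^ (lift ord0 i) =
    (\sum_(i < m) c (lift ord0 i) * B ^ i) * B)%N.
  by rewrite big_distrl; apply: eq_bigr => i _; rewrite lift0 expnSr mulnA.
rewrite !shift => e.
have e0 : a ord0 = b ord0.
  by have := congr1 (modn^~ B) e; rewrite !modnMDr_ || (rewrite ![(_ + _ * B)%N]addnC !modnMDl !modn_small).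
have B0 : (0 < B)%N by apply: leq_ltn_trans (aB ord0).
have e1 : a \o lift ord0 =1 b \o lift ord0.
  apply: IH => [i|i|]; [exact: aB|exact: bB|].
  by move: e; rewrite e0 => /addnI/eqP; rewrite eqn_pmul2r // => /eqP.
by move=> i; have [j ->|->] := unliftP ord0 i; [exact: e1|].
Qed.

Lemma tate_sumE m (I : Type) (r : seq I) (F : I -> tate abs m) b :
  (\sum_(i <- r) F i) b = \sum_(i <- r) F i b.
Proof.
by elim/big_rec2: _ => [|i x y _ e]; [|rewrite tateDE e].
Qed.

(* For weights growing fast enough the monomials of f of maximal norm receive
   distinct degrees in the distinguished variable. *)
Lemma distinguished_shear (f : T) : f != 0 -> exists (s t : {rmorphism T -> T}) k,
  [/\ cancel s t, cancel t s, forall c, s (tateC abs n.+1 c) = tateC abs n.+1 c,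
      forall c, t (tateC abs n.+1 c) = tateC abs n.+1 c & lead (s f) (mcons k 0)].
Proof.
move=> f0; have gf0 : 0 < gn f.
  by rewrite lt0r gauss_ge0 andbT; apply: contraNneq f0 => /gauss_eq0/eqP.
have [d fd] := tate_vanish f gf0.
have small b : abs (f b) = gn f -> (mdegree b < d)%N.
  by move=> e; rewrite ltnNge; apply/negP => /fd; rewrite e ltxx.
(* B exceeds every exponent in a monomial of maximal norm, so base-B expansions separate these
   monomials. X has weight B^0, hence the shift by one in w. *)
pose B := d.+2; pose w (i : 'I_n) := (B ^ i.+1)%N.
pose wt (b : mindex n.+1) := (\sum_i b i * B ^ i)%N.
have [s [t [[st ts] [sC tC] [sle sX] sv]]] := shear_exists w.
pose L := undup [seq b <- mons n.+1 d | abs (f b) == gn f].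
have memL b : (b \in L) = (abs (f b) == gn f).
  rewrite mem_undup mem_filter andb_idr // => /eqP/small/ltnW.
  exact: mem_mons.
have wt_inj : {in L &, injective wt}.
  move=> a b; rewrite !memL => /eqP/small ad /eqP/small bd e.
  apply/ffunP; apply: (base_inj (B := B)) e => i.
    by rewrite (leq_ltn_trans (leq_mdegree _ i)) // /B; lia.
  by rewrite (leq_ltn_trans (leq_mdegree _ i)) // /B; lia.
have [a0 a0P] := gauss_attained f.
have a0L : a0 \in L by rewrite memL -(gaussE a0P).
have [x y|x y z|a aL amax] := @seq_max _ (fun a b => (wt a <= wt b)%N) L a0 _ _ a0L.
- by case: (leqP (wt x) (wt y)) => [|/ltnW]; [left|right].
- exact: leq_trans.
have fa : abs (f a) = gn f by apply/eqP; rewrite -memL.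
have fa0 : f a != 0 by apply: contraTneq gf0 => e; rewrite -fa e absval0 ltxx.
have leadv i : lead (s (tvar abs i)) (mcons (B ^ i) 0).
  have [j ->|->] := unliftP ord0 i; last first.
    by rewrite tvar0 sX expn0; apply: lead_mono; exact: oner_neq0.
  rewrite sv addrC lift0 -/(w j).
  have lX : lead (tX ^+ w j) (mcons (w j) 0).
    by rewrite tXE //; apply: lead_mono; exact: oner_neq0.
  have e1 : abs ((tX ^+ w j) (mcons (w j) 0)) =
      abs (tvar abs (lift ord0 j) (mcons 0 (mdelta j))).
    by rewrite tXE // tvarS !monoE !eqxx.
  have [|l _] := leadD lX (g := tvar abs (lift ord0 j)); last exact: l.
  rewrite e1; apply: vbelow_lead.
    by rewrite tvarS; exact: lead_mono (oner_neq0 K).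
  by apply/mlt_mcons; left; rewrite expn_gt0.
have leads (c : K) b : c != 0 -> lead (s (mono abs c b)) (mcons (wt b) 0) /\
    abs (s (mono abs c b) (mcons (wt b) 0)) = abs c.
  move=> c0; rewrite mono_prod // rmorphM sC rmorph_prod.
  have lp : lead (\prod_i s (tvar abs i ^+ b i)) (mcons (wt b) 0).
    have -> : mcons (wt b) 0 = \sum_(i < n.+1) (mcons (B ^ i) 0 : mindex n.+1) *+ b i.
      rewrite /wt; elim/big_rec2: _ => [|i x y _ <-]; first by rewrite mcons00.
      by rewrite mcons_mulrn mul0rn mconsD addr0 mulnC.
    by apply: lead_prod => i; rewrite rmorphXn; apply: leadX.
  have [l e] := leadM (lead_mono abs 0 c0) lp.
  rewrite -tateCE add0r in l e.
  split=> //; rewrite -(lead_gauss l) gaussM tateCE gauss_mono.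
  have -> : gn (\prod_i s (tvar abs i ^+ b i)) = 1.
    elim/big_rec: _ => [|i x _ x1]; first by rewrite gauss1.
    rewrite gaussM x1 mulr1 rmorphXn.
    have v1 : gn (s (tvar abs i)) = 1.
      apply/eqP; rewrite eq_le (le_trans (sle _)) ?gauss_mono ?absval1 //=.
      have [j ->|->] := unliftP ord0 i; last first.
        by rewrite tvar0 sX gauss_mono absval1.
      rewrite sv; apply: le_trans (gauss_ub _ (mcons (w j) 0)).
      rewrite tateDE tvarS tXE // !monoE eqxx mcons_eq.
      by rewrite expn_eq0 /= add0r absval1.
    by elim: (b i) => [|k IH]; rewrite ?expr0 ?gauss1 // exprS gaussM v1 mul1r.
  by rewrite mulr1.
exists s, t, (wt a); split=> //.
(* g collects the finitely many monomials of maximal norm; h has smaller norm and s is a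
   contraction, so h does not affect the leading term. *)
pose g := \sum_(b <- L) mono abs (f b) b.
pose h := f - g.
have Lu : uniq L by exact: undup_uniq.
have gE c : g c = if c \in L then f c else 0.
  rewrite /g tate_sumE; case: ifPn => cL.
    rewrite (bigD1_seq c) //= eqxx big1 ?addr0 // => b bc.
    by rewrite eq_sym (negPf bc).
  rewrite big1_seq // => b /= bL; case: eqP => // e.
  by rewrite e bL in cL.
have hlt : gn h < gn f.
  apply: gauss_lt => c; rewrite tateBE gE; case: ifPn => cL.
    by rewrite subrr absval0.
  by rewrite subr0 lt_neqAle gauss_ub andbT -memL.
have fE : f = mono abs (f a) a + (\sum_(b <- L | b != a) mono abs (f b) b + h).
  have gS : g = mono abs (f a) a + \sum_(b <- L | b != a) mono abs (f b) b.
    by rewrite /g (bigD1_seq a).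
  by rewrite addrA -gS /h addrC subrK.
have [la ea] := leads (f a) a fa0.
rewrite {1}fE rmorphD.
have [|l _] := leadD la (g := s (\sum_(b <- L | b != a) mono abs (f b) b + h)); last exact: l.
rewrite ea rmorphD; apply: vbelowD; last first.
  by apply: vbelow_gauss; rewrite (le_lt_trans (sle _)) // fa.
rewrite rmorph_sum big_seq_cond.
apply: (big_ind (fun x => vbelow x (mcons (wt a) 0) (abs (f a)))).
- by apply: vbelow_gauss; rewrite (unorm_0 gU) fa.
- by move=> x y; apply: vbelowD.
move=> b /andP[bL ba]; have fb : abs (f b) = abs (f a).
  by rewrite fa; apply/eqP; rewrite -memL.
have fb0 : f b != 0 by apply: contraTneq gf0 => e; rewrite -fa -fb e absval0 ltxx.
have [lb eb] := leads (f b) b fb0.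
rewrite -fb -eb; apply: vbelow_lead => //; apply/mlt_mcons; left.
rewrite ltn_neqAle (amax _ bL) andbT; apply: contra ba => /eqP e.
by apply/eqP/wt_inj.
Qed.

End Shear.

Lemma separated_comp (T T' : idomainType) (s : {rmorphism T -> T'}) (f g : T) :
  injective s -> (exists lam : T' -> int,
    [/\ rval lam, forall x, x != 0 -> 0 <= lam x & lam (s f) < lam (s g)]) ->
  exists lam : T -> int, [/\ rval lam, forall x, x != 0 -> 0 <= lam x & lam f < lam g].
Proof.
move=> sI [lam [lamP lam0 lt]]; exists (lam \o s); split=> //.
  exact: rval_comp.
move=> x x0 /=; apply: lam0; apply: contraNneq x0 => e.
by apply/eqP/sI; rewrite e rmorph0.
Qed.

(** Over the fraction field w has a monic irreducible factor p. By Gauss's lemma p has coefficients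
    in T_n, and it turns out to be a prime element of T_(n+1). If p does not divide f, the p-adic
    valuation separates f from w; otherwise both are divided by p, which lowers the degree of w. *)
Lemma separated_weierstrass n : separated (tate abs n) ->
  forall m (w : {poly tate abs n}) (f : tate abs n.+1),
  w \is monic -> size w = m.+1 -> lead (wpoly n abs_complete w) (mcons m 0) ->
  ~ (exists q, f = q * wpoly n abs_complete w) ->
  exists lam : tate abs n.+1 -> int, [/\ rval lam, forall x, x != 0 -> 0 <= lam x
    & lam f < lam (wpoly n abs_complete w)].
Proof.
move=> sep; elim/ltn_ind => m IH w f wm sw lw nf.
set J := wpoly n abs_complete in lw nf *.
have gJw : gauss_norm (J w) = 1.
  rewrite (lead_gauss lw) -tcoefE tcoef_wpoly.
  by have := monicP wm; rewrite /lead_coef sw /= => ->; rewrite /= eqxx absval1.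
have m0 : (0 < m)%N.
  rewrite lt0n; apply/eqP => m0; apply: nf; exists f.
  have /size_poly1P[c c0 wE] : size w == 1%N by rewrite sw m0.
  move: wm; rewrite wE monicE lead_coefC => /eqP ->.
  by rewrite rmorph1 mulr1.
have Wm : map_poly (@tofrac _) w \is monic by rewrite mapF_monic.
have [|P [Q [Pm Qm WE Pirr]]] := irreducible_factor Wm; first by rewrite size_mapF sw.
have [p pE] := separated_monic_factor sep wm Pm Qm WE.
have [q qE] := separated_monic_factor sep wm Qm Pm (etrans WE (mulrC _ _)).
have wE : w = p * q by apply: mapF_inj; rewrite WE pE qE rmorphM.
have pm : p \is monic by move: Pm; rewrite pE mapF_monic.
have qm : q \is monic by move: Qm; rewrite qE mapF_monic.
have sp : (1 < size p)%N by case: Pirr => + _; rewrite pE size_mapF.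
(* Monic polynomials have norm at least 1, so both factors have norm exactly 1 and are Weierstrass
   polynomials. *)
have gpq : gauss_norm (J p) * gauss_norm (J q) = 1 by rewrite -gaussM -rmorphM -wE.
have gp := gauss_monic_ge1 abs_complete pm; have gq := gauss_monic_ge1 abs_complete qm.
have gp1 : gauss_norm (J p) <= 1.
  by rewrite -gpq -[leLHS]mulr1 ler_pM ?gauss_ge0.
have gq1 : gauss_norm (J q) <= 1.
  by rewrite -gpq -[leLHS]mul1r ler_pM ?gauss_ge0.
have [k sp'] : exists k, size p = k.+2 by case: (size p) sp => [|[|k]] // _; exists k.
have [l sq'] : exists l, size q = l.+1.
  by case E : (size q) => [|l]; [move: (monic_neq0 qm); rewrite -size_poly_eq0 E|exists l].
have [lp _] := lead_monic pm sp' gp1.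
have [lq _] := lead_monic qm sq' gq1.
have lm : (l < m)%N.
  move: sw; rewrite wE (size_monicM pm (monic_neq0 qm)) sp' sq' addnS => -[<-].
  by rewrite addSn ltnS leq_addl.
have Jp0 : J p != 0 := lead_neq0 lp.
have [lam [lamP lam0 lamN lamp]] : exists lam : tate abs n.+1 -> int,
  [/\ rval lam, forall x, x != 0 -> 0 <= lam x,
      forall x, x != 0 -> ~ (exists q, x = q * J p) -> lam x = 0 & lam (J p) = 1].
  apply: padic_rval => //.
  - move=> [u ue]; have u0 : u != 0.
      by apply: contra_eq_neq ue => ->; rewrite mul0r eq_sym oner_neq0.
    have [b ub] := lead_exists u0; have [i [c bE]] := mcons_ex b; rewrite {}bE in ub.
    have [+ _] := leadM ub lp; rewrite ue mconsD => l1.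
    have l1' : lead (1 : tate abs n.+1) (mcons 0 0) by rewrite mcons00; exact: lead1.
    by have [+ _] := mcons_inj (lead_unique l1 l1'); rewrite addnS.
  (* Primality: x and y may be replaced by their Weierstrass remainders r1 and r2. Then p divides r1
     r2 already in T_n[X], hence one of them, which vanishes by its degree. *)
  - move=> x y z xyz.
    have [q1 [r1 [s1 xE]]] := weierstrass_division abs_complete lp x.
    have [q2 [r2 [s2 yE]]] := weierstrass_division abs_complete lp y.
    have rE : J (r1 * r2) = (z - q1 * y - q2 * J r1) * J p.
      rewrite !mulrBl -xyz xE yE rmorphM /J; ring.
    have [h hE] := wpoly_dvd pm lp sp' rE.
    have ip : irreducible_poly (map_poly (@tofrac _) p) by rewrite -pE.
    have zero (r c : {poly tate abs n}) : (size r <= k.+1)%N -> r = c * p -> r = 0.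
      move=> sr re; have [c0|c0] := eqVneq c 0; first by rewrite re c0 mul0r.
      move: sr; rewrite re size_Mmonic // sp'.
      by move: c0; rewrite -size_poly_gt0; case: (size c) => // j _; rewrite addSn /= addnS ltnNge leq_addl.
    have [[c /(zero _ _ s1) r0]|[c /(zero _ _ s2) r0]] := mapF_prime pm ip hE.
      by left; exists q1; rewrite xE r0 rmorph0 addr0.
    by right; exists q2; rewrite yE r0 rmorph0 addr0.
  (* The X-degree of the leading exponent of x bounds the multiplicity, since the one of [J p] is
     positive. *)
  - move=> x /lead_exists[a xa]; exists (a ord0) => i q' xE.
    have q0 : q' != 0.
      by apply: contraTneq (lead_neq0 xa) => q0; rewrite xE q0 mul0r eqxx.
    have [b qb] := lead_exists q0.
    have [+ _] := leadM qb (leadX i lp); rewrite -xE => l1.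
    rewrite (lead_unique xa l1) mcons_mulrn ffunE mcons0E.
    by rewrite -[X in (_ <= X)%N]/(b ord0 + k.+1 * i)%N mulSn addnCA leq_addr.
have Jw : J w = J p * J q by rewrite wE rmorphM.
have Jq0 : J q != 0 := lead_neq0 lq.
have [[f1 fE]|npf] := pselect (exists q, f = q * J p); last first.
  have f0 : f != 0 by apply/eqP => f0; apply: npf; exists 0; rewrite f0 mul0r.
  exists lam; split=> //; rewrite lamN // Jw rvalM // lamp.
  exact: ltr_pwDl (lam0 _ Jq0).
have nf1 : ~ exists q0, f1 = q0 * J q.
  by move=> [q0 f1E]; apply: nf; exists q0; rewrite fE f1E Jw; ring.
have [mu [muP mu0 lt]] := IH l lm q f1 qm sq' lq nf1.
have f10 : f1 != 0 by apply/eqP => f0; apply: nf1; exists 0; rewrite f0 mul0r.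
exists mu; split=> //; rewrite fE Jw !rvalM // addrC.
by rewrite ltrD2l.
Qed.

Lemma separated_tate n : separated (tate abs n).
Proof.
elim: n => [|n IH] f g g0 nf.
  have [b gb] := lead_exists g0; rewrite (mindex0_eq b 0) in gb.
  have [u gu] := lead0_unit abs_complete gb.
  by case: nf; exists (f * u); rewrite -mulrA [u * g]mulrC gu mulr1.
have [s [t [k [st ts _ _ sg]]]] := distinguished_shear g0.
apply: (separated_comp (s := s)); first exact: can_inj st.
have [w [u [v [wm sw lw wE vu]]]] := weierstrass_preparation abs_complete sg.
have nsf : ~ exists q, s f = q * wpoly n abs_complete w.
  move=> [q e]; apply: nf; exists (t (q * u)).
  by apply: (can_inj st); rewrite rmorphM ts e wE mulrA.
have [lam [lamP lam0 lt]] := separated_weierstrass IH wm sw lw nsf.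
(* lam is nonnegative and u is a unit, so lam u = 0 and w has the same value as s g. *)
exists lam; split=> //; apply: lt_le_trans lt _.
have u0 : u != 0 by apply: contra_eq_neq vu => ->; rewrite mulr0 eq_sym oner_neq0.
have v0 : v != 0 by apply: contra_eq_neq vu => ->; rewrite mul0r eq_sym oner_neq0.
have sg0 : s g != 0 := lead_neq0 sg.
rewrite wE rvalM //.
have := congr1 lam vu; rewrite rvalM // (rval1 lamP).
have := lam0 _ u0; have := lam0 _ v0; move: (lam u) (lam v) (lam (s g)).
by clear; move=> a b c; lia.
Qed.

(** If phi kills some h other than 0, a shear makes h distinguished of some order m. By Weierstrass
    division every phi f is then a combination of the images of X^k, k < m, with coefficients from
    T_n, and the induction hypothesis applies to T_n. *)
Lemma noether_normalization n (A : idomainType) (phi : {rmorphism tate abs n -> A}) :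
  exists d (chi : {rmorphism tate abs d -> A}) (I : finType) (b : I -> A),
  [/\ injective chi, forall c, chi (tateC abs d c) = phi (tateC abs n c)
    & forall f, exists k : I -> tate abs d, phi f = \sum_i chi (k i) * b i].
Proof.
elim: n A phi => [|n IH] A phi; have [phiI|nphi] := pselect (injective phi).
- exists 0%N, phi, unit, (fun=> 1); split=> // f; exists (fun=> f).
  by rewrite big_const card_unit /= addr0 mulr1.
- case: nphi; move=> f g e; apply/eqP; rewrite -subr_eq0; apply/eqP.
  apply: contrapT => /eqP h0; have [b hb] := lead_exists h0.
  rewrite (mindex0_eq b 0) in hb; have [u hu] := lead0_unit abs_complete hb.
  have := congr1 phi hu; rewrite rmorphM rmorphB e subrr mul0r rmorph1.
  by move/esym/eqP; rewrite oner_eq0.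
- exists n.+1, phi, unit, (fun=> 1); split=> // f; exists (fun=> f).
  by rewrite big_const card_unit /= addr0 mulr1.
have [h h0 hE] : exists2 h, h != 0 & phi h = 0.
  apply: contrapT => nh; apply: nphi => f g e; apply/eqP; rewrite -subr_eq0.
  apply: contrapT => /negP h0; apply: nh; exists (f - g) => //.
  by rewrite rmorphB e subrr.
have [s [t [m [st ts sC tC sh]]]] := distinguished_shear h0.
have [d [chi [I [b [chiI chiC chiS]]]]] :=
  IH A (phi \o t \o inclR n abs_complete : {rmorphism _ -> _}).
exists d, chi, ('I_m * I)%type, (fun ki : 'I_m * I => b ki.2 * phi (t (tX abs n)) ^+ ki.1).
split=> // [c|f]; first by rewrite chiC /= incl_tateC tC.
have [q [r [rs e]]] := weierstrass_division abs_complete sh (s f).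
have /choice[c cP] : forall k : 'I_m, exists c : I -> tate abs d,
    phi (t (inclR n abs_complete r`_k)) = \sum_i chi (c i) * b i.
  by move=> k; exact: chiS.
exists (fun ki : 'I_m * I => c ki.1 ki.2).
rewrite -(pair_bigA _ (fun (k : 'I_m) (i : I) =>
  chi (c k i) * (b i * phi (t (tX abs n)) ^+ k))) /=.
have -> : phi f = phi (t (wpoly n abs_complete r)).
  rewrite -{1}(st f) e rmorphD rmorphM st rmorphD rmorphM hE mulr0 add0r.
  by [].
have -> : r = \sum_(k < m) r`_k *: 'X^k.
  apply/polyP => i; rewrite coef_sum.
  have [im|mi] := ltnP i m.
    rewrite (bigD1 (Ordinal im)) //= coefZ coefXn eqxx mulr1 big1 ?addr0 // => k ki.
    rewrite coefZ coefXn; case: eqP => [e'|]; last by rewrite mulr0.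
    by case/negP: ki; apply/eqP/val_inj.
  rewrite big1; first by move/leq_sizeP: rs; apply.
  move=> k _; rewrite coefZ coefXn gtn_eqF ?mulr0 //.
  exact: leq_trans (ltn_ord k) mi.
rewrite !rmorph_sum; apply: eq_bigr => k _.
rewrite -mul_polyC !rmorphM wpolyC !rmorphXn wpolyX cP mulr_suml.
by apply: eq_bigr => i _; rewrite mulrA.
Qed.

End Separation.

(** * The Gauss-lexicographic valuation *)

Section GaussLexValuation.
Variables (R : realType) (K : fieldType) (abs : nonarch_absval R K) (n : nat).
Local Notation T := (tate abs n).
Local Notation Q := {fraction T}.
Local Notation mono := (mono abs).
Implicit Types (f g h : T) (a b c : mindex n) (k : K).

(* Comparison for the valuation that sends f with leading exponent a to the pair
   (|f a|, a), ordered lexicographically; only meaningful for h <> 0. *)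
Definition vle f h : Prop := forall b, lead h b ->
  (forall c, abs (f c) <= abs (h b)) /\ (forall c, mlt b c -> abs (f c) < abs (h b)).

Lemma vleP f h a b : lead f a -> lead h b ->
  vle f h <-> (abs (f a) < abs (h b) \/ abs (f a) = abs (h b) /\ ~ mlt b a).
Proof.
move=> la lb; have [fa0 fa fa'] := la; split=> [fh|fh b' lb'].
  have [h1 h2] := fh b lb; have := h1 a; rewrite le_eqVlt => /orP[/eqP e|]; last by left.
  by right; split=> // /h2; rewrite e ltxx.
rewrite -(lead_unique lb lb'); case: fh => [lt|[e nba]].
  by split=> [c|c _]; [apply: ltW|]; apply: le_lt_trans (fa c) lt.
rewrite -e; split=> // c bc; apply: fa'.
have [ab|ab|//] := mlt_total a b; first by rewrite ab.
exact: mlt_trans ab bc.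
Qed.

Lemma vle0 h : vle 0 h.
Proof.
move=> b [hb _ _]; split=> c *; rewrite tate0E absval0 ?absval_ge0 //.
exact: absval_gt0.
Qed.

Lemma vleB f g h : vle f h -> vle g h -> vle (f - g) h.
Proof.
move=> fh gh b lb; have [f1 f2] := fh b lb; have [g1 g2] := gh b lb.
split=> c => [|bc]; rewrite tateBE; [apply: le_trans (absvalD _ _ _) _|
  apply: le_lt_trans (absvalD _ _ _) _].
  by rewrite ge_max absvalN f1 g1.
by rewrite gt_max absvalN f2 ?g2.
Qed.

Lemma vle_total f h : vle f h \/ vle h f.
Proof.
have [->|f0] := eqVneq f 0; first by left; exact: vle0.
have [->|h0] := eqVneq h 0; first by right; exact: vle0.
have [a la] := lead_exists f0; have [b lb] := lead_exists h0.
have [lt|lt|e] := ltgtP (abs (f a)) (abs (h b)).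
- by left; apply/(vleP la lb); left.
- by right; apply/(vleP lb la); left.
have [ba|ba] := pselect (mlt b a).
  by right; apply/(vleP lb la); right; split=> //; exact: mlt_asym.
by left; apply/(vleP la lb); right.
Qed.

Lemma vleM f f' h h' : h != 0 -> h' != 0 -> vle f h -> vle f' h' ->
  vle (f * f') (h * h').
Proof.
move=> h0 h0'; have [->|f0] := eqVneq f 0; first by rewrite mul0r => *; exact: vle0.
have [->|f0'] := eqVneq f' 0; first by rewrite mulr0 => *; exact: vle0.
have [a la] := lead_exists f0; have [b lb] := lead_exists h0.
have [a' la'] := lead_exists f0'; have [b' lb'] := lead_exists h0'.
have [lf ef] := leadM la la'; have [lh eh] := leadM lb lb'.
have [fa0 _ _] := la; have [fa0' _ _] := la'.
have pa := absval_gt0 abs fa0; have pa' := absval_gt0 abs fa0'.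
move=> /(vleP la lb) h1 /(vleP la' lb') h2; apply/(vleP lf lh).
rewrite ef eh; case: h1 => [h1|[e1 n1]].
  left; apply: (@lt_le_trans _ _ (abs (h b) * abs (f' a'))); first by rewrite ltr_pM2r.
  rewrite ler_pM2l; last exact: lt_trans h1.
  by case: h2 => [/ltW|[->]].
case: h2 => [h2|[e2 n2]]; first by left; rewrite e1 ltr_pM2l // -e1.
right; rewrite e1 e2; split=> // lt.
have ab : a = b \/ mlt a b by have [->|?|/n1//] := mlt_total a b; [left|right].
have ab' : a' = b' \/ mlt a' b' by have [->|?|/n2//] := mlt_total a' b'; [left|right].
have l1 : a + a' = b + a' \/ mlt (a + a') (b + a').
  by case: ab => [->|ab]; [left|right; apply/mltD2r].
have l2 : b + a' = b + b' \/ mlt (b + a') (b + b').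
  by case: ab' => [->|ab']; [left|right; rewrite ![b + _]addrC; apply/mltD2r].
case: l1 => [e|l1]; case: l2 => [e'|l2].
- by rewrite e e' in lt; exact: mlt_irr lt.
- by rewrite e in lt; exact: mlt_asym lt l2.
- by rewrite -e' in lt; exact: mlt_asym lt l1.
- exact: mlt_asym lt (mlt_trans l1 l2).
Qed.

Lemma vle_refl h : vle h h. Proof. by case: (vle_total h h). Qed.

Lemma vleM2r g f h : g != 0 -> h != 0 -> vle (f * g) (h * g) -> vle f h.
Proof.
move=> g0 h0; have [->|f0] := eqVneq f 0; first by move=> _; exact: vle0.
have [a la] := lead_exists f0; have [b lb] := lead_exists h0.
have [d lg] := lead_exists g0; have [gd0 _ _] := lg.
have pg := absval_gt0 abs gd0.
have [lf ef] := leadM la lg; have [lh eh] := leadM lb lg.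
move=> /(vleP lf lh) H; apply/(vleP la lb); move: H; rewrite ef eh (ltr_pM2r pg).
case=> [|[e nm]]; [by left|right]; split; first by apply: (mulIf (lt0r_neq0 pg)).
by move=> lt; apply: nm; apply/mltD2r.
Qed.

(** Refining the Gauss norm by the leading exponent shrinks the residue field from rational
    functions to the residue field of K; see [OV_residue]. *)
Definition OV : set Q :=
  [set q | exists f h, [/\ h != 0, q = tofrac f / tofrac h & vle f h]].

Lemma OV_frac f h : h != 0 -> OV (tofrac f / tofrac h) <-> vle f h.
Proof.
move=> h0; split=> [[f' [h' [h0' e fh']]]|fh]; last by exists f, h.
have e' : f * h' = f' * h.
  apply: tofrac_inj; rewrite !rmorphM; apply/eqP.
  by rewrite -eqr_div ?tofrac_eq0 // e.
apply: (vleM2r h0' h0); rewrite e' [h * _]mulrC.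
by apply: vleM => //; exact: vle_refl.
Qed.

Lemma vring_OV : vring OV.
Proof.
split; first split.
- by exists 1, 1; rewrite oner_neq0 divr1 rmorph1; split=> //; exact: vle_refl.
- move=> _ _ [f [h [h0 -> fh]]] [f' [h' [h0' -> fh']]].
  exists (f * h' - f' * h), (h * h'); split; first by rewrite mulf_neq0.
    rewrite -mulNr addf_div ?tofrac_eq0 // -!rmorphN -!rmorphM -rmorphD /=.
    by rewrite mulNr.
  apply: vleB; first by apply: vleM => //; exact: vle_refl.
  by rewrite [h * _]mulrC; apply: vleM => //; exact: vle_refl.
- move=> _ _ [f [h [h0 -> fh]]] [f' [h' [h0' -> fh']]].
  exists (f * f'), (h * h'); split; [by rewrite mulf_neq0| |exact: vleM].
  by rewrite mulf_div -!rmorphM.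
move=> q; have [f [h [h0 ->]]] := fracE q => q0.
have f0 : f != 0 by apply: contraNneq q0 => ->; rewrite rmorph0 mul0r.
rewrite invf_div; case: (vle_total f h) => [fh|hf]; [left|right].
  by exists f, h.
by exists h, f.
Qed.

Lemma vmax_OV f h a : lead h a -> vbelow f a (abs (h a)) ->
  vmax OV (tofrac f / tofrac h).
Proof.
move=> lh [fr fr']; have h0 := lead_neq0 lh.
have [->|f0] := eqVneq f 0; first by left; rewrite rmorph0 mul0r.
right; rewrite invf_div => /(OV_frac _ f0); have [b lf] := lead_exists f0.
move=> /(vleP lh lf)[|[e nm]]; first by rewrite ltNge fr.
by have := fr' _ nm; rewrite e ltxx.
Qed.

Lemma OV_tateC k : abs k <= 1 -> OV (tofrac (tateC abs n k)).
Proof.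
move=> k1; exists (tateC abs n k), 1; rewrite oner_neq0 rmorph1 divr1; split=> //.
move=> b lb; have : gauss_norm (1 : T) = 1 := gauss1 abs n.
rewrite (lead_gauss lb) => ->.
have b0 : b = 0 by apply: lead_unique lb _; exact: lead1.
split=> c; rewrite tateCE monoE; first by case: ifP; rewrite ?absval0.
by rewrite b0; case: eqP => [-> /mlt_irr//|_ _]; rewrite absval0.
Qed.

Lemma vmax_OV_tateC k : abs k < 1 -> vmax OV (tofrac (tateC abs n k)).
Proof.
move=> k1; have [->|k0] := eqVneq k 0; first by left; rewrite !rmorph0.
right; rewrite -[_^-1]mul1r -(rmorph1 (@tofrac T)).
have lk := lead_mono abs (0 : mindex n) k0; rewrite -tateCE in lk.
have l1 : lead (tateC abs n 1) 0 by rewrite tateCE; exact: lead_mono (oner_neq0 K).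
rewrite -(rmorph1 (tateC abs n)) => /(OV_frac _ (lead_neq0 lk)).
move=> /(vleP l1 lk); rewrite !tateCE !monoE eqxx absval1.
by case=> [|[e _]]; [rewrite ltNge ltW|rewrite -e ltxx in k1].
Qed.

(** The residue of f / h is the quotient of their coefficients at the leading exponent of h. *)
Lemma OV_residue (q : Q) : complete_for abs -> OV q ->
  exists k, abs k <= 1 /\ vmax OV (q - tofrac (tateC abs n k)).
Proof.
move=> abs_complete [f [h [h0 -> fh]]]; have [a lh] := lead_exists h0.
have [ha0 hb hb'] := lh; have pa := absval_gt0 abs ha0.
have [f1 f2] := fh a lh; exists (f a / h a); split.
  by rewrite absvalM absvalV ler_pdivrMr // mul1r.
have -> : tofrac f / tofrac h - tofrac (tateC abs n (f a / h a)) =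
    tofrac (f - tateC abs n (f a / h a) * h) / tofrac h.
  by rewrite tofracB tofracM mulrBl mulfK // tofrac_eq0.
apply: (vmax_OV lh).
have kh c : abs (f a / h a * h c) <= abs (h c).
  rewrite absvalM -[leRHS]mul1r ler_wpM2r ?absval_ge0 //.
  by rewrite absvalM absvalV ler_pdivrMr // mul1r.
split=> c => [|nc]; rewrite tateBE tateCM_E //.
  by rewrite (le_trans (absvalD _ _ _)) // ge_max f1 absvalN (le_trans (kh c)).
have [<-|ac|//] := mlt_total a c; first by rewrite divfK // subrr absval0.
rewrite (le_lt_trans (absvalD _ _ _)) // gt_max f2 // absvalN.
by rewrite (le_lt_trans (kh c)) ?hb'.
Qed.

End GaussLexValuation.

(** * Dickson's lemma *)

Definition increasing (phi : nat -> nat) : Prop := forall i k, (i < k)%N -> (phi i < phi k)%N.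

Lemma increasing_ge phi : increasing phi -> forall i k, (i <= k)%N -> (phi i <= phi k)%N.
Proof.
by move=> inc i k; rewrite leq_eqVlt => /orP[/eqP -> //|/inc/ltnW].
Qed.

(** Each chosen index minimizes u on the tail after the preceding choice. *)
Lemma monotone_subseq (u : nat -> nat) : exists phi, increasing phi /\
  forall i k, (i <= k)%N -> (u (phi i) <= u (phi k))%N.
Proof.
have /choice[g gP] : forall k0, exists i, (k0 <= i)%N /\
    forall l, (k0 <= l)%N -> (u i <= u l)%N.
  move=> k0; pose P v := `[< exists2 i, (k0 <= i)%N & u i = v >].
  have exP : exists v, P v by exists (u k0); apply/asboolP; exists k0.
  case: (ex_minnP exP) => v /asboolP[i ki <-] vmin; exists i; split=> // l kl.
  by apply: vmin; apply/asboolP; exists l.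
pose phi i := iter i (fun p => g p.+1) (g 0%N).
have phiS i : (phi i < phi i.+1)%N by rewrite /phi /=; have [] := gP (phi i).+1.
have inc : increasing phi.
  move=> i k; elim: k => // k IH; rewrite ltnS leq_eqVlt => /orP[/eqP -> //|/IH lt].
  exact: ltn_trans lt (phiS k).
have minphi i l : (phi i <= l)%N -> (u (phi i) <= u l)%N.
  case: i => [|i] il; first by have [_] := gP 0%N; apply.
  have [_] := gP (phi i).+1; apply; exact: leq_trans (phiS i) il.
exists phi; split=> // i k ik; apply: minphi.
exact: (increasing_ge inc).
Qed.

Lemma monotone_subseq_fin r (us : 'I_r -> nat -> nat) : exists phi, increasing phi /\
  forall a i k, (i <= k)%N -> (us a (phi i) <= us a (phi k))%N.
Proof.
elim: r us => [|r IH] us; first by exists id; split=> // -[].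
have [phi [inc mon]] := IH (fun a => us (lift ord0 a)).
have [psi [inc' mon']] := monotone_subseq (us ord0 \o phi).
exists (phi \o psi); split=> [i k ik /=|a i k ik /=]; first exact/inc/inc'.
have [a' ->|->] := unliftP ord0 a; last exact: mon'.
by apply: mon; exact: (increasing_ge inc').
Qed.

(* Applied to a residue and to its complement, monotonicity forces the residue to be
   constant along the subsequence. *)
Lemma dickson r (N : nat) (c : nat -> mindex r) : (0 < N)%N ->
  exists phi, increasing phi /\
    forall i k, (i <= k)%N -> exists b : mindex r, c (phi k) = c (phi i) + b *+ N.
Proof.
move=> N0; have [p1 [i1 m1]] := monotone_subseq_fin (fun a i => c i a).
have [p2 [i2 m2]] := monotone_subseq_fin (fun a i => c (p1 i) a %% N)%N.
have [p3 [i3 m3]] := monotone_subseq_fin (fun a i => N - c (p1 (p2 i)) a %% N)%N.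
exists (p1 \o p2 \o p3); split=> [i k ik /=|i k ik]; first exact/i1/i2/i3.
exists [ffun a => ((c (p1 (p2 (p3 k))) a - c (p1 (p2 (p3 i))) a) %/ N)%N].
apply/ffunP => a; rewrite /= ffunE ffunMnE ffunE.
have le1 := m1 a _ _ (increasing_ge i2 (increasing_ge i3 ik)).
have le2 := m2 a _ _ (increasing_ge i3 ik).
have le3 := m3 a _ _ ik.
set x := c (p1 (p2 (p3 k))) a in le1 le2 le3 *.
set y := c (p1 (p2 (p3 i))) a in le1 le2 le3 *.
have xy : (x %% N = y %% N)%N.
  have hx := ltn_pmod x N0; have hy := ltn_pmod y N0.
  by move: le2 le3 hx hy; clear; lia.
have dv : (N %| x - y)%N by rewrite -eqn_mod_dvd // eq_sym; apply/eqP.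
have nat_mulrn (v k' : nat) : v *+ k' = (v * k')%N.
  by elim: k' => [|k' IH]; rewrite ?muln0 // mulrS IH mulnS.
by rewrite nat_mulrn divnK // -[RHS]/(y + (x - y))%N subnKC.
Qed.

(** * Finiteness of the unit ball *)

Lemma scaled_weight (F : fieldType) (q mu : F) N r l : mu != 0 -> (l <= r)%N ->
  (q * mu ^+ (r - l)) ^+ N * mu ^+ (l * N) / mu ^+ (N * r) = q ^+ N.
Proof.
move=> mu0 lr; have -> : mu ^+ (N * r) = (mu ^+ (r - l)) ^+ N * mu ^+ (l * N).
  by rewrite -exprM -exprD -mulnDl subnK // mulnC.
by rewrite exprMn; field; rewrite !expf_neq0.
Qed.

Lemma weight_quotient (F : fieldType) (a b mu : F) n k : mu != 0 -> (k <= n)%N ->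
  a = b ^+ k -> a * mu ^+ (n - k) / mu ^+ n = (b / mu) ^+ k.
Proof.
move=> mu0 kn ->; have -> : mu ^+ n = mu ^+ (n - k) * mu ^+ k by rewrite -exprD subnK.
by rewrite expr_div_n; field; rewrite !expf_neq0.
Qed.

Lemma monic_of_coef (F : fieldType) (p : {poly F}) M :
  p`_M = 1 -> (forall i, (M < i)%N -> p`_i = 0) -> p \is monic /\ size p = M.+1.
Proof.
move=> pM p0; have sp : size p = M.+1.
  apply/eqP; rewrite eqn_leq; apply/andP; split; first exact/leq_sizeP.
  by rewrite ltnNge; apply/negP => /leq_sizeP/(_ _ (leqnn M)); rewrite pM => /eqP; rewrite oner_eq0.
by rewrite monicE /lead_coef sp /= pM.
Qed.

Section SpectralOrder.
Variables (R : realType) (K : fieldType) (abs : nonarch_absval R K).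
Hypothesis abs_complete : complete_for abs.
Variables (t : K) (d : nat).
Hypotheses (t0 : t != 0) (t1 : abs t < 1).
Hypothesis tP : forall c, c != 0 -> exists z : int, abs c = abs t ^ z.
Local Notation T := (tate abs d).
Local Notation Q := {fraction T}.
Local Notation gn := (@gauss_norm R K abs d).
Variables (E : fieldType) (j : {rmorphism Q -> E}) (m : nat).
Hypothesis fin : finite_over j m.
Local Notation J := (fun f : T => j (tofrac f)).
Local Notation O := (@OV R K abs d).
Let vO : vring O := vring_OV abs d.
Let at0 : 0 < abs t := absval_gt0 abs t0.
Implicit Types (c b : mindex d.+1) (x y : E) (f g : T).

(* An exponent c stands for the monomial t^(c 0) z^(mtail c); the order clt is
   reversed on the exponent of t, so that c < b means that mm c is smaller. *)
Definition mm c : T := mono abs (t ^+ c ord0) (mtail c).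

Definition clt c b : Prop :=
  (b ord0 < c ord0)%N \/ c ord0 = b ord0 /\ mlt (mtail c) (mtail b).

Lemma clt_total c b : [\/ c = b, clt c b | clt b c].
Proof.
have [lt|lt|e] := ltngtP (c ord0) (b ord0).
- by constructor 3; left.
- by constructor 2; left.
have [et|lt|lt] := mlt_total (mtail c) (mtail b).
- by constructor 1; rewrite -(mcons_tail c) -(mcons_tail b) e et.
- by constructor 2; right.
- by constructor 3; right.
Qed.

Lemma lead_mm c : lead (mm c) (mtail c).
Proof. by apply: lead_mono; rewrite expf_neq0. Qed.

Lemma mm_neq0 c : mm c != 0. Proof. exact: lead_neq0 (lead_mm c). Qed.

Lemma mmD c b : mm (c + b) = mm c * mm b.
Proof.
rewrite /mm monoM -exprD ffunE; congr mono.
by apply/ffunP => i; rewrite !ffunE.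
Qed.

Lemma mm0 : mm 0 = 1.
Proof.
have -> : (1 : T) = mono abs 1 0 by rewrite -tateCE rmorph1.
rewrite /mm ffunE expr0; congr mono.
by apply/ffunP => i; rewrite !ffunE.
Qed.

Lemma mmX c k : mm (c *+ k) = mm c ^+ k.
Proof. by elim: k => [|k IH]; rewrite ?mulr0n ?mm0 // mulrS exprS mmD IH. Qed.

Lemma gauss_mm c : gn (mm c) = abs t ^+ c ord0.
Proof. by rewrite gauss_mono absvalX. Qed.

Lemma clt_vmax c b : clt c b -> vmax O (tofrac (mm c) / tofrac (mm b)).
Proof.
move=> cb; apply: (vmax_OV (lead_mm b)).
have -> : abs (mm b (mtail b)) = abs t ^+ b ord0.
  by rewrite -(lead_gauss (lead_mm b)) gauss_mm.
case: cb => [lt|[e lt]].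
  by apply: vbelow_gauss; rewrite gauss_mm ltr_iXn2l.
have -> : abs t ^+ b ord0 = abs (mm c (mtail c)).
  by rewrite -(lead_gauss (lead_mm c)) gauss_mm e.
by apply: vbelow_lead => //; exact: lead_mm.
Qed.

(** As |t| generates the values of K, the pair (norm, leading exponent) of f is also that of a
    monomial t^k z^a. *)
Lemma mm_unit f : f != 0 -> gn f <= 1 -> exists c,
  O (tofrac f / tofrac (mm c)) /\ O (tofrac (mm c) / tofrac f).
Proof.
move=> f0 f1; have [a la] := lead_exists f0; have [fa0 _ _] := la.
have [z az] := tP fa0.
have z0 : 0 <= z.
  rewrite leNgt; apply/negP; case: z az => // k az _; move: f1.
  rewrite (lead_gauss la) az leNgt NegzE -exprnN invf_gt1 ?exprn_gt0 //.
  by rewrite exprn_ilt1 ?ltW.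
case: z z0 az => // k _ az; exists (mcons k a).
have lm : lead (mm (mcons k a)) a by have := lead_mm (mcons k a); rewrite mtail_cons.
have e : abs (f a) = abs (mm (mcons k a) a).
  by rewrite -(lead_gauss lm) gauss_mm mcons0E az.
split; [apply/(OV_frac _ (mm_neq0 _))/(vleP la lm)|apply/(OV_frac _ f0)/(vleP lm la)];
  by right; rewrite e; split=> //; exact: mlt_irr.
Qed.

Let N := (m.+1)`!.
Let N0 : (0 < N)%N. Proof. exact: fact_gt0. Qed.

(* x^N is compared with mm c simultaneously in all the valuation rings dominating
   the Gauss-lexicographic one, as for a spectral norm; the slopes of a polynomial of
   degree at most m + 1 become integral after multiplication by N = (m + 1)!. *)
Definition sle x c := forall W, dominates j O W -> W (x ^+ N / J (mm c)).
Definition slt x c := forall W, dominates j O W -> vmax W (x ^+ N / J (mm c)).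
Definition elead x c := sle x c /\ ~ slt x c.

Lemma J_neq0 f : f != 0 -> J f != 0.
Proof. by move=> f0; rewrite fmorph_eq0 tofrac_eq0. Qed.

Lemma slt_sle x c : slt x c -> sle x c.
Proof. by move=> h W dW; have [vW _ _] := dW; apply: vmax_sub => //; exact: h. Qed.

Lemma mm_shift x c b : (J (mm b) * x) ^+ N / J (mm (c + b *+ N)) = x ^+ N / J (mm c).
Proof.
rewrite mmD mmX !rmorphM !rmorphXn exprMn; field.
by rewrite expf_neq0 !J_neq0 ?mm_neq0.
Qed.

Lemma sle_shift x c b : sle (J (mm b) * x) (c + b *+ N) <-> sle x c.
Proof. by split=> h W /h; rewrite mm_shift. Qed.

Lemma slt_shift x c b : slt (J (mm b) * x) (c + b *+ N) <-> slt x c.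
Proof. by split=> h W /h; rewrite mm_shift. Qed.

Lemma elead_shift x c b : elead x c -> elead (J (mm b) * x) (c + b *+ N).
Proof. by move=> [h1 h2]; split; [apply/sle_shift|move/slt_shift]. Qed.

(** z is the one of x and y with the larger absolute value for W. *)
Lemma vring_sum_pow (W : set E) x y (u : E) : vring W -> u != 0 ->
  exists z, [/\ z = x \/ z = y, W ((x + y) ^+ N / u / (z ^+ N / u)) &
    z = 0 -> x + y = 0].
Proof.
move=> vW u0; wlog h : x y / x != 0 /\ W (y / x) \/ x = 0 /\ y = 0.
  move=> wl; have [x0|x0] := eqVneq x 0; have [y0|y0] := eqVneq y 0.
  - by apply: wl; right.
  - have [|z [zE h1 h2]] := wl y x.
      by left; split=> //; rewrite x0 mul0r; exact: subring0 (vring_subring vW).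
    by exists z; rewrite addrC; split=> //; case: zE; [right|left].
  - by apply: wl; left; rewrite y0 mul0r; split=> //; exact: subring0 (vring_subring vW).
  have yx : y / x != 0 by rewrite mulf_neq0 ?invr_eq0.
  have [h|h] := vring_total vW yx; first by apply: wl; left.
  have [|z [zE h1 h2]] := wl y x; first by left; rewrite -invf_div.
  by exists z; rewrite addrC; split=> //; case: zE; [right|left].
have sW := vring_subring vW.
case: h => [[x0 h]|[-> ->]]; last first.
  exists 0; rewrite addr0; split; [by left| |by []].
  by rewrite expr0n gtn_eqF // !mul0r; exact: subring0.
exists x; split; [by left| |by move=> e; rewrite e eqxx in x0].
have -> : (x + y) ^+ N / u / (x ^+ N / u) = (1 + y / x) ^+ N.
  have -> : 1 + y / x = (x + y) / x by rewrite mulrDl divff.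
  by rewrite expr_div_n; field; rewrite u0 expf_neq0.
by apply: (subringX sW); apply: (subringD sW) => //; exact: subring1.
Qed.

Lemma slt_add x y c : slt x c -> slt y c -> slt (x + y) c.
Proof.
move=> xc yc W dW; have [vW _ _] := dW.
have mc0 : J (mm c) != 0 := J_neq0 (mm_neq0 c).
have [z [zE h z0]] := vring_sum_pow x y vW mc0.
have Wz : vmax W (z ^+ N / J (mm c)) by case: zE => ->; [exact: xc|exact: yc].
have [e|zN0] := eqVneq z 0.
  by rewrite z0 // -e.
have zz : z ^+ N / J (mm c) != 0 by rewrite mulf_neq0 ?invr_eq0 ?expf_neq0.
by rewrite -(divfK zz ((x + y) ^+ N / _)); apply: vmaxM.
Qed.

Lemma slt0 c : slt 0 c.
Proof. by move=> W _; left; rewrite expr0n gtn_eqF // mul0r. Qed.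

Lemma slt_scale (q : Q) x c : O q -> slt x c -> slt (j q * x) c.
Proof.
move=> Oq xc W dW; have [vW OW _] := dW.
rewrite exprMn -mulrA; apply: vmaxM => //; last exact: xc.
by apply: (subringX (vring_subring vW)); exact: OW.
Qed.

Lemma slt_vmax (q : Q) x c : vmax O q -> sle x c -> slt (j q * x) c.
Proof.
move=> Oq xc W dW; have [vW _ mW] := dW.
rewrite exprMn -mulrA mulrC; apply: vmaxM => //; first exact: xc.
by apply: vmaxX => //; exact: mW.
Qed.

Lemma slt_sum (I : Type) (r : seq I) (P : pred I) (F : I -> E) c :
  (forall i, P i -> slt (F i) c) -> slt (\sum_(i <- r | P i) F i) c.
Proof.
move=> Fc; apply: (big_ind (fun x => slt x c)) => //; first exact: slt0.
by move=> x y; exact: slt_add.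
Qed.

Lemma sltN x c : slt x c -> slt (- x) c.
Proof.
move=> xc; have := slt_scale (q := - 1) _ xc; rewrite rmorphN rmorph1 mulN1r.
by apply; apply: (subringN (vring_subring vO)); exact: subring1 (vring_subring vO).
Qed.

Lemma slt_trans x c b : sle x c -> clt c b -> slt x b.
Proof.
move=> xc cb W dW; have [vW _ mW] := dW.
have -> : x ^+ N / J (mm b) = x ^+ N / J (mm c) * j (tofrac (mm c) / tofrac (mm b)).
  by rewrite fmorph_div mulrA divfK // J_neq0 // mm_neq0.
by apply: vmaxM => //; [exact: xc|apply: mW; exact: clt_vmax].
Qed.

Lemma elead_clt x c b : slt x c -> elead x b -> clt b c.
Proof.
move=> xc [xb nxb]; have [e|//|cb] := clt_total b c; first by rewrite e in nxb.
by case: nxb; apply: slt_trans cb; exact: slt_sle.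
Qed.

(** The spectral norm of x is the maximum of the |p_(n-k)|^(1/k), 0 < k <= n; y k represents the
    N-th power of such a term, and c is the exponent of the largest y k. If x^N were larger than mm
    c in some W, dividing the equation of x by x^n would put 1 in the maximal ideal. If x^N / mm c
    were in all maximal ideals, it would have a monic equation with small lower coefficients; x then
    satisfies an equation in x^N divisible by its minimal polynomial P, and Gauss's lemma would make
    the largest y k smaller than mm c. *)
Lemma elead_exists (p : {poly T}) x : x != 0 ->
  p \is monic -> (size p <= m.+2)%N -> (forall i, gn p`_i <= 1) ->
  root (map_poly j (map_poly (@tofrac T) p)) x ->
  (forall q : {poly Q}, root (map_poly j q) x -> map_poly (@tofrac T) p %| q) ->
  exists c, elead x c.
Proof.
move=> x0 pm sp p1 px pmin; pose P := map_poly (@tofrac T) p.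
have Pm : P \is monic by rewrite mapF_monic.
have sP : size P = size p := size_mapF p.
have Pi i : P`_i = tofrac p`_i by rewrite coef_map.
have px' : \sum_(i < size p) j P`_i * x ^+ i = 0.
  rewrite -[RHS](rootP px) horner_coef size_map_poly -/P sP.
  by apply: eq_bigr => i _; rewrite [in RHS]coef_map.
have [n pn] : exists n, size p = n.+1.
  by case E' : (size p) => [|n]; [move: (monic_neq0 pm); rewrite -size_poly_eq0 E'|exists n].
have n0 : (0 < n)%N.
  rewrite lt0n; apply/eqP => n0; move/eqP: px'.
  rewrite pn n0 big_ord1 expr0 mulr1.
  have := monicP Pm; rewrite /lead_coef sP pn n0 /= => ->.
  by rewrite rmorph1 oner_eq0.
have p00 : p`_0 != 0.
  apply/eqP => p00; have XP : 'X %| P.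
    have := dvdp_XsubCl P 0; rewrite polyC0 subr0 => ->.
    by rewrite /root horner_coef0 (Pi 0%N) p00 tofrac0 eqxx.
  have [h PE] := dvdpP _ _ XP.
  have hm : h \is monic by rewrite -(monicMr _ (monicX Q)) -PE.
  have /pmin : root (map_poly j h) x.
    move: px; rewrite -/P PE rmorphM /= map_polyX rootM rootX (negPf x0) orbF //.
  move=> /(dvdp_leq (monic_neq0 hm)); rewrite -/P PE size_mulX ?monic_neq0 //.
  by rewrite ltnn.
have kN k : (0 < k <= n)%N -> (k %| N)%N.
  move=> /andP[k0 kn]; apply: dvdn_fact; rewrite k0 /=.
  by rewrite pn in sp; apply: leq_trans kn _; rewrite -ltnS.
pose y k := p`_(n - k) ^+ (N %/ k).
have y1 k : gn (y k) <= 1 by apply: unormX_le1 => //; exact: unorm_gauss.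
have ns : n \in iota 1 n by rewrite mem_iota n0 add1n ltnS leqnn.
have yn0 : tofrac (y n) != 0 by rewrite tofrac_eq0 /y subnn expf_neq0.
have [k0 [k0s yk0 kmax]] := vring_max vO (y := fun k => tofrac (y k)) ns yn0.
have {}yk0 : y k0 != 0 by rewrite -tofrac_eq0.
have k0n : (0 < k0 <= n)%N by move: k0s; rewrite mem_iota add1n ltnS.
have [c [u1 u2]] := mm_unit yk0 (y1 k0); exists c.
have mc0 : J (mm c) != 0 := J_neq0 (mm_neq0 c).
have yc k : (0 < k <= n)%N -> O (tofrac (y k) / tofrac (mm c)).
  move=> kn; have /kmax h : k \in iota 1 n by rewrite mem_iota add1n ltnS.
  by apply: (vring_div_trans vO _ h u1); rewrite tofrac_eq0.
split=> [W dW|sx].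
  have [vW OW _] := dW; apply: contrapT => nW.
  have mu : vmax W (J (mm c) / x ^+ N).
    by right; rewrite invf_div.
  apply: (vmax1 vW).
  have -> : 1 = - \sum_(i < n) j P`_i * x ^+ i / x ^+ n.
    have xn : x ^+ n != 0 by rewrite expf_neq0.
    rewrite -mulr_suml; apply: (mulIf xn); rewrite mulNr divfK // mul1r.
    apply/eqP; rewrite -addr_eq0 addrC; apply/eqP; rewrite -[RHS]px' pn big_ord_recr /=.
    have := monicP Pm; rewrite /lead_coef sP pn /= => ->.
    by rewrite rmorph1 mul1r.
  apply/vmaxN/vmax_sum => // i _; apply: (@vmax_root _ W vW _ N).
  have kn : (0 < n - i <= n)%N by rewrite subn_gt0 ltn_ord leq_subr.
  have ke : (n - (n - i) = i)%N by rewrite subKn // ltnW.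
  have -> : (j P`_i * x ^+ i / x ^+ n) ^+ N =
      (j (tofrac (y (n - i)%N) / tofrac (mm c)) * (J (mm c) / x ^+ N)) ^+ (n - i).
    have xn : x ^+ n = x ^+ i * x ^+ (n - i) by rewrite -exprD subnKC // ltnW.
    have -> : j P`_i * x ^+ i / x ^+ n = j P`_i / x ^+ (n - i).
      by rewrite xn; field; rewrite !expf_neq0.
    rewrite expr_div_n -exprM mulnC exprM.
    have -> : j P`_i ^+ N = j (tofrac (y (n - i)%N)) ^+ (n - i).
      by rewrite Pi /y ke !rmorphXn -exprM divnK // kN.
    rewrite -expr_div_n fmorph_div; congr (_ ^+ _).
    by rewrite mulrA divfK.
  apply: vmaxX => //; first by case/andP: kn.
  by apply: vmaxM => //; apply: OW; exact: yc.
have [q [qm qx qmax]] := vmax_all_equation vO sx.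
have [r qr] : exists r, size q = r.+1.
  by case E' : (size q) => [|r]; [move: (monic_neq0 qm); rewrite -size_poly_eq0 E'|exists r].
have qtop : q`_r = 1 by have := monicP qm; rewrite /lead_coef qr.
pose mu : Q := tofrac (mm c); have mu0 : mu != 0 by rewrite tofrac_eq0 mm_neq0.
(* G is q with roots multiplied by mu, so that G(X^N) vanishes at x. *)
pose G : {poly Q} := \poly_(l < r.+1) (q`_l * mu ^+ (r - l)).
pose GN := G \Po 'X^N.
have GNE i : GN`_i = if (N %| i)%N then G`_(i %/ N) else 0 by rewrite coef_comp_poly_Xn.
have [Gm sG] : GN \is monic /\ size GN = (N * r).+1.
  apply: monic_of_coef.
    by rewrite GNE dvdn_mulr // mulKn // coef_poly ltnSn subnn qtop mul1r.
  move=> i lt; rewrite GNE; case: ifP => // Ni; rewrite coef_poly ltnNge.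
  by rewrite ltn_divRL // mulnC lt.
have Gx : root (map_poly j GN) x.
  rewrite /root map_comp_poly map_polyXn horner_comp hornerXn.
  have -> : (map_poly j G).[x ^+ N] = J (mm c) ^+ r * (map_poly j q).[x ^+ N / J (mm c)].
    rewrite !horner_coef !size_map_poly qr mulr_sumr.
    have sG' : (size G <= r.+1)%N by exact: size_poly.
    rewrite (big_ord_widen r.+1 (fun i => (map_poly j G)`_i * (x ^+ N) ^+ i) sG').
    rewrite big_mkcond; apply: eq_bigr => l _.
    have -> : (if (l < size G)%N then (map_poly j G)`_l * (x ^+ N) ^+ l else 0) =
              (map_poly j G)`_l * (x ^+ N) ^+ l.
      by case: ltnP => // Gl; rewrite nth_default ?mul0r // size_map_poly.
    rewrite !coef_map /G coef_poly ltn_ord /= rmorphM rmorphXn /=.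
    have -> : J (mm c) ^+ r = J (mm c) ^+ (r - l) * J (mm c) ^+ l.
      by rewrite -exprD subnK // -ltnS.
    by rewrite expr_div_n; field; rewrite expf_neq0.
  by move/rootP: qx => ->; rewrite mulr0.
have [h GNh] := dvdpP _ _ (pmin _ Gx).
have hm : h \is monic by rewrite -(monicMr _ Pm) -GNh.
rewrite mulrC -/P in GNh.
(* For the Gauss norm of radius |mu|^(1/N) the lower terms of [GN] are strictly smaller than its
   leading one, hence the same holds for its factor P. *)
have := @gauss_lemma_strict _ _ vO mu N mu0 N0 P h Pm hm _ (n - k0)%N.
rewrite -GNh sG sP pn /= => H.
have /andP[k00 k0n'] := k0n.
have : vmax O (P`_(n - k0) ^+ N * mu ^+ (n - k0) / mu ^+ n).
  apply: H; last by rewrite ltn_subrL k00 (leq_trans k00).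
  move=> i lt; rewrite GNE; case: ifPn => [Ni|_]; last first.
    by left; rewrite expr0n gtn_eqF // !mul0r.
  have [l iE] : exists l, i = (l * N)%N by exists (i %/ N)%N; rewrite divnK.
  have lr : (l < r)%N by move: lt; rewrite iE mulnC ltn_pmul2l.
  rewrite iE mulnK // coef_poly (leq_trans lr) // (scaled_weight _ _ mu0 (ltnW lr)).
  by apply: vmaxX => //; apply: qmax; rewrite qr.
rewrite (@weight_quotient _ _ (tofrac (y k0)) mu n k0 mu0 k0n'); last first.
  by rewrite Pi /y -!tofracXn -exprM divnK // kN.
move=> /(vmax_root vO) h'.
have yq0 : tofrac (y k0) != 0 by rewrite tofrac_eq0.
have nz : tofrac (y k0) / mu != 0 := mulf_neq0 yq0 (invr_neq0 mu0).
by apply: (vmax_inv nz h'); rewrite (invf_div (tofrac (y k0)) mu).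
Qed.

(** * Reduction by leading forms and generators of S *)

Variable S : set E.
Hypothesis sS : subring S.
Hypothesis DS : forall f, gn f <= 1 -> S (J f).
Hypothesis S_lead : forall x, S x -> x != 0 -> exists c, elead x c.

Local Notation tC := (tateC abs d).

(* The leading form of x is a combination of leading forms of monomial multiples of
   elements of L, whose second components are their leading exponents. *)
Definition reducible (L : seq (E * mindex d.+1)) x c : Prop :=
  exists r (i : 'I_r -> nat) (k : 'I_r -> K) (b : 'I_r -> mindex d.+1),
  (forall a, [/\ (i a < size L)%N, abs (k a) <= 1
    & (nth (0, 0) L (i a)).2 + b a *+ N = c]) /\
  slt (x - \sum_a J (tC (k a) * mm (b a)) * (nth (0, 0) L (i a)).1) c.

Lemma mulrn_inj (a b : mindex d.+1) : a *+ N = b *+ N -> a = b.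
Proof.
move=> /ffunP e; apply/ffunP => i; have := e i; rewrite !ffunMnE.
have nat_mulrn (v k' : nat) : v *+ k' = (v * k')%N.
  by elim: k' => [|k' IH]; rewrite ?muln0 // mulrS IH mulnS.
by rewrite !nat_mulrn => /eqP; rewrite eqn_pmul2r // => /eqP.
Qed.

(* The leading forms of elements with the same leading exponent span a space of
   dimension at most m over the residue field, which bounds the chains of
   irreducible elements. *)
Lemma chain_reducible (x : nat -> E) (c : nat -> mindex d.+1) (phi : nat -> nat) :
  (forall i, elead (x i) (c i)) -> increasing phi ->
  (forall i k, (i <= k)%N -> exists b, c (phi k) = c (phi i) + b *+ N) ->
  exists l, reducible (mkseq (fun i => (x i, c i)) (phi l)) (x (phi l)) (c (phi l)).
Proof.
move=> xc inc dk.
have /choice[B BP] : forall ik : nat * nat, exists b, (ik.1 <= ik.2)%N ->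
    c (phi ik.2) = c (phi ik.1) + b *+ N.
  move=> [i k] /=; have [ik|] := boolP (i <= k)%N; last by exists 0.
  by have [b bE] := dk i k ik; exists b.
(* The first m + 1 members of the chain, shifted to the common exponent e, are linearly dependent
   over Frac T. The relation is scaled to have coefficients in O, one of them 1, and these are then
   replaced by their residues in K. *)
pose e := c (phi m); pose y (i : 'I_m.+1) := J (mm (B (i : nat, m))) * x (phi i).
have ye i : elead (y i) e.
  by rewrite /e (BP (i : nat, m)) /=; [apply: elead_shift|rewrite -ltnS].
have [q [[i0 qi0] q0]] := fin y.
have [i1 [_ qi1 qmax]] := vring_max vO (mem_enum _ i0) qi0.
pose r i := q i / q i1.
have rO i : O (r i) by apply: qmax; rewrite mem_enum.
have r0 : \sum_i j (r i) * y i = 0.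
  have -> : \sum_i j (r i) * y i = (j (q i1))^-1 * \sum_i j (q i) * y i.
    rewrite mulr_sumr; apply: eq_bigr => i _.
    by rewrite fmorph_div mulrAC mulrC.
  by rewrite q0 mulr0.
have /choice[k kP] : forall i, exists k, abs k <= 1 /\ vmax O (r i - tofrac (tC k)).
  by move=> i; exact: OV_residue.
pose ky i := J (tC (k i)) * y i.
have sall : slt (\sum_i ky i) e.
  have -> : \sum_i ky i = \sum_i - (j (r i - tofrac (tC (k i))) * y i).
    transitivity (\sum_i ky i - \sum_i j (r i) * y i); first by rewrite r0 subr0.
    rewrite -sumrB; apply: eq_bigr => i _.
    by rewrite (rmorphB j) mulrBl opprB.
  apply: slt_sum => i _; apply: sltN; apply: slt_vmax; first exact: (kP i).2.
  by have [] := ye i.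
have k1 : abs (k i1) == 1.
  rewrite eq_le (kP i1).1 /= leNgt; apply/negP => /(vmax_OV_tateC d) h.
  apply: (vmax1 vO); have -> : 1 = (r i1 - tofrac (tC (k i1))) + tofrac (tC (k i1)).
    by rewrite subrK /r divff.
  by apply: vmaxD => //; exact: (kP i1).2.
(* l is the last index with nonzero residue, so the l-th element is expressed by earlier ones. The
   factor [mm (B (l, m))], common to the remaining terms, is cancelled by [slt_shift]. *)
case: (arg_maxnP (P := fun i => abs (k i) == 1) (fun i : 'I_m.+1 => i : nat) k1).
move=> l /eqP kl lmax; exists l.
have kl0 : k l != 0 by apply/eqP => k0; move: kl; rewrite k0 absval0 => /esym/eqP; rewrite oner_eq0.
have slow : slt (\sum_(i : 'I_m.+1 | (i <= l)%N) ky i) e.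
  have -> : \sum_(i : 'I_m.+1 | (i <= l)%N) ky i =
      \sum_i ky i - \sum_(i : 'I_m.+1 | ~~ (i <= l)%N) ky i.
    by rewrite [X in _ = X - _](bigID (fun i : 'I_m.+1 => (i <= l)%N)) /= addrK.
  apply: slt_add => //; apply/sltN/slt_sum => i; rewrite -ltnNge => li.
  apply: slt_vmax; last by have [] := ye i.
  apply: vmax_OV_tateC; rewrite lt_neqAle (kP i).1 andbT.
  by apply: contraTN li => /lmax; rewrite -leqNgt.
pose f (i : nat) := tC (k (inord i) / k l) * mm (B (i, l : nat)).
pose w := x (phi l) + \sum_(i < l) J (f i) * x (phi i).
have Bm i : (i <= l)%N -> mm (B (i, m)) = mm (B (l : nat, m)) * mm (B (i, l : nat)).
  move=> il; rewrite -mmD; congr mm; apply: mulrn_inj; apply: (@mindex_addIr _ (c (phi i))).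
  have lm : (l <= m)%N by rewrite -ltnS.
  have h1 := BP (i, m) (leq_trans il lm); have h2 := BP (l : nat, m) lm.
  have h3 := BP (i, l : nat) il; rewrite /= in h1 h2 h3.
  by rewrite mulrnDl addrC -h1 h2 h3 -addrA addrC [_ *+ N + _]addrC.
have wE : J (tC (k l)^-1) * (\sum_(i : 'I_m.+1 | (i <= l)%N) ky i) = J (mm (B (l : nat, m))) * w.
  rewrite (bigD1 l) //= mulrDr [RHS]mulrDr; congr (_ + _).
    by rewrite /ky mulrA -rmorphM -tofracM -rmorphM mulVf // !rmorph1 mul1r.
  rewrite !mulr_sumr.
  rewrite (big_ord_widen m.+1 (fun i => J (mm (B (l : nat, m))) * (J (f i) * x (phi i)))
    (ltnW (ltn_ord l))).
  apply: eq_big => [i|i /andP[il _]].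
    by rewrite ltn_neqAle andbC.
  rewrite /ky /y (Bm i il) /f inord_val [k i / k l]mulrC !rmorphM /=.
  by ring.
have {}slow : slt (J (mm (B (l : nat, m))) * w) e.
  rewrite -wE; apply: slt_scale => //; apply: OV_tateC.
  by rewrite absvalV kl invr1.
have eE : e = c (phi l) + B (l : nat, m) *+ N.
  by apply: (BP (l : nat, m)); rewrite /= -ltnS.
rewrite eE in slow; move/slt_shift: slow => slow.
exists l, (fun a => phi a), (fun a => - (k (inord a) / k l)), (fun a => B (a : nat, l : nat)).
split=> [a|].
  have pal : (phi a < phi l)%N by apply: inc.
  rewrite size_mkseq nth_mkseq //; split=> //; last first.
    by rewrite (BP (a : nat, l : nat)) //= ltnW.
  by rewrite absvalN absvalM absvalV kl invr1 mulr1; exact: (kP _).1.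
have -> : x (phi l) - \sum_(a < l) J (tC (- (k (inord a) / k l)) * mm (B (a : nat, l : nat))) *
    (nth (0, 0) (mkseq (fun i => (x i, c i)) (phi l)) (phi a)).1 = w.
  congr (_ + _); rewrite -sumrN; apply: eq_bigr => a _.
  have pal : (phi a < phi l)%N by apply: inc.
  by rewrite nth_mkseq //= /f rmorphN mulNr !rmorphN mulNr opprK.
exact: slow.
Qed.

(** Otherwise one could keep choosing elements of S not reducible by those chosen before; a chain
    extracted by Dickson's lemma contradicts [chain_reducible]. *)
Lemma finite_reduction : exists L : seq (E * mindex d.+1),
  (forall i, (i < size L)%N -> S (nth (0, 0) L i).1) /\
  forall x c, S x -> elead x c -> reducible L x c.
Proof.
pose good (L : seq (E * mindex d.+1)) :=
  forall i, (i < size L)%N -> S (nth (0, 0) L i).1 /\ elead (nth (0, 0) L i).1 (nth (0, 0) L i).2.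
apply: contrapT => nL.
have /choice[pick pickP] : forall L, exists p : E * mindex d.+1, good L ->
    [/\ S p.1, elead p.1 p.2 & ~ reducible L p.1 p.2].
  move=> L; have [gL|] := pselect (good L); last by exists (0, 0).
  apply: contrapT => nex; apply: nL; exists L; split.
    by move=> i /gL[].
  move=> x c Sx xc; apply: contrapT => nr; apply: nex.
  by exists (x, c) => _.
pose Ls k := iter k (fun L => rcons L (pick L)) [::].
pose u k := pick (Ls k).
have LsE k : Ls k = mkseq u k.
  elim: k => // k IH; rewrite mkseqS -IH //.
have gLs k : good (Ls k).
  elim: k => [|k IH] i //; rewrite /= nth_rcons size_rcons.
  have [ik|ki|->] := ltngtP i (size (Ls k)); first by move=> _; exact: IH.
    by rewrite ltnS leqNgt ki.
  by move=> _; have [] := pickP _ IH.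
have uP k : [/\ S (u k).1, elead (u k).1 (u k).2 & ~ reducible (mkseq u k) (u k).1 (u k).2].
  by rewrite -LsE; exact: pickP.
have [phi [inc dk]] := dickson (fun k => (u k).2) N0.
have [|l] := chain_reducible (x := fun k => (u k).1) (c := fun k => (u k).2) _ inc dk.
  by move=> i; have [] := uP i.
have -> : (fun i => ((u i).1, (u i).2)) = u by apply/funext => i; case: (u i).
by have [] := uP (phi l).
Qed.

(** For the spectral norm this reads |x|^N <= |t|^a, so multiplication by t raises levels by N. *)
Definition level x (a : nat) : Prop :=
  x = 0 \/ exists c, elead x c /\ (a <= c ord0)%N.

Lemma level_add x y (a : nat) : S (x + y) -> level x a -> level y a -> level (x + y) a.
Proof.
move=> Sxy xa ya; have [->|xy0] := eqVneq (x + y) 0; first by left.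
have [c xyc] := S_lead Sxy xy0; right; exists c; split=> //.
rewrite leqNgt; apply/negP => ca; case: (xyc) => _; apply.
have low z : level z a -> slt z c.
  move=> [->|[b [zb ab]]]; first exact: slt0.
  apply: (slt_trans (c := b)); first by case: zb.
  by left; exact: leq_trans ca ab.
by apply: slt_add; apply: low.
Qed.

Lemma level_shift x (a : nat) : S x -> level (J (tC (t ^+ a)) * x) (N * a).
Proof.
move=> Sx; have [->|x0] := eqVneq x 0; first by left; rewrite mulr0.
have [c xc] := S_lead Sx x0; right; exists (c + mcons a 0 *+ N).
have -> : tC (t ^+ a) = mm (mcons a 0).
  by rewrite tateCE /mm mcons0E mtail_cons.
split; first exact: elead_shift.
by rewrite mcons_mulrn ffunE mcons0E -[X in (_ <= X)%N]/(c ord0 + a * N)%N mulnC leq_addl.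
Qed.

Lemma level_inf x : S x -> (forall a, level x a) -> x = 0.
Proof.
move=> Sx xa; apply/eqP; apply: contrapT => /negP x0.
have [c xc] := S_lead Sx x0; have [x0'|[b [xb cb]]] := xa (c ord0).+1.
  by rewrite x0' eqxx in x0.
case: (xc) => _; apply; apply: (slt_trans (c := b)); first by case: xb.
by left.
Qed.

Lemma level_mono x (a b : nat) : (b <= a)%N -> level x a -> level x b.
Proof.
move=> ba [->|[c [xc ac]]]; [by left|right; exists c; split=> //].
exact: leq_trans ac.
Qed.

Section Generators.
Variables (L : seq (E * mindex d.+1)) (A0 : nat).
Hypothesis LS : forall i, (i < size L)%N -> S (nth (0, 0) L i).1.
Hypothesis LA : forall i, (i < size L)%N -> ((nth (0%R, 0%R) L i).2 ord0 <= A0)%N.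
Hypothesis Lred : forall x c, S x -> elead x c -> reducible L x c.
Local Notation s := (size L).
Let g i := (nth (0, 0) L i).1.
Let gU := unorm_gauss d abs_complete.

(** The coefficients met when an exponent with t-component a is reduced: it equals c_i + N b with
    c_i that of a generator, whose t-component is at most A0. So b has t-component at least (a - A0)
    / N, which makes successive corrections converge. *)
Let bounded (a : nat) (f : nat -> T) : Prop := (forall i, gn (f i) <= 1) /\
  forall i (b : nat), (N * b + A0 <= a)%N -> gn (f i) <= abs t ^+ b.

Lemma comb_in (f : nat -> T) : (forall i, gn (f i) <= 1) -> S (\sum_(i < s) J (f i) * g i).
Proof.
move=> f1; apply: (subring_sum sS) => i _; apply: (subringM sS); first exact: DS.
exact: LS.
Qed.

Lemma reduce_step x c : S x -> elead x c -> exists f : nat -> T, bounded (c ord0) f /\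
  slt (x - \sum_(i < s) J (f i) * g i) c.
Proof.
move=> Sx xc; have [r [i [k [b [H sl]]]]] := Lred Sx xc.
pose f n := \sum_(a | i a == n) tC (k a) * mm (b a).
exists f; split; [split=> n|].
- apply: unorm_sum_le => // a _; rewrite gauss_tateC // gauss_mm.
  have [_ k1 _] := H a; rewrite -[leRHS]mulr1 ler_pM ?exprn_ge0 ?absval_ge0 //.
  by rewrite exprn_ile1 ?absval_ge0 // ltW.
- move=> b' Nb; apply: unorm_sum_le => //; first by rewrite exprn_ge0 ?absval_ge0.
  move=> a _; rewrite gauss_tateC // gauss_mm.
  have [ia k1 e] := H a; rewrite -[leRHS]mul1r ler_pM ?exprn_ge0 ?absval_ge0 //.
  apply: ler_wiXn2l; [exact: ltW|exact: ltW|].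
  have LAi := LA ia; have := congr1 (fun c' : mindex d.+1 => c' ord0) e.
  rewrite /= ffunE ffunMnE.
  have nat_mulrn (v k' : nat) : v *+ k' = (v * k')%N.
    by elim: k' => [|k' IH]; rewrite ?muln0 // mulrS IH mulnS.
  rewrite nat_mulrn -[_ + (_ * _)%N]/((nth (0%R, 0%R) L (i a)).2 ord0 + b a ord0 * N)%N => e'.
  have : (N * b' <= b a ord0 * N)%N.
    by rewrite -(leq_add2r A0) (leq_trans Nb) // -e' addnC leq_add2l.
  by rewrite mulnC leq_pmul2r.
have -> : \sum_(n < s) J (f n) * g n = \sum_a J (tC (k a) * mm (b a)) * g (i a).
  transitivity (\sum_(n < s) \sum_(a | i a == n :> nat) J (tC (k a) * mm (b a)) * g n).
    by apply: eq_bigr => n _; rewrite /f !raddf_sum mulr_suml.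
  rewrite (exchange_big_dep xpredT) //=; apply: eq_bigr => a _.
  have [ia _ _] := H a; rewrite (bigD1 (Ordinal ia)) //= big1 ?addr0 // => n.
  move=> /andP[/eqP e ne]; case/eqP: ne; exact/val_inj/esym.
exact: sl.
Qed.

Lemma boundedD a (f f' : nat -> T) : bounded a f -> bounded a f' -> bounded a (fun i => f i + f' i).
Proof.
move=> [f1 f2] [f1' f2']; split=> i; first by apply: (unormD_le gU).
by move=> b h; apply: (unormD_le gU); [exact: f2|exact: f2'].
Qed.

Lemma bounded0 a : bounded a (fun=> 0).
Proof. by split=> *; rewrite (unorm_0 gU) ?exprn_ge0 ?absval_ge0. Qed.

(** Each reduction either raises the power of t or lowers the exponent in z lexicographically, and
    the latter happens only finitely often. *)
Lemma reduce_level (a : nat) (al : mindex d) x : S x -> elead x (mcons a al) ->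
  exists f : nat -> T, bounded a f /\ level (x - \sum_(i < s) J (f i) * g i) a.+1.
Proof.
elim/(well_founded_ind (@mlt_wf d)): al x => al IH x Sx xa.
have [f [fb fs]] := reduce_step Sx xa; rewrite mcons0E in fb.
set x' := x - _ in fs.
have Sx' : S x' by apply: (subringB sS) => //; apply: comb_in; exact: fb.1.
have [x0|x0] := eqVneq x' 0; first by exists f; split=> //; left.
have [c xc] := S_lead Sx' x0.
have := elead_clt fs xc; rewrite /clt mcons0E mtail_cons => -[ac|[ca cal]].
  by exists f; split=> //; right; exists c.
have [f' [fb' fs']] : exists f' : nat -> T, bounded a f' /\
    level (x' - \sum_(i < s) J (f' i) * g i) a.+1.
  by apply: (IH _ cal) => //; rewrite -ca mcons_tail.
exists (fun i => f i + f' i); split; first exact: boundedD.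
have -> : x - \sum_(i < s) J (f i + f' i) * g i = x' - \sum_(i < s) J (f' i) * g i.
  rewrite /x' -addrA -opprD -big_split; congr (_ - _); apply: eq_bigr => i _.
  by rewrite !rmorphD mulrDl.
exact: fs'.
Qed.

(** Successive reductions raise the level, with coefficients tending to 0. The difference between x
    and the limit combination is, for each a, an element of level at least a plus t^a times an
    element of S; having every level, it is 0. *)
Lemma generates x : S x -> exists f : nat -> T, (forall i, gn (f i) <= 1) /\
  x = \sum_(i < s) J (f i) * g i.
Proof.
move=> Sx.
have /choice[F FP] : forall kx : nat * E, exists f : nat -> T, S kx.2 -> level kx.2 kx.1 ->
    bounded kx.1 f /\ level (kx.2 - \sum_(i < s) J (f i) * g i) kx.1.+1.
  move=> [k y] /=; have [[Sy ly]|h] := pselect (S y /\ level y k); last first.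
    by exists (fun=> 0) => Sy ly; case: h.
  have zero : level y k.+1 -> exists f : nat -> T, S y -> level y k ->
      bounded k f /\ level (y - \sum_(i < s) J (f i) * g i) k.+1.
    move=> l1; exists (fun=> 0) => _ _; split; first exact: bounded0.
    by rewrite big1 ?subr0 // => i _; rewrite !rmorph0 mul0r.
  case: (ly) => [y0|[c [yc]]]; first by apply: zero; left.
  rewrite leq_eqVlt => /orP[/eqP e|lt]; last by apply: zero; right; exists c.
  have [|f H] := @reduce_level k (mtail c) y Sy; first by rewrite e mcons_tail.
  by exists f.
pose xs := fix xs (k : nat) : E := if k is k'.+1 then
  xs k' - \sum_(i < s) J (F (k', xs k') i) * g i else x.
have xsP k : S (xs k) /\ level (xs k) k.
  elim: k => [|k [Sk lk]] /=.
    split=> //; have [->|x0] := eqVneq x 0; first by left.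
    by have [c xc] := S_lead Sx x0; right; exists c.
  have [[f1 _] l] := FP (k, xs k) Sk lk; split=> //.
  by apply: (subringB sS) => //; exact: comb_in.
pose G k := F (k, xs k).
have GP k : bounded k (G k) by have [Sk lk] := xsP k; have [] := FP (k, xs k) Sk lk.
have xsE k : x = xs k + \sum_(i < s) J (\sum_(l < k) G l i) * g i.
  elim: k => [|k IH].
    rewrite big1 ?addr0 // => i _; by rewrite big_ord0 !rmorph0 mul0r.
  rewrite {1}IH /= -addrA; congr (_ + _); rewrite addrC -sumrB.
  apply: eq_bigr => i _; rewrite big_ord_recr /= !rmorphD /=.
  by rewrite mulrDl addrK.
have Gnull i : null_seq gn (fun k => G k i).
  move=> e e0; have [b be] := geom_small 1 (ltW at0) t1 e0.
  exists (N * b + A0)%N => k kb; rewrite subr0.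
  by apply: le_lt_trans be; rewrite mul1r; have [_] := GP k; apply.
pose f i := ssum gn (fun k => G k i).
have f1 i : gn (f i) <= 1.
  by apply: (ssum_le gU) => // k; have [] := GP k.
exists f; split=> //; apply/eqP; rewrite -subr_eq0; apply/eqP.
set z := x - _; have Sz : S z by apply: (subringB sS) => //; exact: comb_in.
(* From N a + A0 <= k the tails of the coefficients are at most |t|^a; from a <= k the remainder
   [xs k] has level at least a. *)
apply: level_inf => // a; pose k := (N * a + A0 + a)%N.
pose tl i := f i - \sum_(l < k) G l i.
have tlb i : gn (tl i) <= abs t ^+ a.
  apply: (cvg_for_le gU (null_summable gU (Gnull i))); exists k => l kl.
  rewrite -!(big_mkord xpredT (fun l => G l i)) (big_cat_nat (leq0n k) kl) /= addrAC subrr add0r.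
  rewrite big_nat_cond; apply: unorm_sum_le => //; first by rewrite exprn_ge0 ?absval_ge0.
  move=> n /andP[/andP[kn _] _]; have [_] := GP n; apply.
  by apply: leq_trans kn; rewrite /k leq_addr.
pose h i := tC (t ^+ a)^-1 * tl i.
have h1 i : gn (h i) <= 1.
  rewrite gauss_tateC // absvalV absvalX mulrC ler_pdivrMr ?exprn_gt0 //.
  by rewrite mul1r.
have tlE i : tl i = tC (t ^+ a) * h i.
  by rewrite mulrA -rmorphM mulfV ?expf_neq0 // rmorph1 mul1r.
have zE : z = xs k + J (tC (t ^+ a)) * - (\sum_(i < s) J (h i) * g i).
  rewrite /z {1}(xsE k) -addrA; congr (_ + _).
  rewrite mulrN mulr_sumr -sumrB -sumrN; apply: eq_bigr => i _.
  rewrite -mulrBl mulrA -rmorphM -tofracM -tlE /tl tofracB rmorphB.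
  by rewrite -mulNr opprB.
rewrite zE; apply: level_add; first by rewrite -zE.
  apply: (level_mono (a := k)); last by have [] := xsP k.
  by rewrite /k leq_addl.
apply: (level_mono (a := (N * a)%N)); first exact: leq_pmull.
by apply: level_shift; apply: (subringN sS); exact: comb_in.
Qed.

End Generators.

Theorem finitely_generated : exists s (g : nat -> E),
  (forall i, (i < s)%N -> S (g i)) /\
  forall x, S x -> exists f : nat -> T, (forall i, gn (f i) <= 1) /\
    x = \sum_(i < s) J (f i) * g i.
Proof.
have [L [LS Lred]] := finite_reduction.
exists (size L), (fun i => (nth (0, 0) L i).1); split=> // x Sx.
apply: (@generates L (\max_(i < size L) (nth (0%R, 0%R) L i).2 ord0)) => //.
move=> i iL; exact: (leq_bigmax (Ordinal iL) (F := fun i => (nth (0%R, 0%R) L (val i)).2 ord0)).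
Qed.

Lemma separated_by_level x : S x ->
  (forall a, exists2 y, S y & x = J (tC (t ^+ a)) * y) -> x = 0.
Proof.
move=> Sx H; apply: level_inf => // a; have [y Sy ->] := H a.
by apply: (level_mono (a := (N * a)%N)); [exact: leq_pmull|exact: level_shift].
Qed.

End SpectralOrder.

(** * Minimal polynomials *)

Lemma frac_lift (D : idomainType) (L : fieldType) (h : {rmorphism D -> L}) :
  injective h ->
  exists j : {rmorphism {fraction D} -> L}, forall x, j (tofrac x) = h x.
Proof.
move=> hinj.
have h0 x : x != 0 -> h x != 0 by rewrite -(inj_eq hinj) rmorph0.
have /choice[ab abP] : forall q : {fraction D}, exists ab : D * D,
    ab.2 != 0 /\ q = tofrac ab.1 / tofrac ab.2.
  by move=> q; have [a [b abq]] := fracE q; exists (a, b).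
pose j q := h (ab q).1 / h (ab q).2.
have jE a b : b != 0 -> j (tofrac a / tofrac b) = h a / h b.
  move=> b0; rewrite /j; have [] := abP (tofrac a / tofrac b).
  move: (ab _) => [c d] /= d0 /eqP.
  rewrite eqr_div ?tofrac_eq0 // -!tofracM (inj_eq (@tofrac_inj D)) => /eqP e.
  by apply/eqP; rewrite eqr_div ?h0 // -!rmorphM; apply/eqP; rewrite e.
have jB : zmod_morphism j.
  move=> x y; have [a [b [b0 ->]]] := fracE x; have [c [d [d0 ->]]] := fracE y.
  rewrite -mulNr addf_div ?tofrac_eq0 // mulNr -!tofracM -tofracB !jE ?mulf_neq0 //.
  by rewrite rmorphB !rmorphM -[X in _ = _ + X]mulNr addf_div ?h0 // mulNr.
have jM : monoid_morphism j.
  split=> [|x y]; first by rewrite -[1]divr1 -tofrac1 jE ?oner_neq0 // rmorph1 divr1.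
  have [a [b [b0 ->]]] := fracE x; have [c [d [d0 ->]]] := fracE y.
  by rewrite mulf_div -!tofracM !jE ?mulf_neq0 // !rmorphM mulf_div.
pose A1 := GRing.isZmodMorphism.Build _ _ j jB.
pose A2 := GRing.isMonoidMorphism.Build _ _ j jM.
pose jR : {rmorphism {fraction D} -> L} := HB.pack j A1 A2.
exists jR => x; rewrite /= -[tofrac x]divr1 -tofrac1 jE ?oner_neq0 //.
by rewrite rmorph1 divr1.
Qed.

(** After multiplication by a common denominator the elements lie in A, and the matrix of their
    coordinates has one row more than columns. *)
Lemma finite_over_span (D A : idomainType) (chi : {rmorphism D -> A})
    (j : {rmorphism {fraction D} -> {fraction A}}) (I : finType) (b : I -> A) :
  (forall x, j (tofrac x) = tofrac (chi x)) ->
  (forall x, exists k : I -> D, x = \sum_i chi (k i) * b i) ->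
  finite_over j #|I|.
Proof.
move=> jE span y.
have /choice[as_ asP] : forall i, exists ac : A * A, ac.2 != 0 /\ y i = tofrac ac.1 / tofrac ac.2.
  by move=> i; have [a [c ac]] := fracE (y i); exists (a, c).
pose s := \prod_i (as_ i).2.
have s0 : s != 0 by apply/prodf_neq0 => i _; case: (asP i).
have ys i : exists a, y i * tofrac s = tofrac a.
  exists ((as_ i).1 * \prod_(l | l != i) (as_ l).2).
  have [a0 ->] := asP i; rewrite /s (bigD1 i) //= !tofracM.
  by rewrite mulrA divfK // tofrac_eq0.
have /choice[a aE] := ys.
have /choice[k kE] := fun i => span (a i).
pose M : 'M[{fraction D}]_(#|I|.+1, #|I|) := \matrix_(i, l) tofrac (k i (enum_val l)).
have : kermx M != 0.
  rewrite -mxrank_eq0 mxrank_ker subn_eq0 -ltnNge ltnS; exact: rank_leq_col.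
move=> /rowV0Pn[v /sub_kermxP vM v0].
have [i0 vi0] : exists i, v 0 i != 0.
  apply: contrapT => nv; case/eqP: v0; apply/rowP => i; rewrite mxE.
  by apply/eqP; apply: contrapT => /negP vi; apply: nv; exists i.
exists (fun i => v 0 i); split; first by exists i0.
apply: (@mulIf _ (tofrac s)); first by rewrite tofrac_eq0.
rewrite mul0r mulr_suml.
transitivity (\sum_i \sum_(l < #|I|) j (v 0 i * M i l) * tofrac (b (enum_val l))).
  apply: eq_bigr => i _; rewrite -mulrA aE kE raddf_sum mulr_sumr.
  have := big_enum_val (A := predT) (fun l : I => j (v 0 i * tofrac (k i l)) * tofrac (b l)).
  rewrite (eq_bigl xpredT) // => e; under [RHS]eq_bigr => l _ do rewrite mxE.
  rewrite -e; apply: eq_bigr => l _.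
  by rewrite (rmorphM j) jE -mulrA -tofracM.
rewrite exchange_big big1 //= => l _; rewrite -mulr_suml -(rmorph_sum j).
have := congr1 (fun m : 'rV_ _ => m 0 l) vM; rewrite !mxE => ->.
by rewrite rmorph0 mul0r.
Qed.

Lemma minimal_polynomial (F E : fieldType) (j : {rmorphism F -> E}) m (x : E) :
  finite_over j m -> exists p : {poly F},
  [/\ p \is monic, (size p <= m.+1)%N, root (map_poly j p) x
    & forall q, root (map_poly j q) x -> p %| q].
Proof.
move=> fin; pose P n := `[< exists p : {poly F},
  [/\ p != 0, size p = n & root (map_poly j p) x] >].
have Pm : exists2 n, P n & (n <= m.+1)%N.
  have [c [[i ci] c0]] := fin (fun i => x ^+ i).
  pose p := \poly_(i < m.+1) c (inord i).
  exists (size p); last exact: size_poly.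
  apply/asboolP; exists p; split=> //.
    apply/eqP => /(congr1 (fun q : {poly F} => q`_i)).
    by rewrite coef_poly ltn_ord inord_val coef0 => /eqP; rewrite (negPf ci).
  rewrite /root (@horner_coef_wide _ m.+1) ?size_map_poly ?size_poly //.
  apply/eqP; rewrite -[RHS]c0; apply: eq_bigr => l _.
  by rewrite coef_map coef_poly ltn_ord inord_val.
have [n0 Pn0 n0m] := Pm; have Pex : exists n, P n by exists n0.
case: (ex_minnP Pex) => n /asboolP[p [p0 sp px]] nmin.
have lp : (lead_coef p)^-1 != 0 by rewrite invr_eq0 lead_coef_eq0.
exists ((lead_coef p)^-1 *: p); split.
- by rewrite monicE lead_coefZ mulVf // lead_coef_eq0.
- by rewrite size_scale // sp (leq_trans _ n0m) // nmin.
- by rewrite map_polyZ /root hornerZ (rootP px) mulr0.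
move=> q qx; rewrite dvdpZl //; apply/modp_eq0P/eqP; apply: contrapT => /negP r0.
have : (n <= size (q %% p)%R)%N.
  apply: nmin; apply/asboolP; exists (q %% p); split=> //.
  move: qx; rewrite {1}(divp_eq q p) rmorphD rmorphM /=.
  by rewrite /root hornerD hornerM (rootP px) mulr0 add0r.
by rewrite leqNgt -sp ltn_modp p0.
Qed.

(** u clears denominators: u x satisfies a monic equation with coefficients u^(n-i) p_i in W, and
    valuation rings are integrally closed. *)
Lemma vring_integral_scale (F : fieldType) (W : set F) (p : {poly F}) (u x : F) :
  vring W -> p \is monic -> W u -> (forall i, (i < (size p).-1)%N -> W (u * p`_i)) ->
  root p x -> W (u * x).
Proof.
move=> vW pm Wu up px; apply: contrapT => nW.
have ux0 : u * x != 0 by apply/eqP => e; apply: nW; rewrite e; exact: subring0 (vring_subring vW).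
have /andP[u0 x0] : (u != 0) && (x != 0) by rewrite -negb_or -mulf_eq0.
have mu : vmax W (u * x)^-1 by right; rewrite invrK.
have [n pn] : exists n, size p = n.+1.
  by case E' : (size p) => [|n]; [move: (monic_neq0 pm); rewrite -size_poly_eq0 E'|exists n].
apply: (vmax1 vW).
have -> : 1 = - \sum_(i < n) p`_i * x ^+ i / x ^+ n.
  have xn : x ^+ n != 0 by rewrite expf_neq0.
  rewrite -mulr_suml; apply: (mulIf xn); rewrite mulNr divfK // mul1r.
  apply/eqP; rewrite -addr_eq0 addrC; apply/eqP; rewrite -[RHS](rootP px) horner_coef pn.
  by rewrite big_ord_recr /=; have := monicP pm; rewrite /lead_coef pn /= => ->; rewrite mul1r.
apply/(vmaxN vW)/(vmax_sum vW) => i _.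
have -> : p`_i * x ^+ i / x ^+ n = (u * p`_i) * u ^+ (n - i).-1 * (u * x)^-1 ^+ (n - i).
  have in0 : (0 < n - i)%N by rewrite subn_gt0.
  have -> : x ^+ n = x ^+ i * x ^+ (n - i) by rewrite -exprD subnKC // ltnW.
  rewrite -[in RHS](prednK in0) exprVn exprMn -[in u ^+ _.+1](prednK in0) [u ^+ _.+1]exprS.
  by rewrite prednK //; field; rewrite u0 !expf_neq0.
have sW := vring_subring vW.
apply: (vmaxM vW); last by apply: (vmaxX vW) => //; rewrite subn_gt0.
by apply: (subringM sW); [apply: up; rewrite pn|exact: subringX].
Qed.

(** Either x is integral over the ring of lam, and Gauss's lemma passes from its equation to the
    factor p, or some valuation of E is negative at x. *)
Lemma minimal_polynomial_coef (F E : fieldType) (j : {rmorphism F -> E}) m (x : E)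
    (p : {poly F}) (lam : F -> int) :
  finite_over j m -> p \is monic -> (forall q, root (map_poly j q) x -> p %| q) ->
  (forall lam', rval lam' -> rval_ring lam' x) -> rval lam ->
  forall i, rval_ring lam p`_i.
Proof.
move=> fin pm pmin xO lamP.
have [[q [qm qx qO]]|] := pselect (exists q : {poly F}, [/\ q \is monic,
    root (map_poly j q) x & forall i, rval_ring lam q`_i]).
  have [h qE] := dvdpP _ _ (pmin _ qx); rewrite mulrC in qE.
  have hm : h \is monic by rewrite -(monicMl _ pm) -qE.
  move=> i; have := @gauss_lemma _ _ (vring_rval lamP) 1 1 (oner_neq0 _) isT p h pm hm _ i.
  rewrite !expr1n !mulr1 !divr1 expr1; apply => l; rewrite !expr1n !mulr1 ?divr1 ?expr1 -qE.
  exact: qO.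
move=> /(rval_extension fin lamP)[lam' [lamP' x0 neg]].
by have := xO _ lamP' x0; rewrite leNgt neg.
Qed.

(** * Elements integral for all discrete valuations *)

Lemma ler_iXz2l (F : realFieldType) (r : F) : 0 < r -> r < 1 ->
  {mono exprz r : y z /~ y <= z}.
Proof.
move=> r0 r1 y z; rewrite -(opprK y) -(opprK z) -!(exprz_inv r) ler_eXz2l ?lerN2 //.
by rewrite invf_gt1.
Qed.

Section RationalValuationIntegers.
Variables (R : realType) (K : fieldType) (abs : nonarch_absval R K).
Hypothesis abs_nontrivial : nontrivial_absval abs.
Hypothesis abs_complete : complete_for abs.

(** The intersection of the theorem, by [bigcap_valuation_ring]. Valuations need not be surjective
    here, so restrictions and scaled extensions qualify directly. *)
Definition rint (F : fieldType) : set F :=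
  [set x | forall lam, rval lam -> rval_ring lam x].

Lemma subring_rint (F : fieldType) : subring (@rint F).
Proof.
have sub lam := fun lamP : rval lam => vring_subring (@vring_rval F lam lamP).
split=> [lam /sub sW|x y xO yO lam lamP|x y xO yO lam lamP].
- exact: subring1 sW.
- exact: (subringB (sub _ lamP)) (xO _ lamP) (yO _ lamP).
- exact: (subringM (sub _ lamP)) (xO _ lamP) (yO _ lamP).
Qed.

Lemma bigcap_valuation_ring (F : fieldType) :
  \bigcap_(v in @discrete_valuations F) valuation_ring v = @rint F.
Proof.
apply/seteqP; split=> x /= xO.
  move=> lam lamP x0; rewrite leNgt; apply/negP => neg.
  have [v vP vE] := rval_normalize lamP x0 (ltr0_neq0 neg).
  by have := xO v vP; rewrite /valuation_ring /= vE // leNgt neg.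
move=> v vP; have [vE0 [lam [lamP vE _]]] := (vP, discrete_valuations_rval vP).
rewrite /valuation_ring /=; have [->|x0] := eqVneq x 0.
  by case: vE0 => _ v0 _ _; rewrite (v0 0).2.
by rewrite vE // lee_fin; exact: xO.
Qed.

Lemma rint_bounded (C : comNzRingType) (N : C -> R) (iota : {rmorphism K -> C})
    (F : fieldType) (h : {rmorphism C -> F}) (x : C) (M : R) : unorm N ->
  (forall c x, N (iota c * x) = abs c * N x) -> (forall k, N (x ^+ k) <= M) ->
  rint (h x).
Proof.
move=> uN Nc xM lam lamP hx; exact: (rval_ge0_bounded abs_nontrivial uN Nc lamP xM).
Qed.

Lemma rint_gauss n (F : fieldType) (h : {rmorphism tate abs n -> F}) f :
  gauss_norm f <= 1 -> rint (h f).
Proof.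
move=> f1; have gU := unorm_gauss n abs_complete.
apply: (rint_bounded (iota := tateC abs n) (M := 1) gU).
  exact: gauss_tateC.
by move=> k; exact: unormX_le1.
Qed.

(** Let v be the normalized restriction of lam to K; its ring contains O_K. If |x| > 1 and v x >= 0,
    choose b with v b < 0: for large k the element b x^-k lies in O_K but has negative value. So the
    two rings agree. *)
Lemma rval_scalar (F : fieldType) (h : {rmorphism K -> F}) (lam : F -> int) c :
  rval lam -> c != 0 -> lam (h c) != 0 -> discretely_valued abs.
Proof.
move=> lamP c0 lc0; have uabs := unorm_absval abs_complete.
have lamP' : rval (lam \o h) by apply: rval_comp lamP; exact: fmorph_inj.
have pos x : x != 0 -> abs x <= 1 -> 0 <= lam (h x).
  move=> x0 x1; suff /(_ _ lamP) : rint (h x) by apply; rewrite fmorph_eq0.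
  apply: (rint_bounded (iota := idfun) (M := 1) uabs) => [a b|k].
    by rewrite absvalM.
  by rewrite absvalX exprn_ile1 ?absval_ge0.
have [v vP vE] := rval_normalize lamP' c0 lc0.
exists v => //; apply/seteqP; split=> x; rewrite /ring_of_integers /valuation_ring /=.
  have [->|x0] := eqVneq x 0; first by case: vP => _ v0 _ _; rewrite (v0 0).2.
  by move=> x1; rewrite vE //=; exact: pos.
have [->|x0] := eqVneq x 0; first by rewrite absval0 ler01.
rewrite vE //= => lx; rewrite leNgt; apply/negP => x1.
have [b [b0 lb]] : exists b, b != 0 /\ lam (h b) < 0.
  have [lt|] := ltP (lam (h c)) 0; first by exists c.
  rewrite le_eqVlt eq_sym (negPf lc0) /= => lt; exists c^-1; rewrite invr_eq0; split=> //.
  by rewrite fmorphV (rvalV lamP) ?fmorph_eq0 // oppr_lt0.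
have ax : abs x^-1 < 1 by rewrite absvalV invf_lt1 // (lt_trans ltr01).
have [k kb] := geom_small (abs b) (absval_ge0 abs _) ax ltr01.
have h0 y : y != 0 -> h y != 0 by rewrite fmorph_eq0.
have : 0 <= lam (h (b * x^-1 ^+ k)).
  by apply: pos; [rewrite mulf_neq0 ?expf_neq0 ?invr_eq0|rewrite absvalM absvalX ltW].
rewrite rmorphM rmorphXn (rvalM lamP) ?expf_neq0 ?h0 ?invr_eq0 //.
rewrite (rvalX lamP) ?h0 ?invr_eq0 // fmorphV (rvalV lamP) ?h0 // mulNrn subr_ge0.
by move=> /(le_trans (mulrn_wge0 k lx)); rewrite leNgt lb.
Qed.

Lemma absvalXz c (z : int) : abs (c ^ z) = abs c ^ z.
Proof. by case: z => k; rewrite ?NegzE -?exprnP -?exprnN ?absvalV absvalX. Qed.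

Lemma uniformizer : discretely_valued abs -> exists t,
  [/\ t != 0, abs t < 1 & forall c, c != 0 -> exists z : int, abs c = abs t ^ z].
Proof.
move=> [v vP vE]; have [lam [lamP lamE [t t0 lt]]] := discrete_valuations_rval vP.
have absE c : c != 0 -> (abs c <= 1) = (0 <= lam c).
  move=> c0; rewrite -[RHS]lee_fin -lamE //; apply/idP/idP => h.
    by have : valuation_ring v c by rewrite -vE.
  by have : ring_of_integers abs c by rewrite vE.
have lX c (z : int) : c != 0 -> lam (c ^ z) = lam c * z.
  move=> c0; case: z => k; rewrite ?NegzE.
    by rewrite -exprnP (rvalX lamP) // -mulr_natr natz.
  by rewrite -exprnN (rvalV lamP) ?expf_neq0 // (rvalX lamP) // -mulr_natr natz mulrN.
have t1 : abs t < 1.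
  rewrite ltNge; apply/negP => h; have : abs t^-1 <= 1.
    by rewrite absvalV invf_le1 // absval_gt0.
  by rewrite absE ?invr_eq0 // (rvalV lamP) // lt.
exists t; split=> // c c0; exists (lam c).
have at0 : 0 < abs t ^ lam c by rewrite exprz_gt0 // absval_gt0.
have tz : t ^ lam c != 0 by rewrite expfz_neq0.
have q0 : c / t ^ lam c != 0 by rewrite mulf_neq0 ?invr_eq0.
have lq : lam (c / t ^ lam c) = 0.
  by rewrite (rvalM lamP) ?invr_eq0 // (rvalV lamP) // lX // lt mul1r subrr.
have : abs (c / t ^ lam c) == 1.
  rewrite eq_le absE // lq lexx /= -invf_le1 ?absval_gt0 // -absvalV absE ?invr_eq0 //.
  by rewrite (rvalV lamP) // lq.
by rewrite absvalM absvalV absvalXz => /eqP e; rewrite -[LHS](divfK (lt0r_neq0 at0)) e mul1r.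
Qed.

Lemma gauss_rval (t : K) n : t != 0 -> abs t < 1 ->
  (forall c, c != 0 -> exists z : int, abs c = abs t ^ z) ->
  exists lam : tate abs n -> int, rval lam /\
    forall f, f != 0 -> gauss_norm f = abs t ^ lam f.
Proof.
move=> t0 t1 tP; have at0 := absval_gt0 abs t0.
have /choice[lam lamE] : forall f : tate abs n, exists z : int,
    f != 0 -> gauss_norm f = abs t ^ z.
  move=> f; have [->|f0] := eqVneq f 0; first by exists 0 => /eqP.
  have [a la] := lead_exists f0; have [fa0 _ _] := la.
  by have [z zE] := tP _ fa0; exists z => _; rewrite (lead_gauss la).
have le_exp (y z : int) : (abs t ^ y <= abs t ^ z) = (z <= y).
  exact: ler_iXz2l.
have inj (y z : int) : abs t ^ y = abs t ^ z -> y = z.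
  by move=> e; apply/eqP; rewrite eq_le -!le_exp e lexx.
exists lam; split=> //; split=> [f g f0 g0|f g f0 g0 fg0].
  apply: inj; rewrite -lamE ?mulf_neq0 // gaussM !lamE // -expfzDr //.
  exact: lt0r_neq0.
rewrite ge_min -!le_exp -!lamE // -le_max; exact: (unormD (unorm_gauss n abs_complete)).
Qed.

Lemma rint_minimal_polynomial d (E : fieldType)
    (j : {rmorphism {fraction tate abs d} -> E}) m x :
  finite_over j m -> rint x -> exists p : {poly tate abs d},
  [/\ p \is monic, (size p <= m.+1)%N,
      root (map_poly j (map_poly (@tofrac _) p)) x,
      forall q, root (map_poly j q) x -> map_poly (@tofrac _) p %| q
    & forall lam, rval lam -> forall i, rval_ring lam (tofrac p`_i)].
Proof.
move=> fin xO; have [P [Pm sP Px Pmin]] := minimal_polynomial x fin.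
have PO lam (lamP : rval lam) i : rval_ring lam P`_i.
  exact: (minimal_polynomial_coef fin Pm Pmin xO lamP).
have /choice[c cE] : forall i, exists c, P`_i = tofrac c.
  move=> i; apply: (separated_coef (separated_tate abs_complete (n := d))).
  by move=> lam lamP _; exact: PO.
pose p := \poly_(i < size P) c i.
have PE : map_poly (@tofrac _) p = P.
  apply/polyP => i; rewrite coef_map coef_poly.
  by case: ltnP => [_|iP]; [rewrite /= -cE|rewrite /= tofrac0 nth_default].
exists p; split.
- by rewrite -mapF_monic PE.
- by rewrite -size_mapF PE.
- rewrite PE; exact: Px.
- rewrite PE; exact: Pmin.
- move=> lam lamP i; have := PO _ lamP i.
  by rewrite -PE coef_map.
Qed.

End RationalValuationIntegers.

(** * Gauge norms *)

Section GaugeNorm.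
Variables (R : realType) (r : R) (E : fieldType) (S : set E) (tau : E).
Hypotheses (r0 : 0 < r) (r1 : r < 1) (sS : subring S).
Hypotheses (tau0 : tau != 0) (Stau : S tau).
Hypothesis S_sep : forall x, S x -> (forall a : nat, S (x / tau ^+ a)) -> x = 0.
Implicit Types (x y : E) (w z : int).

(** Membership in S[1/tau]. *)
Definition gauge_bounded x : Prop := exists k : nat, S (tau ^+ k * x).

(* |x| = r^z for the largest z with x in tau^z S. *)
Definition gauge x : R :=
  if x == 0 then 0 else r ^ xget 0 [set z | forall w, S (x * tau ^ (- w)) <-> w <= z].

Lemma gauge0 : gauge 0 = 0. Proof. by rewrite /gauge eqxx. Qed.

Lemma gauge_down x w w' : w' <= w -> S (x * tau ^ (- w)) -> S (x * tau ^ (- w')).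
Proof.
move=> ww' Sx; have -> : x * tau ^ (- w') = x * tau ^ (- w) * tau ^ (w - w').
  by rewrite -mulrA -expfzDr // addrA addNr sub0r.
apply: (subringM sS) => //; have : 0 <= w - w' by rewrite subr_ge0.
by case: (w - w') => // k _; exact: subringX.
Qed.

Lemma gauge_value x : gauge_bounded x -> x != 0 -> exists z,
  gauge x = r ^ z /\ forall w, S (x * tau ^ (- w)) <-> w <= z.
Proof.
move=> [k Sk] x0; pose Z : set int := [set z | forall w, S (x * tau ^ (- w)) <-> w <= z].
suff zex : exists z, Z z.
  by exists (xget 0 Z); rewrite /gauge (negPf x0); split=> //; exact: (xgetPex 0 zex).
have y0 : tau ^+ k * x != 0 by rewrite mulf_neq0 ?expf_neq0.
have yE (a : nat) : tau ^+ k * x / tau ^+ a = x * tau ^ (- (a%:Z - k%:Z)).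
  by rewrite opprB expfzDr // -exprnN -exprnP mulrCA mulrA.
have nall : exists a, ~~ `[< S (tau ^+ k * x / tau ^+ a) >].
  apply: contrapT => all; case/eqP: y0; apply: S_sep => // a.
  by apply: contrapT => na; apply: all; exists a; apply/asboolPn.
case: (ex_minnP nall) => -[|a] /asboolPn na amin.
  by case: na; rewrite divr1.
have Sa : S (tau ^+ k * x / tau ^+ a).
  by apply: contrapT => /asboolPn/amin; rewrite ltnn.
exists (a%:Z - k%:Z) => w; split=> [Sw|lw]; last by apply: (gauge_down lw); rewrite -yE.
rewrite leNgt; apply/negP => lt; apply: na; rewrite yE; apply: gauge_down Sw.
by move: lt; clear; lia.
Qed.

Lemma gauge_le x w : gauge_bounded x -> gauge x <= r ^ w <-> S (x * tau ^ (- w)).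
Proof.
move=> bx; have [->|x0] := eqVneq x 0.
  rewrite gauge0 mul0r exprz_ge0 ?ltW //.
  by split=> // _; exact: subring0.
by have [z [-> zP]] := gauge_value bx x0; rewrite ler_iXz2l // zP.
Qed.

Lemma gauge_eq0 x : gauge_bounded x -> gauge x = 0 <-> x = 0.
Proof.
move=> bx; split=> [|->]; last exact: gauge0.
have [//|x0] := eqVneq x 0; have [z [-> _]] := gauge_value bx x0 => /eqP.
by rewrite expfz_eq0 (gt_eqF r0) andbF.
Qed.

Lemma gauge_boundedD x y : gauge_bounded x -> gauge_bounded y -> gauge_bounded (x + y).
Proof.
move=> [k Sx] [l Sy]; exists (k + l)%N; rewrite mulrDr; apply: (subringD sS).
  by rewrite exprD mulrAC mulrC; apply: (subringM sS) => //; exact: subringX.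
by rewrite exprD -mulrA; apply: (subringM sS) => //; exact: subringX.
Qed.

Lemma gauge_boundedM x y : gauge_bounded x -> gauge_bounded y -> gauge_bounded (x * y).
Proof.
move=> [k Sx] [l Sy]; exists (k + l)%N; rewrite exprD mulrACA.
exact: subringM.
Qed.

Lemma gauge_sub x : S x -> gauge_bounded x.
Proof. by move=> Sx; exists 0%N; rewrite mul1r. Qed.

Lemma gauge_le1 x : gauge_bounded x -> gauge x <= 1 <-> S x.
Proof. by move=> bx; rewrite -[1](expr0z r) gauge_le // oppr0 expr0z mulr1. Qed.

Lemma gaugeN x : gauge (- x) = gauge x.
Proof.
rewrite /gauge oppr_eq0; case: eqP => // _; congr (_ ^ xget _ _).
apply/seteqP; split=> z zP w; rewrite -zP mulNr;
  by split=> /(subringN sS); rewrite ?opprK.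
Qed.

Lemma gaugeD x y : gauge_bounded x -> gauge_bounded y ->
  gauge (x + y) <= Num.max (gauge x) (gauge y).
Proof.
move=> bx by_; wlog xy : x y bx by_ / gauge x <= gauge y.
  move=> wl; have [xy|yx] := leP (gauge x) (gauge y).
    by rewrite -[leRHS](max_r xy); exact: wl.
  by rewrite addrC -[leRHS](max_r (ltW yx)); apply: wl => //; exact: ltW.
rewrite le_max; apply/orP; right; have [y0|y0] := eqVneq y 0.
  rewrite y0 gauge0 in xy *; rewrite addr0; exact: xy.
have [z [yE _]] := gauge_value by_ y0; rewrite yE.
apply/gauge_le; first exact: gauge_boundedD.
by rewrite mulrDl; apply: (subringD sS); apply/gauge_le; rewrite -?yE.
Qed.

Lemma gaugeM_le x y : gauge_bounded x -> gauge_bounded y ->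
  gauge (x * y) <= gauge x * gauge y.
Proof.
move=> bx by_; have [->|x0] := eqVneq x 0; first by rewrite !mul0r gauge0 mul0r.
have [->|y0] := eqVneq y 0; first by rewrite !mulr0 gauge0 mulr0.
have [z [xE zP]] := gauge_value bx x0; have [w [yE wP]] := gauge_value by_ y0.
rewrite xE yE -expfzDr ?lt0r_neq0 //; apply/gauge_le; first exact: gauge_boundedM.
rewrite opprD expfzDr // mulrACA; apply: (subringM sS); [exact/zP|exact/wP].
Qed.

Lemma gauge1 : gauge 1 = 1.
Proof.
have S1 := subring1 sS; have b1 := gauge_sub S1.
have [z [zE zP]] := gauge_value b1 (oner_neq0 _).
have z0 : 0 <= z by apply/zP; rewrite oppr0 expr0z mulr1.
have z1 : ~ 1 <= z.
  move=> /zP; rewrite mul1r exprN1 => St; case/eqP: (oner_neq0 E); apply: S_sep => // a.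
  by rewrite mul1r -exprVn; exact: subringX.
rewrite zE; have -> : z = 0 by move: z0 z1; clear; lia.
exact: expr0z.
Qed.

Lemma gauge_bounded_scale (u : E) z : S (u * tau ^ (- z)) -> gauge_bounded u.
Proof.
move=> Su; exists `|z|%N.
have -> : tau ^+ `|z| * u = u * tau ^ (- z) * tau ^ (`|z|%:Z + z).
  by rewrite -mulrA -expfzDr // addrCA addNr addr0 mulrC.
apply: (subringM sS) => //; have : 0 <= `|z|%:Z + z by clear; lia.
by case: (_ + z) => // k _; exact: subringX.
Qed.

Lemma gauge_scale_le (u x : E) z : gauge_bounded x -> S (u * tau ^ (- z)) ->
  gauge (u * x) <= r ^ z * gauge x.
Proof.
move=> bx Su; have [->|x0] := eqVneq x 0; first by rewrite !mulr0 gauge0 mulr0.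
have bu := gauge_bounded_scale Su.
have [w [xE wP]] := gauge_value bx x0.
rewrite xE -expfzDr ?lt0r_neq0 //; apply/gauge_le; first exact: gauge_boundedM.
by rewrite opprD expfzDr // mulrACA; apply: (subringM sS) => //; exact/wP.
Qed.

Lemma gauge_scale (u x : E) z : gauge_bounded x -> u != 0 ->
  S (u * tau ^ (- z)) -> S (u^-1 * tau ^ z) -> gauge (u * x) = r ^ z * gauge x.
Proof.
move=> bx u0 Su Su'; apply/eqP; rewrite eq_le gauge_scale_le //=.
have rz : 0 < r ^ z by rewrite exprz_gt0.
have bu : gauge_bounded (u * x).
  by apply: gauge_boundedM => //; exact: gauge_bounded_scale Su.
have := @gauge_scale_le u^-1 (u * x) (- z) bu; rewrite opprK mulKf // => /(_ Su').
by rewrite -invr_expz mulrC ler_pdivlMr // mulrC.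
Qed.

End GaugeNorm.

(** * Strict presentations *)

Section StrictPresentation.
Variables (R : realType) (K : fieldType) (abs : nonarch_absval R K).
Hypothesis abs_complete : complete_for abs.
Variables (B : comNzRingType) (iota : {rmorphism K -> B}) (N : B -> R).
Hypothesis N_iota : forall c x, N (iota c * x) = abs c * N x.

(** psi is a contraction and elements lift without increase of norm, so N is the quotient norm
    modulo the kernel of psi, and that quotient gives the presentation. *)
Lemma induces_topology_of_strict n (psi : {rmorphism tate abs n -> B}) : unorm N ->
  (forall c, psi (tateC abs n c) = iota c) ->
  (forall f, N (psi f) <= gauss_norm f) ->
  (forall b, exists f, psi f = b /\ gauss_norm f <= N b) ->
  induces_canonical_topology abs iota N.
Proof.
move=> uN psiC psi_le psi_strict.
pose I0 : {pred tate abs n} := [pred f | psi f == 0].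
have I0P : idealr_closed I0.
  split=> [||a u v]; rewrite ?inE /= ?rmorph0 ?rmorph1 ?oner_neq0 //.
  by move=> /eqP u0 /eqP v0; rewrite rmorphD rmorphM u0 v0 mulr0 addr0.
pose A1 := isIdealr.Build _ I0 I0P.
pose I : idealr (tate abs n) := HB.pack I0 A1.
pose phi (q : {ideal_quot I}) : B := psi (repr q).
have phiE f : phi (\pi_{ideal_quot I}%qT f) = psi f.
  rewrite /phi; apply/eqP; rewrite -subr_eq0 -rmorphB.
  have := Quotient.idealrBE I (repr (\pi_{ideal_quot I}%qT f)) f.
  by rewrite reprK eqxx.
have phiB : zmod_morphism phi.
  move=> x y; rewrite -[x]reprK -[y]reprK -rmorphB !phiE; exact: rmorphB.
have phiM : monoid_morphism phi.
  split=> [|x y]; first by rewrite -(rmorph1 (\pi_{ideal_quot I}%qT)) phiE rmorph1.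
  rewrite -[x]reprK -[y]reprK -rmorphM !phiE; exact: rmorphM.
pose H1 := GRing.isZmodMorphism.Build _ _ phi phiB.
pose H2 := GRing.isMonoidMorphism.Build _ _ phi phiM.
pose phiR : {rmorphism {ideal_quot I} -> B} := HB.pack phi H1 H2.
exists n, I, phiR; split; first split.
- have /choice[g gP] : forall b, exists f, psi f = b.
    by move=> b; have [f [fb _]] := psi_strict b; exists f.
  exists (fun b => \pi_{ideal_quot I}%qT (g b)) => [q|b]; last by rewrite /= phiE.
  rewrite -[q]reprK; apply/eqP; rewrite -Quotient.idealrBE inE /= rmorphB subr_eq0.
  by rewrite gP phiE.
- by move=> c; rewrite /= phiE.
move=> U; split=> [oU f /=|oU b Ub].
  rewrite phiE => /oU[e e0 eU]; exists e => // g /= ge; rewrite phiE; apply: eU.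
  by rewrite -rmorphB (le_lt_trans (psi_le _)).
have [f [fb _]] := psi_strict b.
have [|e e0 eU] := oU f; first by rewrite /= phiE fb.
exists e => // b' be; have [g [gb gN]] := psi_strict (b' - b).
have := eU (g + f); rewrite addrK /= phiE rmorphD gb fb subrK; apply.
exact: le_lt_trans be.
Qed.

Variables (d s : nat) (chi : {rmorphism tate abs d -> B}) (g : 'I_s -> B).
Hypothesis chi_tateC : forall c, chi (tateC abs d c) = iota c.
Hypothesis chi_le : forall f, N (chi f) <= gauss_norm f.
Hypothesis g_le1 : forall i, N (g i) <= 1.
Hypothesis chi_lift : forall b, exists f : 'I_s -> tate abs d,
  b = \sum_i chi (f i) * g i /\ forall i, gauss_norm (f i) <= N b.

(** Differences of consecutive terms of a Cauchy sequence lift to null sequences of coefficients,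
    which are summed in T_d. The properties of N are listed separately because [unorm] includes
    completeness. *)
Lemma complete_of_lift :
  (forall x y, N (x + y) <= Num.max (N x) (N y)) -> (forall x, N (- x) = N x) ->
  (forall x y, N (x * y) <= N x * N y) -> N 0 = 0 -> complete_for N.
Proof.
move=> ND NN NM N0 u cu; have gU := unorm_gauss d abs_complete.
have N_ge0 x : 0 <= N x by have := ND x (- x); rewrite subrr N0 NN maxxx.
have sum_le (F : 'I_s -> B) (M : R) : 0 <= M -> (forall i, N (F i) <= M) ->
    N (\sum_i F i) <= M.
  move=> M0 FM; apply: (big_ind (fun x => N x <= M)) => [|x y xM yM|i _] //.
    by rewrite N0.
  by rewrite (le_trans (ND _ _)) // ge_max xM yM.
have /choice[F FP] := fun k => chi_lift (u k.+1 - u k).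
have Fnull i : null_seq (@gauss_norm R K abs d) (fun k => F k i).
  move=> e e0; have [k ke] := cu e e0; exists k => l kl; rewrite subr0.
  by rewrite (le_lt_trans ((FP l).2 i)) // ke // ltnW.
pose f i := ssum (@gauss_norm R K abs d) (fun k => F k i).
have uE k : u k = u 0%N + \sum_i chi (\sum_(l < k) F l i) * g i.
  elim: k => [|k IH].
    by rewrite big1 ?addr0 // => i _; rewrite big_ord0 rmorph0 mul0r.
  rewrite -[LHS](subrK (u k)) (FP k).1 IH addrCA; congr (_ + _).
  rewrite -big_split; apply: eq_bigr => i _ /=.
  by rewrite big_ord_recr rmorphD mulrDl addrC.
exists (u 0%N + \sum_i chi (f i) * g i) => e e0.
have fcv i : exists k0, forall k, (k0 <= k)%N ->
    gauss_norm (\sum_(l < k) F l i - f i) < e.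
  exact: (null_summable gU (Fnull i)).
have /choice[k0 kP] := fcv; exists (\max_i k0 i)%N => k kk.
rewrite uE opprD addrACA subrr add0r -sumrB.
apply: (big_ind (fun x => N x < e)) => [|x y xe ye|i _]; first by rewrite N0.
  by rewrite (le_lt_trans (ND _ _)) // gt_max xe ye.
rewrite -mulrBl -rmorphB (le_lt_trans (NM _ _)) // -[ltRHS]mulr1.
apply: le_lt_trans (ler_wpM2l (N_ge0 _) (g_le1 i)) _.
rewrite !mulr1 (le_lt_trans (chi_le _)) // kP // (leq_trans _ kk) //.
exact: leq_bigmax.
Qed.

(** The first d variables go to the chi-images of the variables of T_d and the last s to the g i;
    the lift of b is linear in the last s variables. *)
Lemma strict_surjection : unorm N -> exists psi : {rmorphism tate abs (d + s) -> B},
  [/\ forall c, psi (tateC abs (d + s) c) = iota c,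
      forall f, N (psi f) <= gauss_norm f
    & forall b, exists f, psi f = b /\ gauss_norm f <= N b].
Proof.
move=> uN; have gU := unorm_gauss (d + s) abs_complete.
pose b (i : 'I_(d + s)) : B :=
  match fintype.split i with inl i => chi (tvar abs i) | inr i => g i end.
have b1 i : N (b i) <= 1.
  rewrite /b; case: fintype.split => // l.
  by rewrite (le_trans (chi_le _)) // gauss_mono absval1.
have [psi [psiC psiV psi_le]] := tate_universal abs_complete uN N_iota b1.
exists psi; split=> // x.
have v1 (i : 'I_d) : gauss_norm (tvar abs (lshift s i)) <= 1.
  by rewrite gauss_mono absval1.
have [e [eC eV e_le]] := tate_universal abs_complete gU
  (iota := tateC abs (d + s)) (gauss_tateC abs_complete) v1.
have eE f : psi (e f) = chi f.
  have := @tate_hom_ext _ _ _ _ abs_complete _ _ uN (psi \o e) chi 1 ltr01.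
  apply=> [h|h|c|i] /=.
  - by rewrite mul1r (le_trans (psi_le _)).
  - by rewrite mul1r.
  - by rewrite eC psiC chi_tateC.
  - by rewrite eV psiV /b (unsplitK (inl i)).
have [f [xE fx]] := chi_lift x.
exists (\sum_i e (f i) * tvar abs (rshift d i)); split.
  rewrite rmorph_sum xE; apply: eq_bigr => i _.
  by rewrite rmorphM /= eE psiV /b (unsplitK (inr i)).
apply: (unorm_sum_le gU) => [|i _]; first exact: unorm_ge0 uN _.
rewrite (le_trans (unormM gU _ _)) // gauss_mono absval1 mulr1.
by rewrite (le_trans (e_le _)).
Qed.

End StrictPresentation.

(** * The normalization of an affinoid domain *)

Section NormalizationOfAffinoid.
Variables (R : realType) (K : fieldType) (abs : nonarch_absval R K).
Hypothesis abs_nontrivial : nontrivial_absval abs.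
Hypothesis abs_complete : complete_for abs.
Variables (A : idomainType) (iota : {rmorphism K -> A}).
Variables (n : nat) (Pi : {rmorphism tate abs n -> A}).
Hypothesis Pi_tateC : forall c, Pi (tateC abs n c) = iota c.
Hypothesis Pi_surj : forall a, exists f, Pi f = a.
Variables (d : nat) (chi : {rmorphism tate abs d -> A}).
Variables (j : {rmorphism {fraction tate abs d} -> {fraction A}}) (m : nat).
Hypothesis chi_tateC : forall c, chi (tateC abs d c) = iota c.
Hypothesis jE : forall f, j (tofrac f) = tofrac (chi f).
Hypothesis fin : finite_over j m.
Local Notation E := {fraction A}.
Implicit Types x y : E.

Lemma rint_integral x : rint x -> integralOver (@tofrac A) x.
Proof.
move=> xO; have [p [pm _ px _ _]] := rint_minimal_polynomial abs_complete fin xO.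
exists (map_poly chi p); first exact: monic_map.
rewrite -map_poly_comp; move: px; rewrite -map_poly_comp.
by rewrite (eq_map_poly (g := @tofrac A \o chi)) // => f /=; rewrite jE.
Qed.

(** A power of t turns the coefficients of an integral equation into images of elements of Gauss
    norm at most 1, which lie in every valuation ring. Thus B is contained in S[1/t]. *)
Lemma integral_scale (t : K) x : t != 0 -> abs t < 1 -> integralOver (@tofrac A) x ->
  exists k : nat, rint (tofrac (iota (t ^+ k)) * x).
Proof.
move=> t0 t1 [p pm px]; have at1 := ltW t1.
have scal k : rint (tofrac (iota (t ^+ k))).
  rewrite -Pi_tateC -[tofrac _]/((@tofrac A \o Pi) _).
  apply: (rint_gauss abs_nontrivial abs_complete).
  by rewrite tateCE gauss_mono absvalX exprn_ile1 ?absval_ge0.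
have /choice[kf kfP] : forall a : A, exists k : nat, forall l, (k <= l)%N ->
    rint (tofrac (iota (t ^+ l)) * tofrac a).
  move=> a; have [f <-] := Pi_surj a.
  have [k kP] := geom_small (gauss_norm f) (absval_ge0 abs t) t1 ltr01.
  exists k => l kl; rewrite -Pi_tateC -tofracM -rmorphM.
  rewrite -[tofrac _]/((@tofrac A \o Pi) _).
  apply: (rint_gauss abs_nontrivial abs_complete).
  rewrite gauss_tateC // absvalX mulrC; apply: le_trans (ltW kP).
  by rewrite ler_wpM2l ?gauss_ge0 ?ler_wiXn2l ?absval_ge0.
pose k := \max_(i < size p) kf (p`_i)%R; exists k => lam lamP.
apply: (vring_integral_scale (p := map_poly (@tofrac A) p)) => //.
- exact: vring_rval.
- exact: monic_map.
- exact: scal.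
move=> i; rewrite coef_map size_mapF => /leq_trans/(_ (leq_pred _)) ip.
apply: kfP => //; exact: (leq_bigmax (Ordinal ip) (F := fun i : 'I_(size p) => kf (p`_i)%R)).
Qed.

Lemma integral_rint x : ~ discretely_valued abs -> integralOver (@tofrac A) x -> rint x.
Proof.
move=> ndisc xint; have [t [t0 _ t1]] := nontrivial_small abs_nontrivial.
have [k kO] := integral_scale t0 t1 xint.
move=> lam lamP x0; have tk : t ^+ k != 0 by rewrite expf_neq0.
have h0 : tofrac (iota (t ^+ k)) != 0 by rewrite tofrac_eq0 fmorph_eq0.
have lt0 : lam (tofrac (iota (t ^+ k))) = 0.
  apply/eqP; apply: contrapT => /negP lt0; apply: ndisc.
  exact: (rval_scalar (h := @tofrac A \o iota) abs_nontrivial abs_complete lamP tk lt0).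
have := kO _ lamP; rewrite /rval_ring /= (rvalM lamP) // lt0 add0r.
by apply; rewrite mulf_neq0.
Qed.

Section DiscretelyValued.
Variable t : K.
Hypotheses (t0 : t != 0) (t1 : abs t < 1).
Hypothesis tP : forall c, c != 0 -> exists z : int, abs c = abs t ^ z.
Local Notation T := (tate abs d).
Local Notation J := (fun f : T => j (tofrac f)).
Let at0 : 0 < abs t := absval_gt0 abs t0.
Let tau : E := tofrac (iota t).

Let DS (f : T) : gauss_norm f <= 1 -> @rint E (J f).
Proof.
rewrite -[X in rint X]/((j \o @tofrac T) f) => f1.
exact: (rint_gauss abs_nontrivial abs_complete f1).
Qed.

Let S_lead x : rint x -> x != 0 -> exists c, elead (abs := abs) t j m x c.
Proof.
move=> xO x0; have [p [pm sp px pmin pO]] := rint_minimal_polynomial abs_complete fin xO.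
apply: (elead_exists abs_complete t0 t1 tP x0 pm (leqW sp) _ px pmin) => i.
have [->|pi0] := eqVneq p`_i 0.
  by rewrite (unorm_0 (unorm_gauss d abs_complete)) ler01.
have [lam [lamP lamE]] := gauss_rval abs_complete d t0 t1 tP.
have [lam' [lamP' lamE']] := rval_fraction lamP.
have := pO _ lamP' i; rewrite /rval_ring /= tofrac_eq0 lamE' // => /(_ pi0) lpi.
by rewrite lamE // -[leRHS](expr0z (abs t)) ler_iXz2l.
Qed.

Lemma JtateC c : j (tofrac (tateC abs d c)) = tofrac (iota c).
Proof. by rewrite jE chi_tateC. Qed.

Let tau0 : tau != 0. Proof. by rewrite tofrac_eq0 fmorph_eq0. Qed.

Let S_scalar c : abs c <= 1 -> @rint E (tofrac (iota c)).
Proof. by move=> c1; rewrite -JtateC; apply: DS; rewrite tateCE gauss_mono. Qed.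

Let tauX (a : nat) : tau ^+ a = tofrac (iota (t ^+ a)).
Proof. by rewrite rmorphXn tofracXn. Qed.

Let S_sep x : rint x -> (forall a : nat, rint (x / tau ^+ a)) -> x = 0.
Proof.
move=> xO xa; apply: (separated_by_level t0 t1 S_lead xO) => a.
by exists (x / tau ^+ a) => //; rewrite JtateC -tauX mulrC divfK // expf_neq0.
Qed.

Let sS := @subring_rint E.
Let Stau : rint tau := S_scalar (ltW t1).
Local Notation G := (gauge (abs t) (@rint E) tau).
Local Notation bnd := (gauge_bounded (@rint E) tau).
Local Notation B := (normalization A).
Local Notation iotaB := (normalization_scalar iota).
Let N (b : B) : R := G (val b).

Let bndB (b : B) : bnd (val b).
Proof.
have [k kO] := integral_scale t0 t1 (asboolP _ (valP b)).
by exists k; rewrite tauX.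
Qed.

Let tauXz z : tau ^ z = tofrac (iota (t ^ z)).
Proof. by rewrite -[RHS]/((@tofrac A \o iota) _) rmorphXz ?unitfE. Qed.

Let scalar_tau c z : abs c = abs t ^ z -> @rint E (tofrac (iota c) * tau ^ (- z)).
Proof.
move=> cz; rewrite tauXz -tofracM -rmorphM; apply: S_scalar.
by rewrite absvalM absvalXz cz -expfzDr ?lt0r_neq0 // subrr expr0z.
Qed.

(** Equality holds because |c| is a power |t|^z: both c t^-z and its inverse lie in S. *)
Let N_iota c b : N (iotaB c * b) = abs c * N b.
Proof.
have [->|c0] := eqVneq c 0.
  by rewrite rmorph0 mul0r absval0 mul0r /N /= gauge0.
have [z cz] := tP c0; rewrite /N cz.
apply: (gauge_scale at0 t1 sS tau0 Stau S_sep) => //.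
- by rewrite tofrac_eq0 fmorph_eq0.
- exact: scalar_tau.
have -> : (val (iotaB c))^-1 = tofrac (iota c^-1).
  by rewrite -[RHS]/((@tofrac A \o iota) _) fmorphV.
by rewrite -[X in tau ^ X]opprK; apply: scalar_tau; rewrite absvalV cz invr_expz.
Qed.

Let chiB : {rmorphism T -> B} := @to_normalization A \o chi.

Let chiB_le f : N (chiB f) <= gauss_norm f.
Proof.
have [->|f0] := eqVneq f 0.
  by rewrite rmorph0 /N /= gauge0 gauss_ge0.
have [lam [_ lamE]] := gauss_rval abs_complete d t0 t1 tP; rewrite lamE //.
apply/(gauge_le at0 t1 sS tau0 Stau S_sep) => //.
rewrite /= -jE tauXz -JtateC -rmorphM -tofracM; apply: DS.
rewrite mulrC gauss_tateC // absvalXz lamE // -expfzDr ?lt0r_neq0 //.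
by rewrite addNr expr0z.
Qed.

(** If N b = |t|^z, then t^-z b is in S; its coefficients over the generators of S have norm at most
    1 and are multiplied by t^z. *)
Let chiB_lift : exists s (g : 'I_s -> B), (forall i, N (g i) <= 1) /\
  forall b, exists f : 'I_s -> T,
    b = \sum_i chiB (f i) * g i /\ forall i, gauss_norm (f i) <= N b.
Proof.
have [s [g [gS gen]]] := finitely_generated abs_complete t0 t1 fin sS DS S_lead.
pose gB (i : 'I_s) : B :=
  Normalization (asboolT (rint_integral (gS i (ltn_ord i)))).
exists s, gB; split=> [i|b].
  by apply/(gauge_le1 at0 t1 sS tau0 Stau S_sep) => //; exact: (gS i (ltn_ord i)).
have [b0|b0] := eqVneq (val b) 0.
  exists (fun=> 0); split=> [|i]; last first.
    by rewrite (unorm_0 (unorm_gauss d abs_complete)) /N b0 gauge0.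
  apply: val_inj; rewrite b0 big1 // => i _; by rewrite (rmorph0 chiB) mul0r.
have [z [bz zP]] := gauge_value (abs t) sS tau0 Stau S_sep (bndB b) b0.
have [f [f1 fE]] := gen _ ((zP z).2 (lexx z)).
exists (fun i => tateC abs d (t ^ z) * f i); split=> [|i]; last first.
  rewrite gauss_tateC // absvalXz /N bz -[leRHS]mulr1 ler_wpM2l //.
  by rewrite exprz_ge0 // ltW.
apply: val_inj; rewrite -[val b](divfK (expfz_neq0 z tau0)) invr_expz fE.
rewrite mulr_suml raddf_sum; apply: eq_bigr => i _.
by rewrite /= -jE tofracM rmorphM JtateC -tauXz mulrAC [_ * tau ^ z]mulrC.
Qed.

Lemma rint_power_bounded x : rint x ->
  exists2 b : B, power_bounded abs iotaB b & val b = x.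
Proof.
move=> xO; pose b : B := Normalization (asboolT (rint_integral xO)).
exists b => //; have [s [g [g1 lift]]] := chiB_lift.
have ND b1 b2 : N (b1 + b2) <= Num.max (N b1) (N b2).
  exact: (gaugeD at0 t1 sS tau0 Stau S_sep).
have NN b1 : N (- b1) = N b1 by exact: (gaugeN (abs t) tau sS).
have NM b1 b2 : N (b1 * b2) <= N b1 * N b2.
  exact: (gaugeM_le at0 t1 sS tau0 Stau S_sep).
have N0 b1 : N b1 = 0 <-> b1 = 0.
  rewrite /N (gauge_eq0 at0 sS tau0 Stau S_sep (bndB b1)).
  by split=> [b0|->]; [apply: val_inj|].
have N1 : N 1 = 1 by exact: (gauge1 (abs t) sS tau0 Stau S_sep).
have chiBC c : chiB (tateC abs d c) = iotaB c by rewrite /= chi_tateC.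
have Nc : complete_for N.
  by apply: (complete_of_lift abs_complete chiB_le g1 lift) => //; exact/N0.
have uN : unorm N by split.
have [psi [psiC psi_le psi_strict]] :=
  strict_surjection abs_complete N_iota chiBC chiB_le g1 lift uN.
exists N; split; first by split.
  exact: (induces_topology_of_strict uN psiC psi_le psi_strict).
exists 1 => _ [k _ <-].
apply: (gauge_le1 at0 t1 sS tau0 Stau S_sep (bndB (b ^+ k))).2.
by rewrite rmorphXn; exact: (subringX sS).
Qed.

End DiscretelyValued.

Lemma power_bounded_rint (b : normalization A) :
  power_bounded abs (normalization_scalar iota) b -> rint (val b).
Proof.
move=> [N [[N0 ND [N1 NM] Nc Ncomp] _ [M NX]]].
have NN (c : normalization A) : N (- c) = N c.
  have -> : - c = normalization_scalar iota (- 1) * c by rewrite rmorphN1 mulN1r.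
  by rewrite Nc absvalN absval1 mul1r.
have uN : unorm N by split.
pose v : {rmorphism normalization A -> E} := val.
apply: (rint_bounded abs_nontrivial (h := v) (M := M) uN Nc) => k.
by apply: NX; exists k.
Qed.

End NormalizationOfAffinoid.

Theorem theorem1p1 (R : realType) (K : fieldType) (abs : nonarch_absval R K)
    (abs_nontrivial : nontrivial_absval abs) (abs_complete : complete_for abs)
    (A : idomainType) (iota : {rmorphism K -> A})
    (A_affinoid : affinoid abs iota) :
  (discretely_valued abs ->
     \bigcap_(v in @discrete_valuations {fraction A}) valuation_ring v =
     @normalization_val A @` power_bounded abs (normalization_scalar iota)) /\
  (~ discretely_valued abs ->
     \bigcap_(v in @discrete_valuations {fraction A}) valuation_ring v =
     range (@normalization_val A)).
Proof.
have [n [I [phi [[phi' phiK phi'K] phiC]]]] := A_affinoid.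
pose Pi : {rmorphism tate abs n -> A} := phi \o \pi_{ideal_quot I}%qT.
have PiC c : Pi (tateC abs n c) = iota c by rewrite /= phiC.
have Pi_surj a : exists f, Pi f = a.
  by exists (repr (phi' a)); rewrite /= reprK phi'K.
have [d [chi [J [b [chi_inj chiC span]]]]] := noether_normalization abs_complete Pi.
have tchi_inj : injective (@tofrac A \o chi).
  by apply: inj_comp => //; exact: tofrac_inj.
have [j jE] := frac_lift tchi_inj.
have fin : finite_over j #|J|.
  apply: (finite_over_span (chi := chi) (b := b)) => [x|x]; first exact: jE.
  by have [f <-] := Pi_surj x; exact: span.
have chiC' c : chi (tateC abs d c) = iota c by rewrite chiC PiC.
rewrite bigcap_valuation_ring; split=> disc; apply/seteqP; split=> x.
- have [t [t0 t1 tP]] := uniformizer disc.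
  move=> /(rint_power_bounded abs_nontrivial abs_complete PiC Pi_surj chiC' jE fin t0 t1 tP).
  by move=> [y yO <-]; exists y.
- by move=> [y yO <-]; exact: (power_bounded_rint abs_nontrivial yO).
- by move=> /(rint_integral abs_complete jE fin) xint; exists (Normalization (asboolT xint)).
- move=> [y _ <-].
  by apply: (integral_rint abs_nontrivial abs_complete PiC Pi_surj disc); exact/asboolP/(valP y).
Qed.
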